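(* There exists a sequence of bounded Lipschitz domains $\Omega_k\subseteq \mathbb{R}^2$, $k\ge 1$, such that $\frac{D(\Omega_k)}{\sqrt{|\Omega_k|}}\to\infty$ as $k\to\infty$ while $N(\Omega_k)$ is uniformly bounded above in $k$.
   Context: For a bounded Lipschitz domain $\Omega\subseteq\mathbb{R}^2$, let $0=\mu_1<\mu_2\leq\dots$ (resp. $0<\lambda_1<\lambda_2\leq\dots$) be the eigenvalues, counted with multiplicity, of the (positive) Laplacian $-\Delta$ on $\Omega$ with Neumann (resp. Dirichlet) boundary conditions, and set $N(\Omega):=\#\{j\mid \mu_j\leq\lambda_1\}$. $|\Omega|$ is the area of $\Omega$, and $D(\Omega)$ is its diameter, i.e. the supremum of Euclidean distances between pairs of points in $\Omega$. *)

(* Defs.v *)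
From HB Require Import structures.
From mathcomp Require Import all_boot all_order all_algebra.
From mathcomp Require Import all_classical all_reals all_analysis.

Set Implicit Arguments.
Unset Strict Implicit.
Unset Printing Implicit Defensive.

Import Order.TTheory GRing.Theory Num.Theory.
Import numFieldNormedType.Exports.

Local Open Scope classical_set_scope.
Local Open Scope ring_scope.

(* The plane is R * R. Its library norm is the sup norm, which induces the
   usual topology and bounded sets; Euclidean distance is defined below. *)

Section plane.
Context {R : realType}.

Definition lebesgue2 :
    {measure set (measurableTypeR R * measurableTypeR R) -> \bar R} :=
  (@lebesgue_measure R \x @lebesgue_measure R)%E.

Definition area (Omega : set (R * R)) : R := fine (lebesgue2 Omega).

Definition euclidean_dist (p q : R * R) : R :=
  Num.sqrt ((p.1 - q.1) ^+ 2 + (p.2 - q.2) ^+ 2).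

Definition diameter (Omega : set (R * R)) : R :=
  sup [set euclidean_dist pq.1 pq.2 | pq in Omega `*` Omega].

(* Near each boundary point, in coordinates rotated by the angle with cosine c
   and sine s, Omega is the open region above the graph of a Lipschitz
   function gamma. *)
Definition lipschitz_boundary (Omega : set (R * R)) : Prop :=
  forall p, (closure Omega `\` Omega°) p ->
  exists c s : R, exists gamma : R -> R,
    [/\ c ^+ 2 + s ^+ 2 = 1, lipschitz gamma &
        \forall x \near p,
          Omega x <-> gamma (c * x.1 + s * x.2) < c * x.2 - s * x.1].

Definition bounded_lipschitz_domain (Omega : set (R * R)) : Prop :=
  [/\ Omega !=set0, open Omega, connected Omega, bounded_set Omega &
      lipschitz_boundary Omega].

Definition e1 : R * R := (1, 0).
Definition e2 : R * R := (0, 1).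

Fixpoint Ck (n : nat) (phi : R * R -> R) : Prop :=
  if n is m.+1 then
    [/\ continuous phi,
        (forall x, derivable phi x e1), Ck m (fun x => 'D_e1 phi x),
        (forall x, derivable phi x e2) & Ck m (fun x => 'D_e2 phi x)]
  else continuous phi.

Definition test_function (Omega : set (R * R)) (phi : R * R -> R) : Prop :=
  [/\ forall n, Ck n phi,
      compact (closure [set x | phi x != 0]) &
      closure [set x | phi x != 0] `<=` Omega].

Definition L2 (Omega : set (R * R)) (u : R * R -> R) : Prop :=
  @measurable_fun _ _ (measurableTypeR R * measurableTypeR R)%type R Omega u /\
  (\int[lebesgue2]_(x in Omega) (u x ^+ 2)%:E < +oo)%E.

Definition weak_derivative (Omega : set (R * R)) (v : R * R)
    (u g : R * R -> R) : Prop :=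
  forall phi, test_function Omega phi ->
    \int[lebesgue2]_(x in Omega) (u x * 'D_v phi x) =
    - \int[lebesgue2]_(x in Omega) (g x * phi x).

(* u is in H^1(Omega), and (g1, g2) represents its weak gradient. *)
Definition H1 (Omega : set (R * R)) (u g1 g2 : R * R -> R) : Prop :=
  [/\ L2 Omega u, L2 Omega g1, L2 Omega g2,
      weak_derivative Omega e1 u g1 & weak_derivative Omega e2 u g2].

(* H^1_0(Omega): the closure of the test functions in H^1(Omega). *)
Definition H10 (Omega : set (R * R)) (u g1 g2 : R * R -> R) : Prop :=
  H1 Omega u g1 g2 /\
  forall eps : R, 0 < eps -> exists2 phi, test_function Omega phi &
    (\int[lebesgue2]_(x in Omega)
       ((u x - phi x) ^+ 2 + (g1 x - 'D_e1 phi x) ^+ 2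
        + (g2 x - 'D_e2 phi x) ^+ 2)%:E < eps%:E)%E.

Section spectrum.
(* dom u g1 g2: u is in the form domain, with weak gradient (g1, g2).
   The self-adjoint realization of the Laplacian is given by its quadratic
   form: the form domain H1 is the Neumann Laplacian, H10 the Dirichlet one. *)
Variables (Omega : set (R * R))
          (dom : (R * R -> R) -> (R * R -> R) -> (R * R -> R) -> Prop).

Definition eigenspace (t : R) : set (R * R -> R) :=
  [set u | exists g1 g2, dom u g1 g2 /\
    forall v h1 h2, dom v h1 h2 ->
      \int[lebesgue2]_(x in Omega) (g1 x * h1 x + g2 x * h2 x) =
      t * \int[lebesgue2]_(x in Omega) (u x * v x)].

(* Linear independence in L^2(Omega), i.e. modulo a.e. equality. *)
Definition ae_linearly_independent (n : nat) (u : 'I_n -> R * R -> R) : Prop :=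
  forall c : 'I_n -> R,
    {ae lebesgue2, forall x, Omega x -> \sum_(i < n) c i * u i x = 0} ->
    forall i, c i = 0.

(* The dimension of the eigenspace in L^2(Omega); 0 if t is not an
   eigenvalue. *)
Definition multiplicity (t : R) : \bar R :=
  ereal_sup [set n%:R%:E | n in [set n : nat |
    exists u : 'I_n -> R * R -> R,
      (forall i, eigenspace t (u i)) /\ ae_linearly_independent u]].

Definition eigenvalue_count (t : R) : \bar R :=
  \esum_(s in [set s : R | s <= t]) multiplicity s.

(* The j-th eigenvalue (j >= 1) in nondecreasing order, each repeated
   according to multiplicity: the smallest t such that at least j eigenvalues
   are <= t. It is +oo if there are fewer than j eigenvalues. *)
Definition nth_eigenvalue (j : nat) : \bar R :=
  ereal_inf [set t%:E | t in [set t : R | (j%:R%:E <= eigenvalue_count t)%E]].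

End spectrum.

Definition neumann_eigenvalue (Omega : set (R * R)) (j : nat) : \bar R :=
  nth_eigenvalue Omega (H1 Omega) j.

Definition dirichlet_eigenvalue (Omega : set (R * R)) (j : nat) : \bar R :=
  nth_eigenvalue Omega (H10 Omega) j.

(* N(Omega) = #{j >= 1 | mu_j <= lambda_1}. *)
Definition neumann_count (Omega : set (R * R)) : \bar R :=
  counting [set j : nat | (1 <= j)%N /\
    (neumann_eigenvalue Omega j <= dirichlet_eigenvalue Omega 1)%E].

End plane.

(* Main.v *)
(* Omega_k is a square of fixed side S with a tail of k + 1 unit-length boxes of
   heights 1, 1/4, ..., 4^-k attached: its area stays bounded while its diameter
   tends to infinity.  Local Poincare inequalities on the unit cells, and the
   fact that the heights decay faster than the cell averages can grow along the
   tail, give int u^2 <= C int |grad u|^2 + 4 sum_q c_q(u)^2, where q runs over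
   the S^2 + 1 unit cells in the square and at the mouth of the tail, c_q is a
   smooth average over q, and C depends neither on S nor on k.  Hence at most
   S^2 + 1 Neumann eigenvalues are below 1 / C.  A plateau supported in the
   square has Rayleigh quotient O(1 / S^2), which is below 1 / C for S large;
   the same inequality then makes minimizing sequences in H^1_0 compact, so that
   lambda_1 is attained and is below 1 / C.  As weak derivatives are only tested
   against smooth functions, the Poincare inequalities are proved by duality:
   each tensor product f of test functions on a box is the sum of a multiple of
   a bump and of the divergence of an explicit test field bounded by f in L^2. *)
Require Import Defs.
From mathcomp Require Import all_boot all_order all_algebra.
From mathcomp Require Import all_classical all_reals all_analysis.
From mathcomp Require Import measurable_realfun ring lra.

Set Implicit Arguments.
Unset Strict Implicit.
Unset Printing Implicit Defensive.

Import Order.TTheory GRing.Theory Num.Theory.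
Import numFieldNormedType.Exports.

Local Open Scope classical_set_scope.
Local Open Scope ring_scope.

(** * Positive semidefinite forms on a real vector space *)

Section forms.
Context {R : realType} {V : lmodType R}.
Implicit Types (D : set V) (a b e : V -> V -> R) (u v w : V) (k t : R).

(** By definition [dirichlet_eigenvalue Om 1] is +oo when no eigenvalue exists, and then
    [neumann_count] is not bounded by the gap inequality. A trial function of small Rayleigh
    quotient is therefore not enough: an eigenfunction in [H10] must be produced. The gap inequality
    serves both ends, since finitely many functionals control what the gradient does not; this
    replaces compact embeddings and the spectral theorem. The square is there to bring lambda_1
    below 1 / C, and the argument is not circular because C is fixed before S: it comes from cells
    of side at most 1 and from one constant [N], a bound for the derivative of a fixed smooth step.
    Thin cells cost nothing, because in the Poincare inequality the powers of the sides either
    cancel or are positive. The decay is dictated by (c + d)^2 <= 2 c^2 + 2 d^2: passing to the next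
    cell may double the squared average, so the cell areas must shrink by more than a factor 2. The
    ratio 1/4 leaves a factor 2 to sum, and keeps the jump estimate, weighted by the smaller height,
    free of that height. *)

Definition subspace D := D 0 /\ forall k u v, D u -> D v -> D (k *: u + v).

(** Linearity is asked only on [D]: an integral of products is not additive for functions outside
    L^2. *)
Definition linear_on D (l : V -> R) :=
  forall k u v, D u -> D v -> l (k *: u + v) = k * l u + l v.

Definition psd_form D a :=
  [/\ forall u v, D u -> D v -> a u v = a v u,
      forall w, D w -> linear_on D (a^~ w) &
      forall u, D u -> 0 <= a u u].

Lemma subspaceD D u v : subspace D -> D u -> D v -> D (u + v).
Proof. by move=> [_ DD] Du Dv; rewrite -[u]scale1r; apply: DD. Qed.

Lemma subspaceZ D k u : subspace D -> D u -> D (k *: u).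
Proof. by move=> [D0 DD] Du; rewrite -[X in D X]addr0; apply: DD. Qed.

Lemma subspaceB D u v : subspace D -> D u -> D v -> D (u - v).
Proof.
by move=> sD Du Dv; apply: subspaceD => //; rewrite -scaleN1r; apply: subspaceZ.
Qed.

Lemma subspace_sum D (I : finType) (u : I -> V) : subspace D ->
  (forall i, D (u i)) -> D (\sum_i u i).
Proof.
move=> sD Du; elim/big_ind: _ => //; first by case: sD.
by move=> x y; exact: subspaceD.
Qed.

Section linear_on.
Variables (D : set V) (l : V -> R).
Hypotheses (sD : subspace D) (lin : linear_on D l).

Lemma linear_on0 : l 0 = 0.
Proof.
have [D0 _] := sD; have := lin 1 D0 D0.
by rewrite scale1r addr0 mul1r; lra.
Qed.

Lemma linear_onD u v : D u -> D v -> l (u + v) = l u + l v.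
Proof. by move=> Du Dv; rewrite -{1}[u]scale1r lin// mul1r. Qed.

Lemma linear_onZ k u : D u -> l (k *: u) = k * l u.
Proof.
by have [D0 _] := sD; move=> Du; rewrite -[X in l X]addr0 lin// linear_on0 addr0.
Qed.

Lemma linear_onB u v : D u -> D v -> l (u - v) = l u - l v.
Proof.
move=> Du Dv; rewrite linear_onD//; last by rewrite -scaleN1r; apply: subspaceZ.
by rewrite -scaleN1r linear_onZ// mulN1r.
Qed.

Lemma linear_on_sum (I : finType) (u : I -> V) : (forall i, D (u i)) ->
  l (\sum_i u i) = \sum_i l (u i).
Proof.
move=> Du.
suff [] : D (\sum_i u i) /\ l (\sum_i u i) = \sum_i l (u i) by [].
elim/big_rec2: _ => [|i y x _ [Dx lx]].
  by rewrite linear_on0; split => //; case: sD.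
by rewrite linear_onD// lx; split => //; apply: subspaceD.
Qed.

End linear_on.

Section form.
Variables (D : set V) (a : V -> V -> R).
Hypotheses (sD : subspace D) (fa : psd_form D a).

Lemma formC u v : D u -> D v -> a u v = a v u. Proof. by case: fa => + _ _; apply. Qed.
Lemma form_ge0 u : D u -> 0 <= a u u. Proof. by case: fa => _ _; apply. Qed.
Lemma form_linl w : D w -> linear_on D (a^~ w). Proof. by case: fa => _ + _; apply. Qed.

Lemma form_linr w : D w -> linear_on D (a w).
Proof.
move=> Dw k u v Du Dv; have Dk : D (k *: u + v) by case: sD => _; apply.
by rewrite formC// form_linl// (formC Dw Du) (formC Dw Dv).
Qed.

Lemma form_sqrD u v : D u -> D v -> a (u + v) (u + v) = a u u + 2 * a u v + a v v.
Proof.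
move=> Du Dv; have Duv := subspaceD sD Du Dv.
rewrite (linear_onD (form_linl Duv))// !(linear_onD (form_linr _))//.
by rewrite (formC Dv Du); ring.
Qed.

Lemma form_sqrB u v : D u -> D v -> a (u - v) (u - v) = a u u - 2 * a u v + a v v.
Proof.
move=> Du Dv; have Duv := subspaceB sD Du Dv.
rewrite (linear_onB sD (form_linl Duv))// !(linear_onB sD (form_linr _))//.
by rewrite (formC Dv Du); ring.
Qed.

Lemma form_sqrZ k u : D u -> a (k *: u) (k *: u) = k ^+ 2 * a u u.
Proof.
move=> Du; rewrite (linear_onZ sD (form_linl (subspaceZ k sD Du)))//.
by rewrite (linear_onZ sD (form_linr Du))// mulrA.
Qed.

Lemma form_null u v : D u -> D v -> a u u = 0 -> a u v = 0.
Proof.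
move=> Du Dv u0; apply/eqP/negPn/negP => uv0.
(* With this [t] the form takes the value -1 at [t *: u + v]. *)
pose t := - (a v v + 1) / (2 * a u v).
have := form_ge0 (subspaceD sD (subspaceZ t sD Du) Dv).
rewrite form_sqrD//; last exact: subspaceZ.
rewrite form_sqrZ// u0 mulr0 add0r (linear_onZ sD (form_linl Dv))//.
have -> : 2 * (t * a u v) = - (a v v + 1) by rewrite /t; field.
lra.
Qed.

Lemma form_parallelogram u v : D u -> D v ->
  a (u - v) (u - v) = 2 * a u u + 2 * a v v - a (u + v) (u + v).
Proof. by move=> Du Dv; rewrite form_sqrB// form_sqrD//; ring. Qed.

Lemma form_sqrD_le u v : D u -> D v -> a (u + v) (u + v) <= 2 * a u u + 2 * a v v.
Proof.
move=> Du Dv; have := form_parallelogram Du Dv.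
by have := form_ge0 (subspaceB sD Du Dv); lra.
Qed.

Lemma form_cauchy_schwarz u v : D u -> D v -> a u v ^+ 2 <= a u u * a v v.
Proof.
move=> Du Dv; have [v0|v0] := eqVneq (a v v) 0.
  by rewrite formC// (form_null Dv Du v0) v0 mulr0 expr0n.
have vp : 0 < a v v by rewrite lt_neqAle eq_sym v0 form_ge0.
have := form_ge0 (subspaceB sD (subspaceZ (a v v) sD Du) (subspaceZ (a u v) sD Dv)).
rewrite form_sqrB; try exact: subspaceZ.
rewrite !form_sqrZ// (linear_onZ sD (form_linl (subspaceZ _ sD Dv)))//.
rewrite (linear_onZ sD (form_linr Du))//.
have -> : a v v ^+ 2 * a u u - 2 * (a v v * (a u v * a u v)) + a u v ^+ 2 * a v v
  = a v v * (a u u * a v v - a u v ^+ 2) by ring.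
by rewrite pmulr_rge0// subr_ge0.
Qed.

End form.

(** A matrix with more rows than columns has a nonzero left kernel. The index type is arbitrary so
    that vectors can later be indexed by pairs of an eigenvalue and a position. *)
Lemma nontrivial_relation (I : finType) M (l : I -> 'I_M -> R) : (M < #|I|)%N ->
  exists c : I -> R, (exists i, c i != 0) /\ forall j, \sum_i c i * l i j = 0.
Proof.
move=> MI; pose A : 'M[R]_(#|I|, M) := \matrix_(i, j) l (enum_val i) j.
have : kermx A != 0.
  by rewrite kermx_eq0 -row_leq_rank -ltnNge (leq_ltn_trans (rank_leq_col _)).
move=> /rowV0Pn[v /sub_kermxP vA v0].
exists (fun i => v 0 (enum_rank i)); split.
  have /rV0Pn[j vj] := v0; exists (enum_val j); by rewrite enum_valK.
move=> j; have /matrixP /(_ 0 j) := vA; rewrite !mxE => vA0; apply: etrans vA0.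
rewrite (reindex (fun i : 'I_#|I| => enum_val i)) /=; last first.
  by apply: onW_bij; exact: enum_val_bij.
by apply: eq_bigr => i _; rewrite enum_valK mxE.
Qed.

(* A vector orthogonal to the functionals [l] has large Rayleigh quotient, and
   so cannot be a sum of eigenvectors for small eigenvalues. *)
Lemma eigenvectors_dependent D a b (K : finType) (w : K -> V) (t : K -> R) C :
  subspace D -> psd_form D a -> psd_form D b ->
  (forall s, D (w s)) -> injective t -> 0 <= C ->
  (forall s, C * t s < 1) ->
  (forall s v, D v -> a (w s) v = t s * b (w s) v) ->
  b (\sum_s w s) (\sum_s w s) <= C * a (\sum_s w s) (\sum_s w s) ->
  forall s, b (w s) (w s) = 0.
Proof.
move=> sD fa fb Dw tinj C0 Ct aw gap.
(* By symmetry of both forms, [(t s - t r) * b (w s) (w r)] vanishes. *)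
have orth s r : s != r -> b (w s) (w r) = 0.
  move=> sr; have := aw s _ (Dw r); rewrite (formC fa)// aw// (formC fb)//.
  move=> /eqP; rewrite -subr_eq0 -mulrBl mulf_eq0 => /orP[|/eqP//].
  by rewrite subr_eq0 => /eqP /tinj rs; rewrite rs eqxx in sr.
have Dsum := subspace_sum sD Dw.
have bE s : b (w s) (\sum_r w r) = b (w s) (w s).
  rewrite (linear_on_sum sD (form_linr sD fb (Dw s)))// (bigD1 s)//=.
  by rewrite big1 ?addr0// => r rs; rewrite orth// eq_sym.
have bsum : b (\sum_s w s) (\sum_s w s) = \sum_s b (w s) (w s).
  rewrite (linear_on_sum sD (form_linl fb Dsum))//.
  by apply: eq_bigr => s _.
have asum : a (\sum_s w s) (\sum_s w s) = \sum_s t s * b (w s) (w s).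
  rewrite (linear_on_sum sD (form_linl fa Dsum))//.
  by apply: eq_bigr => s _; rewrite aw// bE.
(* The gap now bounds a sum of the nonnegative terms [(1 - C * t s) * b (w s) (w s)] above by 0, so
   each of them vanishes. *)
move: gap; rewrite bsum asum mulr_sumr -subr_ge0 -sumrB => gap s.
have term r : 0 <= (1 - C * t r) * b (w r) (w r).
  by rewrite mulr_ge0 ?subr_ge0 ?(ltW (Ct _))// (form_ge0 fb).
have : \sum_s (1 - C * t s) * b (w s) (w s) = 0.
  apply/eqP; rewrite eq_le sumr_ge0 ?andbT// -oppr_ge0 -sumrN.
  move: gap; congr (is_true (0 <= _)); apply: eq_bigr => r _; ring.
move=> /eqP; rewrite psumr_eq0// => /allP /(_ s (mem_index_enum _)) /=.
rewrite mulf_eq0 subr_eq0 => /orP[/eqP C1|/eqP//].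
by have := Ct s; rewrite -C1 ltxx.
Qed.

End forms.

(** * The direct method of the calculus of variations *)

Section ground_state.
Context {R : realType}.

Lemma bounded_cluster M (x : nat -> 'I_M -> R) B : (forall n j, `|x n j| <= B) ->
  exists p : 'I_M -> R, forall e N, 0 < e ->
    exists2 n, (N <= n)%N & forall j, `|x n j - p j| < e.
Proof.
move=> xB.
pose X n : 'rV[R]_M := \row_j x n j.
pose K := [set v : 'rV[R]_M | forall j, `[- B, B]%classic (v ord0 j)].
have cK : compact K by apply: (@rV_compact _ _ (fun=> _)) => j; exact: segment_compact.
have FK : (X @ \oo) K.
  exists 0%N => // n _ j; rewrite /X mxE /= in_itv /=.
  by rewrite -ler_norml.
have [p [_ clp]] := cK _ _ FK.
exists (fun j => p ord0 j) => e N e0.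
have FN : (X @ \oo) (X @` [set n | (N <= n)%N]).
  by exists N => // n Nn; exists n.
have [_ [[n Nn <-] pn]] := clp _ _ FN (nbhsx_ballx p e e0).
exists n => // j; have [_ /(_ ord0 j)] := pn.
by rewrite /X mxE /ball /= distrC.
Qed.

Variable V : lmodType R.
Implicit Types (D : set V) (a b : V -> V -> R) (u v w : V).

(* The direct method: the gap inequality makes minimizing sequences with
   convergent [l] Cauchy, by the parallelogram law. *)
Lemma ground_state D a b M (l : 'I_M -> V -> R) C C1 B u0 :
  subspace D -> psd_form D a -> psd_form D b ->
  (forall j, linear_on D (l j)) ->
  0 <= C -> 0 <= C1 -> (forall j u, D u -> l j u ^+ 2 <= B * b u u) ->
  (forall u, D u -> b u u <= C * a u u + C1 * \sum_j l j u ^+ 2) ->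
  (forall (u : nat -> V) K, (forall n, D (u n)) ->
     (forall m n, (m <= n)%N ->
        a (u n - u m) (u n - u m) + b (u n - u m) (u n - u m) <= K * 4^-1 ^+ m) ->
     exists2 v, D v & forall e, 0 < e -> exists N, forall n, (N <= n)%N ->
        a (u n - v) (u n - v) + b (u n - v) (u n - v) < e) ->
  D u0 -> 0 < b u0 u0 -> C * a u0 u0 < b u0 u0 ->
  exists t u, [/\ C * t < 1, D u, 0 < b u u &
    forall v, D v -> a u v = t * b u v].
Proof.
move=> sD fa fb ll C0 C10 lB gap complete Du0 b0 Ca0.
pose S := [set t : R | exists2 u, D u /\ 0 < b u u & t = a u u / b u u].
have hS : has_inf S.
  split; first by exists (a u0 u0 / b u0 u0), u0.
  by exists 0 => _ [u [Du bu] ->]; rewrite divr_ge0 ?(ltW bu)// (form_ge0 fa).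
pose t := inf S.
have tle u : D u -> t * b u u <= a u u.
  move=> Du; have [bu0|bu0] := eqVneq (b u u) 0.
    by rewrite bu0 mulr0 (form_ge0 fa).
  have bu : 0 < b u u by rewrite lt_neqAle eq_sym bu0 (form_ge0 fb).
  rewrite -ler_pdivlMr//; apply: ge_inf; last by exists u.
  by case: hS.
have t0 : 0 <= t.
  apply: lb_le_inf; first by case: hS.
  by move=> _ [u [Du bu] ->]; rewrite divr_ge0 ?(ltW bu)// (form_ge0 fa).
have Ct : C * t < 1.
  have := tle _ Du0; rewrite -ler_pdivlMr// => H.
  apply: (le_lt_trans (ler_wpM2l C0 H)).
  by rewrite mulrA ltr_pdivrMr// mul1r.
have minim e : 0 < e -> exists2 u, D u & b u u = 1 /\ a u u < t + e.
  move=> e0; have [_ [u [Du bu] ->] ut] := inf_adherent e0 hS.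
  pose k := (Num.sqrt (b u u))^-1.
  have k2 : k ^+ 2 = (b u u)^-1 by rewrite /k exprVn sqr_sqrtr// ltW.
  exists (k *: u); first exact: subspaceZ.
  rewrite !(form_sqrZ sD)// k2 mulVf ?gt_eqF//; split => //.
  by rewrite mulrC.
have q0 (n : nat) : 0 < 4^-1 ^+ n :> R by rewrite exprn_gt0.
have q1 (n : nat) : 4^-1 ^+ n <= 1 :> R by apply: exprn_ile1; lra.
have /choice[x xP] : forall n, exists u,
    [/\ D u, b u u = 1 & a u u < t + 4^-1 ^+ n].
  by move=> n; have [u Du [bu au]] := minim _ (q0 n); exists u.
have [p pP] : exists p : 'I_M -> R, forall e N, 0 < e ->
    exists2 n, (N <= n)%N & forall j, `|l j (x n) - p j| < e.
  apply: (@bounded_cluster _ (fun n j => l j (x n)) (1 + B)) => n j.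
  have [Dx bx _] := xP n; have := lB j _ Dx; rewrite bx mulr1 => H.
  have B0 : 0 <= B by apply: le_trans H; exact: sqr_ge0.
  rewrite -(ler_pXn2r (n := 2)) ?nnegrE// ?addr_ge0//.
  rewrite real_normK ?num_real//; apply: (le_trans H).
  by rewrite sqrrD expr1n mul1r; have := sqr_ge0 B; lra.
(* Since [n <= s n], the reindexed sequence minimizes at the rate 4^-n at least, and its functionals
   now converge at that rate too. *)
have /choice[s sP] : forall n, exists m, (n <= m)%N /\
    forall j, `|l j (x m) - p j| < 4^-1 ^+ n.
  by move=> n; have [m nm mP] := pP _ n (q0 n); exists m.
pose y n := x (s n).
have yP n : [/\ D (y n), b (y n) (y n) = 1 & a (y n) (y n) < t + 4^-1 ^+ n].
  have [Dx bx ax] := xP (s n); split => //; apply: (lt_le_trans ax).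
  by rewrite lerD2l; apply: ler_wiXn2l; [lra|lra|case: (sP n)].
have q m n : (m <= n)%N -> 4^-1 ^+ n <= 4^-1 ^+ m :> R.
  by move=> mn; apply: ler_wiXn2l; [lra|lra|].
pose K := 4 * C + 4 * C1 * M%:R.
have K0 : 0 <= K by rewrite /K addr_ge0 ?mulr_ge0// mulr_ge0.
pose g := (1 - C * t)^-1.
have g0 : 0 < g by rewrite invr_gt0 subr_gt0.
have bK m n : (m <= n)%N -> b (y n - y m) (y n - y m) <= g * K * 4^-1 ^+ m /\
  a (y n - y m) (y n - y m) <= (t * (g * K) + 4) * 4^-1 ^+ m.
  move=> mn; have [Dm bm am] := yP m; have [Dn bn an] := yP n.
  have Dmn := subspaceB sD Dn Dm.
  (* Parallelogram law for both forms, with [t * b <= a] applied to the sum [y n + y m]. *)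
  have aE : a (y n - y m) (y n - y m) <= t * b (y n - y m) (y n - y m) + 4 * 4^-1 ^+ m.
    rewrite (form_parallelogram sD fa)// (form_parallelogram sD fb)// bn bm.
    by have := tle _ (subspaceD sD Dn Dm); have := q _ _ mn; nra.
  have lE : \sum_j l j (y n - y m) ^+ 2 <= M%:R * (4 * 4^-1 ^+ m).
    rewrite -[M in M%:R]card_ord -sum1_card natr_sum mulr_suml; apply: ler_sum => j _.
    rewrite mul1r (linear_onB sD)//.
    have [_ /(_ j) lm] := sP m; have [_ /(_ j) ln] := sP n.
    have h : `|l j (y n) - l j (y m)| <= 2 * 4^-1 ^+ m.
      rewrite -(subrKA (p j)) (le_trans (ler_normD _ _))// (distrC (p j)).
      by have := q _ _ mn; lra.
    rewrite -real_normK ?num_real//.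
    apply: (@le_trans _ _ ((2 * 4^-1 ^+ m) ^+ 2)).
      by rewrite ler_pXn2r// nnegrE ?mulr_ge0// ltW.
    by have := q1 m; have := q0 m; rewrite exprMn => h1 h2; nra.
  (* Inserting [aE] into the gap inequality puts [C * t] times the left side on the right; it is
     absorbed because [C * t < 1]. *)
  have bE : (1 - C * t) * b (y n - y m) (y n - y m) <= K * 4^-1 ^+ m.
    have := gap _ Dmn; have := ler_wpM2l C0 aE; have := ler_wpM2l C10 lE.
    by rewrite /K; lra.
  have bE' : b (y n - y m) (y n - y m) <= g * K * 4^-1 ^+ m.
    by rewrite -mulrA -ler_pdivrMl// invrK.
  split => //; apply: (le_trans aE); have := ler_wpM2l t0 bE'; lra.
have cauchy m n : (m <= n)%N ->
    a (y n - y m) (y n - y m) + b (y n - y m) (y n - y m)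
    <= (g * K + (t * (g * K) + 4)) * 4^-1 ^+ m.
  by move=> mn; have [h1 h2] := bK _ _ mn; lra.
have Dy n : D (y n) by have [] := yP n.
have [v Dv vlim] := complete y _ Dy cauchy.
  exists t, v; split => //.
    (* The limit keeps positive mass: 1 = b(y) <= 2 b(v) + 2 b(y - v), and the last term is below
       1/2. *)
    have [N /(_ N (leqnn _))] := vlim 4^-1 ltac:(lra).
    have [Dn bn an] := yP N => H.
    have := form_sqrD_le sD fb Dv (subspaceB sD Dn Dv).
    rewrite addrC subrK bn.
    by have := form_ge0 fa (subspaceB sD Dn Dv); lra.
  (* Minimality of [t] makes [e] positive semidefinite; once [e v v = 0], [form_null] is the
     Euler-Lagrange equation. *)
  pose e u w := a u w - t * b u w.
  have fe : psd_form D e.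
    split => [u w Du Dw|w Dw k u u' Du Du'|u Du].
    - by rewrite /e (formC fa)// (formC fb).
    - by rewrite /e (form_linl fa)// (form_linl fb)//; ring.
    - by rewrite subr_ge0; apply: tle.
  have ev : e v v = 0.
    apply/eqP; rewrite eq_le (form_ge0 fe)// andbT leNgt; apply/negP => ev.
    have [N NP] := vlim (e v v / 4) ltac:(lra).
    have [N' N'P] : exists N', 4^-1 ^+ N' < e v v / 4.
      have : (4^-1 : R) ^+ n @[n --> \oo] --> 0 by apply: cvg_expr; rewrite ger0_norm; lra.
      move=> /cvgrPdist_lt /(_ (e v v / 4) ltac:(lra)) [n _ /(_ n (leqnn _))] /=.
      by rewrite sub0r normrN ger0_norm ?(ltW (q0 _))// => H; exists n.
    have := NP (maxn N N') (leq_maxl _ _).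
    have [Dn bn an] := yP (maxn N N').
    have Dd := subspaceB sD Dn Dv.
    have := form_sqrD_le sD fe Dn (subspaceB sD Dv Dn).
    rewrite addrC subrK => H1 H2.
    have := q _ _ (leq_maxr N N').
    have h3 : e (v - y (maxn N N')) (v - y (maxn N N')) = e (y (maxn N N') - v) (y (maxn N N') - v).
      by rewrite -[v - _]opprB -[- (_ - v)]scaleN1r (form_sqrZ sD fe)// expr2 mulrNN !mul1r.
    move: H1; rewrite h3 {2 3}/e bn.
    have := mulr_ge0 t0 (form_ge0 fb Dd); have := form_ge0 fb Dd.
    by move: an N'P; lra.
  move=> w Dw; have := form_null sD fe Dv Dw ev.
  by rewrite /e => /eqP; rewrite subr_eq0 => /eqP.
Qed.

End ground_state.

(** * Smooth functions on the line and a smooth step *)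

Section smooth_line.
Context {R : realType}.
Implicit Types (f g h : R -> R) (a b c x y : R) (n : nat).

Fixpoint derivable_n n f : Prop :=
  if n is m.+1 then
    exists2 g, (forall x, is_derive x 1 f (g x)) & derivable_n m g
  else True.

Definition smooth f := forall n, derivable_n n f.

Lemma derivable_nW n f : derivable_n n.+1 f -> derivable_n n f.
Proof.
elim: n f => [//|n IH] f [g fg gn].
by exists g => //; apply: IH.
Qed.

Lemma smooth_derive f : smooth f ->
  exists2 g, smooth g & forall x, is_derive x 1 f (g x).
Proof.
move=> sf; have [g fg _] := sf 1%N; exists g => // n.
have [k fk kn] := sf n.+1.
suff -> : g = k by [].
apply/funext => x; have [_ <-] := fg x; by have [_ <-] := fk x.
Qed.

Lemma smooth_is_derive f g : (forall x, is_derive x 1 f (g x)) ->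
  smooth g -> smooth f.
Proof. by move=> fg sg [//|n]; exists g. Qed.

Lemma is_derive_continuous f g : (forall x, is_derive x 1 f (g x)) ->
  continuous f.
Proof.
move=> fg x; apply: differentiable_continuous.
by apply/derivable1_diffP; case: (fg x).
Qed.

Lemma smooth_continuous f : smooth f -> continuous f.
Proof. by move=> /(_ 1%N)[g fg _]; exact: is_derive_continuous fg. Qed.

Lemma smooth_cst c : smooth (fun=> c).
Proof.
move=> n; elim: n c => [//|n IH] c; exists (fun=> 0) => // x.
exact: is_derive_cst.
Qed.

Lemma smooth_affine a b : smooth (fun x => a * x + b).
Proof.
apply: (@smooth_is_derive _ (fun=> a)); last exact: smooth_cst.
move=> x.
apply: (is_derive_eq (is_deriveD (is_deriveZ a (is_derive_id x 1)) (is_derive_cst b x 1))).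
by rewrite addr0 /GRing.scale /= mulr1.
Qed.

Lemma derivable_nD n f g :
  derivable_n n f -> derivable_n n g -> derivable_n n (fun x => f x + g x).
Proof.
elim: n f g => [//|n IH] f g [f' ff' nf] [g' gg' ng].
exists (fun x => f' x + g' x); last exact: IH.
by move=> x; apply: is_deriveD.
Qed.

Lemma derivable_nM n f g :
  derivable_n n f -> derivable_n n g -> derivable_n n (fun x => f x * g x).
Proof.
elim: n f g => [//|n IH] f g fn gn.
have [f' ff' nf] := fn; have [g' gg' ng] := gn.
exists (fun x => f x * g' x + g x * f' x).
  by move=> x; apply: is_deriveM.
by apply: derivable_nD; apply: IH => //; exact: derivable_nW.
Qed.

Lemma smoothD f g : smooth f -> smooth g -> smooth (fun x => f x + g x).
Proof. by move=> sf sg n; apply: derivable_nD. Qed.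

Lemma smoothM f g : smooth f -> smooth g -> smooth (fun x => f x * g x).
Proof. by move=> sf sg n; apply: derivable_nM. Qed.

Lemma smoothZ c f : smooth f -> smooth (fun x => c * f x).
Proof. by move=> sf; apply: smoothM => //; apply: smooth_cst. Qed.

Lemma smoothN f : smooth f -> smooth (fun x => - f x).
Proof.
by move=> /(smoothZ (-1)); under eq_fun do rewrite mulN1r.
Qed.

Lemma smoothB f g : smooth f -> smooth g -> smooth (fun x => f x - g x).
Proof. by move=> sf sg; apply: smoothD => //; apply: smoothN. Qed.

Lemma smooth_comp f g : smooth f -> smooth g -> smooth (f \o g).
Proof.
move=> sf sg n; elim: n f sf => [//|n IH] f sf.
have [f' sf' ff'] := smooth_derive sf; have [g' sg' gg'] := smooth_derive sg.
exists (fun x => f' (g x) * g' x).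
  by move=> x; apply: is_derive1_comp.
by apply: derivable_nM; [exact: IH|exact: sg'].
Qed.

Lemma smoothV f : (forall x, f x != 0) -> smooth f ->
  smooth (fun x => (f x)^-1).
Proof.
move=> f0 sf n; elim: n => [//|n IH].
have [f' sf' ff'] := smooth_derive sf.
exists (fun x => - f' x * ((f x)^-1 * (f x)^-1)).
  move=> x; apply: (is_derive_eq (is_deriveV (f0 x) (ff' x))).
  rewrite /GRing.scale /= expr2 invfM; ring.
by apply: derivable_nM; [exact: smoothN|exact: derivable_nM].
Qed.

(* All derivatives of [exp (-1/x)] on the right half line have this form. *)
Definition flat (p : {poly R}) x : R :=
  if x <= 0 then 0 else p.[x^-1] * expR (- x^-1).

Lemma flat_derive_pos p x : 0 < x ->
  is_derive x 1 (flat p) (flat ('X ^+ 2 * (p - p^`())) x).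
Proof.
move=> x0; have xn0 : x != 0 by rewrite gt_eqF.
have dV : is_derive x 1 (fun y : R => y^-1) (- x ^- 2).
  apply: (is_derive_eq (is_deriveV (f := id) xn0 (is_derive_id x 1))).
  by rewrite /GRing.scale /= mulr1.
have dp : is_derive x 1 (horner p \o (fun y : R => y^-1)) (p^`().[x^-1] * (- x ^- 2)).
  by apply: is_derive1_comp.
have dN : is_derive x 1 (fun y : R => - y^-1) (x ^- 2).
  by apply: (is_derive_eq (is_deriveN dV)); rewrite opprK.
have de : is_derive x 1 (expR \o (fun y : R => - y^-1)) (expR (- x^-1) * x ^- 2).
  by apply: is_derive1_comp.
have dM := is_deriveM dp de.
apply: (near_eq_is_derive _ (is_derive_eq dM _)); last first.
  rewrite /flat leNgt x0 /= !hornerE /GRing.scale /= -exprVn.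
  by ring.
near=> y.
rewrite /flat leNgt ifN //; rewrite negbK; near: y; exact: lt_nbhsr.
Unshelve. all: by end_near.
Qed.

Lemma exp_dominates_poly (p : {poly R}) :
  exists2 C, 0 <= C & forall y, 0 <= y -> `|p.[y]| <= C * expR y.
Proof.
have mono k y : 0 <= y -> y ^+ k <= k`!%:R * expR y.
  move=> y0; case: k => [|k].
    by rewrite expr0 mul1r; apply: le_trans (expR_ge1Dx y); rewrite lerDl.
  have := expR_ge1Dxn k y0; rewrite -ler_pdivrMl ?ltr0n ?fact_gt0// mulrC.
  by apply: le_trans; rewrite lerDr.
exists (\sum_(i < size p) `|p`_i| * i`!%:R).
  by apply: sumr_ge0 => i _; rewrite mulr_ge0.
move=> y y0; rewrite horner_coef mulr_suml.
apply: le_trans (ler_norm_sum _ _ _) _.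
apply: ler_sum => i _; rewrite normrM -mulrA ler_wpM2l//.
by rewrite ger0_norm ?exprn_ge0// mono.
Qed.

(** With y = 1/x this says that y^2 p(y) is dominated by exp(y). The quadratic bound is what yields
    derivative 0 at the origin. *)
Lemma flat_le_sqr p : exists2 C, 0 <= C & forall x, `|flat p x| <= C * x ^+ 2.
Proof.
have [C C0 pC] := exp_dominates_poly ('X ^+ 2 * p).
exists C => // x; rewrite /flat; have [x0|x0] := leP x 0.
  by rewrite normr0 mulr_ge0// sqr_ge0.
have := pC x^-1; rewrite invr_ge0 (ltW x0) => /(_ isT).
rewrite hornerM hornerXn normrM normrX (ger0_norm (x := x^-1)) ?invr_ge0 ?(ltW x0)//.
move=> H; rewrite normrM (ger0_norm (expR_ge0 _)) expRN.
rewrite ler_pdivrMr ?expR_gt0// mulrAC -ler_pdivrMr ?exprn_gt0//.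
by rewrite mulrC -exprVn.
Qed.

Lemma is_derive_sqr_bound f C : (forall x, `|f x| <= C * x ^+ 2) ->
  is_derive (0 : R) 1 f 0.
Proof.
move=> fC.
have f0 : f 0 = 0.
  by apply/eqP; rewrite -normr_eq0 eq_le normr_ge0 andbT (le_trans (fC 0))// expr0n mulr0.
have C0 : 0 <= C.
  by have := fC 1; rewrite expr1n mulr1; apply: le_trans.
have lim : h^-1 *: (f (h *: 1 + 0) - f 0) @[h --> 0^'] --> (0 : R).
  apply/cvgr0Pnorm_lt => e e0; near=> h.
  have h0 : h != 0 by near: h; exact: nbhs_dnbhs_neq.
  rewrite f0 subr0 addr0 normrZ /GRing.scale /= mulr1 normfV.
  rewrite mulrC ltr_pdivrMr ?normr_gt0//.
  apply: le_lt_trans (fC h) _; rewrite -real_normK ?num_real// expr2 mulrA.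
  rewrite ltr_pM2r ?normr_gt0//.
  apply: (@le_lt_trans _ _ ((C + 1) * `|h|)); first by rewrite ler_wpM2r// lerDl.
  rewrite -ltr_pdivlMl ?ltr_wpDl// mulrC.
  near: h; apply: dnbhs0_lt; rewrite divr_gt0// ltr_wpDl//.
split; first by apply/cvg_ex; exists 0.
exact: cvg_lim lim.
Unshelve. all: by end_near.
Qed.

Lemma flat_derive p x : is_derive x 1 (flat p) (flat ('X ^+ 2 * (p - p^`())) x).
Proof.
have [x0|x0|->] := ltgtP x 0; last 1 first.
- have [C _ pC] := flat_le_sqr p.
  by rewrite {2}/flat lexx; exact: is_derive_sqr_bound pC.
- rewrite {2}/flat ltW//.
  apply: (near_eq_is_derive _ (is_derive_cst 0 x 1)); near=> y.
  by rewrite /flat ifT// ltW//; near: y; exact: lt_nbhsl.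
- exact: flat_derive_pos.
Unshelve. all: by end_near.
Qed.

Lemma smooth_flat p : smooth (flat p).
Proof.
move=> n; elim: n p => [//|n IH] p.
by exists (flat ('X ^+ 2 * (p - p^`()))) => // x; apply: flat_derive.
Qed.

Let flat1_gt0 x : 0 < x -> 0 < flat 1 x.
Proof. by move=> x0; rewrite /flat leNgt x0 /= hornerC mul1r expR_gt0. Qed.

Let flat1_ge0 x : 0 <= flat 1 x.
Proof. by rewrite /flat; case: ifP => // _; rewrite hornerC mul1r expR_ge0. Qed.

Let flat1_le0 x : x <= 0 -> flat 1 x = 0.
Proof. by rewrite /flat => ->. Qed.

(** The transition takes place in [1/4, 3/4], strictly inside the unit interval, so that the
    derivative has compact support in the open interval. *)
Definition step x : R :=
  flat 1 (x - 4^-1) * (flat 1 (x - 4^-1) + flat 1 (3 / 4 - x))^-1.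

Let step_den x : 0 < flat 1 (x - 4^-1) + flat 1 (3 / 4 - x).
Proof.
have [x1|x1] := leP x 4^-1.
  by rewrite ltr_wpDl// flat1_gt0//; lra.
by rewrite ltr_pwDl// flat1_gt0//; lra.
Qed.

Lemma step_ge0 x : 0 <= step x.
Proof. by rewrite mulr_ge0// invr_ge0 ltW. Qed.

Lemma step_le1 x : step x <= 1.
Proof. by rewrite ler_pdivrMr// mul1r lerDl. Qed.

Lemma step0 x : x <= 4^-1 -> step x = 0.
Proof. by move=> x1; rewrite /step flat1_le0 ?mul0r//; lra. Qed.

Lemma step1 x : 3 / 4 <= x -> step x = 1.
Proof.
move=> x1; rewrite /step (flat1_le0 (x := 3 / 4 - x)); last lra.
by rewrite addr0 divff// gt_eqF// flat1_gt0//; lra.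
Qed.

Lemma smooth_step : smooth step.
Proof.
have s1 : smooth (fun x => flat 1 (x - 4^-1)).
  apply: (@smooth_comp _ (fun x => x - 4^-1)); first exact: smooth_flat.
  by have := smooth_affine 1 (- 4^-1); under eq_fun do rewrite mul1r.
have s2 : smooth (fun x => flat 1 (3 / 4 - x)).
  apply: (@smooth_comp _ (fun x => 3 / 4 - x)); first exact: smooth_flat.
  by have := smooth_affine (- 1) (3 / 4); under eq_fun do rewrite mulN1r addrC.
apply: smoothM => //; apply: smoothV; last exact: smoothD.
by move=> x; rewrite gt_eqF.
Qed.

End smooth_line.

(** * Test functions of one variable and their primitives *)

Section line_tests.
Context {R : realType}.
Implicit Types (f g F : R -> R) (a b c x y : R).
Local Notation mu := (@lebesgue_measure R).

(** Support in a compact part of the open interval; [d < c] is allowed and forces [f] to be zero. *)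
Definition supported a b f := exists c d,
  [/\ a < c, d < b & forall x, f x != 0 -> c <= x <= d].

Definition test1 a b f := smooth f /\ supported a b f.

Lemma supported_out a b f x : supported a b f -> (x <= a) || (b <= x) -> f x = 0.
Proof.
move=> [c [d [ac db fcd]]] xab; apply/eqP; apply/negPn/negP => /fcd /andP[].
by case/orP: xab; lra.
Qed.

Lemma supportedZ a b f g : supported a b f -> supported a b (fun x => g x * f x).
Proof.
move=> [c [d [ac db fcd]]]; exists c, d; split => // x gf.
by apply: fcd; apply: contra_neq gf => ->; rewrite mulr0.
Qed.

Lemma supportedD a b f g : supported a b f -> supported a b g ->
  supported a b (fun x => f x + g x).
Proof.
move=> [c [d [ac db fcd]]] [c' [d' [ac' db' gcd]]].
exists (Num.min c c'), (Num.max d d'); split.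
- by rewrite lt_min ac ac'.
- by rewrite gt_max db db'.
move=> x; have [->|f0 _] := eqVneq (f x) 0.
  by rewrite add0r => /gcd /andP[xc xd]; rewrite ge_min le_max xc xd !orbT.
by have /andP[xc xd] := fcd _ f0; rewrite ge_min le_max xc xd.
Qed.

Lemma supportedW a b a' b' f : a' <= a -> b <= b' ->
  supported a b f -> supported a' b' f.
Proof.
move=> aa bb [c [d [ac db fcd]]]; exists c, d; split => //.
- exact: le_lt_trans ac.
- exact: lt_le_trans bb.
Qed.

Lemma test1D a b f g : test1 a b f -> test1 a b g -> test1 a b (fun x => f x + g x).
Proof. by move=> [sf uf] [sg ug]; split; [exact: smoothD|exact: supportedD]. Qed.

Lemma test1Z a b c f : test1 a b f -> test1 a b (fun x => c * f x).
Proof. by move=> [sf uf]; split; [exact: smoothZ|exact: supportedZ]. Qed.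

Lemma test1B a b f g : test1 a b f -> test1 a b g -> test1 a b (fun x => f x - g x).
Proof.
move=> tf tg; have := test1D tf (test1Z (-1) tg).
by under eq_fun do rewrite mulN1r.
Qed.

Lemma test1W a b a' b' f : a' <= a -> b <= b' -> test1 a b f -> test1 a' b' f.
Proof. by move=> aa bb [sf uf]; split => //; apply: supportedW uf. Qed.

Lemma supported_integrable a b f : continuous f -> supported a b f ->
  mu.-integrable setT (EFin \o f).
Proof.
move=> cf uf.
have : mu.-integrable `[a, b]%classic (EFin \o f).
  apply: continuous_compact_integrable; first exact: segment_compact.
  by apply: continuous_subspaceT.
rewrite integrable_mkcond//; congr (_.-integrable _ _).
apply/funext => x; rewrite /patch; case: ifPn => //.
rewrite notin_setE /= in_itv /= => /negP; rewrite negb_and -!ltNge => xab.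
by rewrite (supported_out uf)//; apply/orP; case/orP: xab => /ltW; [left|right].
Qed.

Lemma test1_integrable a b f : test1 a b f -> mu.-integrable setT (EFin \o f).
Proof. by move=> [sf uf]; apply: supported_integrable uf; exact: smooth_continuous. Qed.

Lemma Rintegral_supported a b f (A : set R) : supported a b f ->
  `[a, b]%classic `<=` A -> \int[mu]_(x in A) f x = \int[mu]_x f x.
Proof.
move=> uf abA; rewrite Rintegral_mkcond; congr (Rintegral _ _ _).
apply/funext => x; rewrite /patch; case: ifPn => //.
rewrite notin_setE => xA; rewrite (supported_out uf)//.
have [//|ax /=] := leP x a; have [//|xb] := leP b x.
by exfalso; apply: xA; apply: abA; rewrite /= in_itv/= !ltW.
Qed.

Lemma le_Rintegral_subset (A B : set R) f : measurable A -> measurable B ->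
  A `<=` B -> (forall x, 0 <= f x) -> mu.-integrable B (EFin \o f) ->
  \int[mu]_(x in A) f x <= \int[mu]_(x in B) f x.
Proof.
move=> mA mB AB f0 fi; apply: fine_le.
- by apply: integrable_fin_num => //; exact: integrableS fi.
- by apply: integrable_fin_num.
apply: ge0_subset_integral => //; last by move=> x _; rewrite lee_fin.
by apply: measurable_int fi.
Qed.

Definition primitive f x := \int[mu]_(t in `]-oo, x]) f t.

Lemma primitive_derive a b f x : test1 a b f ->
  is_derive x 1 (primitive f) (f x).
Proof.
move=> tf; have [sf uf] := tf; have fi := test1_integrable tf.
have h1 : x < x + 1 by rewrite ltrDl.
have h2 : mu.-integrable `]-oo, x + 1]%classic (EFin \o f) by exact: integrableS fi.
have [] := continuous_FTC1 h1 h2 _ _.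
- exact: ltNyr.
- exact: (smooth_continuous sf).
rewrite derive1E => D E; split; first exact: D.
exact: E.
Qed.

Lemma test1_primitive a b f : test1 a b f -> \int[mu]_x f x = 0 ->
  test1 a b (primitive f).
Proof.
move=> tf f0; have [sf uf] := tf.
split; first by apply: smooth_is_derive sf => x; exact: primitive_derive tf.
have [c [d [ac db fcd]]] := uf; exists c, d; split => // x.
apply: contraNT; rewrite negb_and -!ltNge => /orP[xc|dx].
  rewrite /primitive Rintegral_mkcond; apply/eqP.
  rewrite (_ : _ \_ _ = cst 0) ?Rintegral_cst ?mul0r//.
  apply/funext => t; rewrite /patch; case: ifPn => //.
  rewrite inE /= in_itv /= => tx; apply/eqP/negPn/negP => /fcd /andP[].
  by move: tx xc; lra.
(* To the right of the support the primitive has collected the whole integral, which is 0. *)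
rewrite -f0 /primitive Rintegral_mkcond; apply/eqP; congr (Rintegral _ _ _).
apply/funext => t; rewrite /patch; case: ifPn => //.
rewrite notin_setE /= in_itv /= => /negP; rewrite -ltNge => tx; apply/esym/eqP/negPn/negP => /fcd /andP[].
by move: tx dx; lra.
Qed.

Lemma primitive_le a b f x : test1 a b f -> `|primitive f x| <= \int[mu]_x `|f x|.
Proof.
move=> tf; have fi := test1_integrable tf.
apply: (le_trans (le_normr_Rintegral _ _)) => //.
  exact: integrableS fi.
apply: le_Rintegral_subset => //.
exact: integrable_norm.
Qed.

Lemma primitiveD a b f g x : test1 a b f -> test1 a b g ->
  primitive (fun x => f x + g x) x = primitive f x + primitive g x.
Proof.
move=> tf tg; rewrite /primitive RintegralD//.
- exact: integrableS (test1_integrable tf).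
- exact: integrableS (test1_integrable tg).
Qed.

Lemma primitiveZ a b c f x : test1 a b f ->
  primitive (fun x => c * f x) x = c * primitive f x.
Proof.
move=> tf; rewrite /primitive RintegralZl//.
exact: integrableS (test1_integrable tf).
Qed.

End line_tests.

(** * Rescaled steps, bumps of mass one, plateaus *)

Section bumps.
Context {R : realType}.
Implicit Types (f g F : R -> R) (a b c d x y : R).
Local Notation mu := (@lebesgue_measure R).

Lemma Rintegral_derive F f a b : a < b ->
  (forall x, is_derive x 1 F (f x)) -> continuous f ->
  \int[mu]_(x in `[a, b]) f x = F b - F a.
Proof.
move=> ab Ff cf; rewrite /Rintegral (@continuous_FTC2 _ _ F)//.
- exact: continuous_subspaceT.
- have cF := is_derive_continuous Ff; split => //.
  + by apply: cvg_at_right_filter; exact: cF.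
  + by apply: cvg_at_left_filter; exact: cF.
- by move=> x _; rewrite derive1E; case: (Ff x).
Qed.

Definition step_on a b x : R := step ((x - a) / (b - a)).
(** The derivative of [step_on a b], so that differences of bumps have explicit primitives. *)
Definition bump a b x : R := (b - a)^-1 * (derive1 (@step R)) ((x - a) / (b - a)).

Let dstep : smooth (derive1 (@step R)) /\ forall x, is_derive x 1 (@step R) ((derive1 (@step R)) x).
Proof.
have [g sg dg] := smooth_derive (@smooth_step R).
have -> : (derive1 (@step R)) = g.
  by apply/funext => x; rewrite derive1E; case: (dg x).
by [].
Qed.

Let smooth_lin a b : smooth (fun x => (x - a) / (b - a)).
Proof.
have := smooth_affine (b - a)^-1 (- a / (b - a)).
by under eq_fun do rewrite mulrC -mulrDl.
Qed.

Lemma step_on_derive a b x : is_derive x 1 (step_on a b) (bump a b x).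
Proof.
have [_ ds] := dstep.
have dl : is_derive x 1 (fun x => (x - a) / (b - a)) (b - a)^-1.
  have -> : (fun x => (x - a) / (b - a)) = (b - a)^-1 \*: (@id R + cst (- a)).
    by apply/funext => t; rewrite mulrC.
  apply: (is_derive_eq (is_deriveZ _ (is_deriveD (is_derive_id x 1) (is_derive_cst (- a) x 1)))).
  by rewrite addr0 /GRing.scale /= mulr1.
apply: (is_derive_eq (is_derive1_comp (ds _) dl)).
by rewrite mulrC.
Qed.

Lemma smooth_bump a b : smooth (bump a b).
Proof.
apply: smoothZ; apply: (@smooth_comp _ _ (fun x => (x - a) / (b - a))) => //.
by have [] := dstep.
Qed.

Lemma smooth_step_on a b : smooth (step_on a b).
Proof. by apply: (@smooth_comp _ _ (fun x => (x - a) / (b - a))) => //; exact: smooth_step. Qed.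

Let dstep_out x : (x < 4^-1) || (3 / 4 < x) -> (derive1 (@step R)) x = 0.
Proof.
move=> xx; rewrite derive1E.
have [D|D] := orP xx.
  rewrite (near_eq_derive (g := cst (0 : R))) ?derive_cst//.
  near=> y; apply: step0; near: y; exact: lt_le_nbhsl.
rewrite (near_eq_derive (g := cst (1 : R))) ?derive_cst//.
near=> y; apply: step1; near: y; exact: lt_le_nbhsr.
Unshelve. all: by end_near.
Qed.

Lemma step_on_ge0 a b x : 0 <= step_on a b x. Proof. exact: step_ge0. Qed.
Lemma step_on_le1 a b x : step_on a b x <= 1. Proof. exact: step_le1. Qed.

Lemma step_on0 a b x : a < b -> x <= a + (b - a) / 4 -> step_on a b x = 0.
Proof.
move=> ab xa; apply: step0; rewrite ler_pdivrMr ?subr_gt0//.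
by rewrite mulrC; lra.
Qed.

Lemma step_on1 a b x : a < b -> b - (b - a) / 4 <= x -> step_on a b x = 1.
Proof.
move=> ab xa; apply: step1; rewrite ler_pdivlMr ?subr_gt0//; lra.
Qed.

Lemma test1_bump a b : a < b -> test1 a b (bump a b).
Proof.
move=> ab; split; first exact: smooth_bump.
have ba : 0 < b - a by rewrite subr_gt0.
exists (a + (b - a) / 4), (b - (b - a) / 4); split; [lra|lra|move=> x].
apply: contra_neqT; rewrite negb_and -!ltNge /bump => xx.
rewrite dstep_out ?mulr0//; apply/orP; case/orP: xx => xx; [left|right].
  by rewrite ltr_pdivrMr//; lra.
by rewrite ltr_pdivlMr//; lra.
Qed.

Lemma Rintegral_bump a b : a < b -> \int[mu]_x bump a b x = 1.
Proof.
move=> ab; have [_ u] := test1_bump ab.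
rewrite -(Rintegral_supported (A := `[a, b]%classic) u)//.
rewrite (Rintegral_derive ab (step_on_derive a b)).
  by rewrite (@step_on1 a b b) ?(@step_on0 a b a) ?subr0//; lra.
by apply: smooth_continuous; exact: smooth_bump.
Qed.

(** By scaling, one bound for the derivative of [step] serves every interval. This [N] is the source
    of all later constants, which makes them independent of the domain. *)
Lemma bump_bound : exists2 N : R, 1 <= N &
  forall a b x, a < b -> `|bump a b x| <= N / (b - a).
Proof.
have [sd _] := dstep; have cd := smooth_continuous sd.
have cn : {within `[(0:R), 1], continuous (fun x => `|(derive1 (@step R)) x|)}.
  apply: continuous_subspaceT => x.
  by apply: (continuous_comp (cd x)); exact: norm_continuous.
have [c _ cmax] := EVT_max ler01 cn.
exists (1 + `|(derive1 (@step R)) c|); first by rewrite lerDl.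
move=> a b x ab; have ba : 0 < b - a by rewrite subr_gt0.
rewrite /bump normrM normfV (gtr0_norm ba) mulrC ler_wpM2r ?invr_ge0 ?(ltW ba)//.
set y := _ / _; have [y0|y0] := leP 0 y; have [y1|y1] := leP y 1.
- by apply: (le_trans (cmax y _)); rewrite ?lerDr// in_itv/= y0.
- by rewrite dstep_out ?normr0 ?addr_ge0//; apply/orP; right; lra.
- by rewrite dstep_out ?normr0 ?addr_ge0//; apply/orP; left; lra.
- by rewrite dstep_out ?normr0 ?addr_ge0//; apply/orP; left; lra.
Qed.

(** The two ramps have width [d]; letting [d] tend to 0 gives the indicator of the open interval. *)
Definition plateau a b d x : R := step ((x - a) / d) * step ((b - x) / d).

Lemma plateau_ge0 a b d x : 0 <= plateau a b d x.
Proof. by rewrite mulr_ge0// step_ge0. Qed.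

Lemma plateau_le1 a b d x : plateau a b d x <= 1.
Proof. by rewrite mulr_ile1// ?step_ge0// step_le1. Qed.

Lemma test1_plateau a b d : 0 < d -> test1 a b (plateau a b d).
Proof.
move=> d0; split.
  apply: smoothM.
    apply: (@smooth_comp _ _ (fun x => (x - a) / d)); first exact: smooth_step.
    by have := smooth_affine d^-1 (- a / d); under eq_fun do rewrite mulrC -mulrDl.
  apply: (@smooth_comp _ _ (fun x => (b - x) / d)); first exact: smooth_step.
  have := smooth_affine (- d^-1) (b / d).
  by under eq_fun do rewrite mulNr mulrC addrC -mulrBl.
exists (a + d / 4), (b - d / 4); split; [lra|lra|move=> x].
apply: contra_neqT; rewrite negb_and -!ltNge /plateau => /orP[xx|xx].
  by rewrite step0 ?mul0r// ler_pdivrMr//; lra.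
by rewrite mulrC step0 ?mul0r// ler_pdivrMr//; lra.
Qed.

Lemma plateau_cvg a b x : plateau a b k.+1%:R^-1 x @[k --> \oo] --> (\1_(`]a, b[%classic) x : R).
Proof.
rewrite indicE; have [|] := boolP (x \in `]a, b[%classic).
  rewrite inE /= in_itv /= => /andP[ax xb].
  apply: cvg_near_cst; have xa0 : 0 < x - a by rewrite subr_gt0.
  have bx0 : 0 < b - x by rewrite subr_gt0.
  near=> k.
  have k0 : 0 < k.+1%:R^-1 :> R by rewrite invr_gt0.
  have kx : k.+1%:R^-1 < x - a by near: k; exact: (near_infty_natSinv_lt (PosNum xa0)).
  have kb : k.+1%:R^-1 < b - x by near: k; exact: (near_infty_natSinv_lt (PosNum bx0)).
  move: k0 kx kb; set d := _^-1 => k0 kx kb.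
  by rewrite /plateau !step1 ?mulr1//; rewrite ler_pdivlMr//; lra.
rewrite notin_setE /= in_itv /= => /negP; rewrite negb_and -!leNgt => xx.
apply: cvg_near_cst; near=> k.
have k0 : 0 < k.+1%:R^-1 :> R by rewrite invr_gt0.
move: k0; set d := _^-1 => k0; have [xa|xb] := orP xx.
  by rewrite /plateau step0 ?mul0r// ler_pdivrMr//; lra.
by rewrite /plateau mulrC step0 ?mul0r// ler_pdivrMr//; lra.
Unshelve. all: by end_near.
Qed.

End bumps.

(** * Partial derivatives and tensor products of test functions *)

Section plane_derivatives.
Context {R : realType}.
Implicit Types (f g : R * R -> R) (p : R * R) (a b : R -> R) (x : R).

Lemma is_derive_e1 f p (d : R) :
  is_derive p e1 f d <-> is_derive p.1 1 (fun s => f (s, p.2)) d.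
Proof.
have E : (fun h : R => h^-1 *: ((f \o shift p) (h *: e1) - f p)) =
  (fun h : R => h^-1 *: (((fun s => f (s, p.2)) \o shift p.1) (h *: (1 : R)) - f (p.1, p.2))).
  apply/funext => h /=; rewrite -surjective_pairing; congr (_ *: (f _ - _)).
  by case: p => x y /=; congr pair; rewrite /= /GRing.scale /= mulr0 add0r.
split=> -[D Ed]; split.
- by move: D; rewrite /derivable E.
- by move: Ed; rewrite /derive E.
- by move: D; rewrite /derivable E.
- by move: Ed; rewrite /derive E.
Qed.

Lemma is_derive_e2 f p (d : R) :
  is_derive p e2 f d <-> is_derive p.2 1 (fun s => f (p.1, s)) d.
Proof.
have E : (fun h : R => h^-1 *: ((f \o shift p) (h *: e2) - f p)) =
  (fun h : R => h^-1 *: (((fun s => f (p.1, s)) \o shift p.2) (h *: (1 : R)) - f (p.1, p.2))).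
  apply/funext => h /=; rewrite -surjective_pairing; congr (_ *: (f _ - _)).
  by case: p => x y /=; congr pair; rewrite /= /GRing.scale /= mulr0 add0r.
split=> -[D Ed]; split.
- by move: D; rewrite /derivable E.
- by move: Ed; rewrite /derive E.
- by move: D; rewrite /derivable E.
- by move: Ed; rewrite /derive E.
Qed.

Definition tensor a b : R * R -> R := fun p => a p.1 * b p.2.

Lemma continuous_tensor a b : continuous a -> continuous b -> continuous (tensor a b).
Proof.
move=> ca cb p; apply: cvgM.
  by apply: (@cvg_comp _ _ _ fst a); [exact: cvg_fst|exact: ca].
by apply: (@cvg_comp _ _ _ snd b); [exact: cvg_snd|exact: cb].
Qed.

Lemma tensor_derive_e1 a a' b p : (forall x, is_derive x 1 a (a' x)) ->
  is_derive p e1 (tensor a b) (tensor a' b p).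
Proof.
move=> da; apply/is_derive_e1; rewrite /tensor /=.
have -> : (fun s => a s * b p.2) = b p.2 \*: a by apply/funext => s; rewrite mulrC.
by apply: (is_derive_eq (is_deriveZ _ (da _))); rewrite mulrC.
Qed.

Lemma tensor_derive_e2 a b b' p : (forall x, is_derive x 1 b (b' x)) ->
  is_derive p e2 (tensor a b) (tensor a b' p).
Proof.
move=> db; apply/is_derive_e2; rewrite /tensor /=.
exact: (is_deriveZ _ (db _)).
Qed.

Lemma derive_tensor_e1 a a' b : (forall x, is_derive x 1 a (a' x)) ->
  (fun p => 'D_e1 (tensor a b) p) = tensor a' b.
Proof. by move=> da; apply/funext => p; case: (tensor_derive_e1 b p da). Qed.

Lemma derive_tensor_e2 a b b' : (forall x, is_derive x 1 b (b' x)) ->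
  (fun p => 'D_e2 (tensor a b) p) = tensor a b'.
Proof. by move=> db; apply/funext => p; case: (tensor_derive_e2 a p db). Qed.

Lemma Ck_tensor n a b : smooth a -> smooth b -> Ck n (tensor a b).
Proof.
elim: n a b => [|n IH] a b sa sb; have ca := smooth_continuous sa; have cb := smooth_continuous sb.
  exact: continuous_tensor.
have [a' sa' da] := smooth_derive sa; have [b' sb' db] := smooth_derive sb.
split.
- exact: continuous_tensor.
- by move=> p; case: (tensor_derive_e1 b p da).
- by rewrite (derive_tensor_e1 _ da); exact: IH.
- by move=> p; case: (tensor_derive_e2 a p db).
- by rewrite (derive_tensor_e2 _ db); exact: IH.
Qed.

Definition box (x0 x1 y0 y1 : R) : set (R * R) :=
  [set p | x0 < p.1 < x1 /\ y0 < p.2 < y1].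

Lemma closed_strip (c d c' d' : R) :
  closed [set p : R * R | c <= p.1 <= d /\ c' <= p.2 <= d'].
Proof.
have -> : [set p : R * R | c <= p.1 <= d /\ c' <= p.2 <= d'] =
  (fst @^-1` `[c, d]%classic) `&` (snd @^-1` `[c', d']%classic).
  by apply/seteqP; split => p; rewrite /= !in_itv.
apply: closedI; apply: closed_comp => //; [|exact: interval_closed| |exact: interval_closed].
- by move=> p _; exact: cvg_fst.
- by move=> p _; exact: cvg_snd.
Qed.

Lemma compact_strip (c d c' d' : R) :
  compact [set p : R * R | c <= p.1 <= d /\ c' <= p.2 <= d'].
Proof.
have -> : [set p : R * R | c <= p.1 <= d /\ c' <= p.2 <= d'] = `[c, d] `*` `[c', d'].
  by apply/seteqP; split => p; rewrite /= !in_itv.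
by apply: compact_setX; exact: segment_compact.
Qed.

Lemma test_tensor (Om : set (R * R)) x0 x1 y0 y1 a b :
  box x0 x1 y0 y1 `<=` Om -> test1 x0 x1 a -> test1 y0 y1 b ->
  test_function Om (tensor a b).
Proof.
move=> bOm [sa [c [d [xc dx acd]]]] [sb [c' [d' [yc dy bcd]]]].
pose K := [set p : R * R | c <= p.1 <= d /\ c' <= p.2 <= d'].
have sK : closure [set x | tensor a b x != 0] `<=` K.
  rewrite [X in _ `<=` X](_ : K = closure K); last first.
    by apply/closure_id; exact: closed_strip.
  apply: closureS => p /=; rewrite mulf_eq0 negb_or => /andP[ap bp].
  by split; [exact: acd|exact: bcd].
split.
- by move=> n; exact: Ck_tensor.
- by apply: (subclosed_compact _ (@compact_strip c d c' d') sK); exact: closed_closure.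
- apply: (subset_trans sK) => p [/andP[p1 p2] /andP[p3 p4]]; apply: bOm.
  split; apply/andP; split.
  + exact: lt_le_trans p1.
  + exact: le_lt_trans dx.
  + exact: lt_le_trans p3.
  + exact: le_lt_trans dy.
Qed.

End plane_derivatives.

(** * The pairing of L^2 on a measurable set *)

Section square_integrable.
Context {R : realType}.
Local Notation plane := (measurableTypeR R * measurableTypeR R)%type.
Local Notation mu := (@lebesgue2 R).
Implicit Types (D Q : set plane) (u v w : R * R -> R).

Definition inner D u v : R := \int[mu]_(x in D) (u x * v x).

Lemma L2_measurable D u : L2 D u -> @measurable_fun _ _ plane R D u.
Proof. by case. Qed.

Lemma L2_sqr_integrable D u : measurable D -> L2 D u ->
  mu.-integrable D (fun x => (u x ^+ 2)%:E).
Proof.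
move=> mD [mu_ iu]; apply/integrableP; split.
  by apply/measurable_EFinP; apply: measurable_funX.
by under eq_integral do rewrite gee0_abs ?lee_fin ?sqr_ge0//.
Qed.

Lemma L2_integrable D u v : measurable D -> L2 D u -> L2 D v ->
  mu.-integrable D (fun x => (u x * v x)%:E).
Proof.
move=> mD Lu Lv.
apply: (le_integrable mD _ _ (integrableD mD (L2_sqr_integrable mD Lu) (L2_sqr_integrable mD Lv))).
  apply/measurable_EFinP; apply: measurable_funM; exact: L2_measurable.
move=> x Dx; rewrite -EFinD /= lee_fin normrM (ger0_norm (addr_ge0 (sqr_ge0 _) (sqr_ge0 _))).
rewrite -(real_normK (num_real (u x))) -(real_normK (num_real (v x))).
by have := sqr_ge0 (`|u x| - `|v x|); have := normr_ge0 (u x); have := normr_ge0 (v x); nra.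
Qed.

Lemma L2_intro D u : measurable D -> @measurable_fun _ _ plane R D u ->
  mu.-integrable D (fun x => (u x ^+ 2)%:E) -> L2 D u.
Proof.
move=> mD mu_ /integrableP[_ iu]; split => //.
apply: le_lt_trans iu; rewrite le_eqVlt; apply/orP; left; apply/eqP.
by apply: eq_integral => x _; rewrite gee0_abs ?lee_fin ?sqr_ge0.
Qed.

Lemma L2_subspace D : measurable D -> subspace (L2 D).
Proof.
move=> mD; split.
  split; first exact: measurable_cst.
  rewrite (eq_integral (cst 0)) ?integral0// => x _.
  by rewrite /= /GRing.zero/= expr0n.
move=> k u v Lu Lv; have mk : measurable_fun D (k *: u + v).
  apply: measurable_funD; last exact: L2_measurable.
  by apply: measurable_funM => //; exact: L2_measurable.
apply: L2_intro => //.
have uu := integrableZl mD (k ^+ 2) (L2_sqr_integrable mD Lu).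
have uv := integrableZl mD (2 * k) (L2_integrable mD Lu Lv).
apply: eq_integrable (integrableD mD (integrableD mD uu uv) (L2_sqr_integrable mD Lv)) => //.
move=> x _ /=; rewrite -!EFinM -!EFinD; congr _%:E.
have -> : (k *: u + v) x = k * u x + v x by [].
by ring.
Qed.

Lemma inner_linear D w : measurable D -> L2 D w -> linear_on (L2 D) (inner D ^~ w).
Proof.
move=> mD Lw k u v Lu Lv; rewrite /inner -RintegralZl//; last exact: L2_integrable.
rewrite -RintegralD//; last 2 first.
- exact: (integrableZl mD k (L2_integrable mD Lu Lw)).
- exact: L2_integrable.
by apply: eq_Rintegral => x _; rewrite mulrDl -mulrA.
Qed.

Lemma inner_form D : measurable D -> psd_form (L2 D) (inner D).
Proof.
move=> mD; split => [u v _ _|w Lw|u _].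
- by apply: eq_Rintegral => x _; rewrite mulrC.
- exact: inner_linear.
- by apply: Rintegral_ge0 => x _; rewrite -expr2 sqr_ge0.
Qed.

Lemma L2_subset D Q u : measurable D -> measurable Q -> Q `<=` D -> L2 D u -> L2 Q u.
Proof.
move=> mD mQ QD Lu; apply: L2_intro => //.
- by apply: measurable_funS QD _ => //; exact: L2_measurable.
- by apply: integrableS QD _ => //; exact: L2_sqr_integrable.
Qed.

Lemma inner_EFin D u : measurable D -> L2 D u ->
  (\int[mu]_(x in D) (u x ^+ 2)%:E)%E = (inner D u u)%:E.
Proof.
move=> mD Lu; rewrite /inner /Rintegral fineK.
  by apply: eq_integral => x _; rewrite expr2.
exact: integrable_fin_num (L2_integrable mD Lu Lu).
Qed.

Lemma inner_subset D Q u : measurable D -> measurable Q -> Q `<=` D -> L2 D u ->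
  inner Q u u <= inner D u u.
Proof.
move=> mD mQ QD Lu; rewrite -lee_fin -!inner_EFin//; last exact: L2_subset Lu.
apply: ge0_subset_integral => //.
  by apply/measurable_EFinP; apply: measurable_funX; exact: L2_measurable.
by move=> x _; rewrite lee_fin sqr_ge0.
Qed.

End square_integrable.

(** * Completeness of L^2 along geometrically convergent sequences *)

Section completeness.
Context {R : realType}.
Local Notation plane := (measurableTypeR R * measurableTypeR R)%type.
Local Notation mu := (@lebesgue2 R).

(** One step of a weighted Cauchy-Schwarz inequality: [w] accumulates the weights [p], and [S] the
    terms d^2 / p. The cross term is bounded by the arithmetic-geometric mean inequality for [X] and
    [Y]. *)
Lemma weighted_sqr_add (A d w S p : R) : 0 <= w -> 0 <= S -> 0 < p ->
  A ^+ 2 <= w * S -> (A + d) ^+ 2 <= (w + p) * (S + p^-1 * d ^+ 2).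
Proof.
move=> w0 S0 p0 AwS.
pose X := w * (p^-1 * d ^+ 2); pose Y := p * S.
have X0 : 0 <= X by rewrite mulr_ge0// mulr_ge0 ?sqr_ge0// invr_ge0 ltW.
have Y0 : 0 <= Y by rewrite mulr_ge0// ltW.
have XY : X * Y = w * S * d ^+ 2 by rewrite /X /Y; field; rewrite gt_eqF.
have h : 2 * (A * d) <= X + Y.
  apply: (le_trans (ler_norm _)).
  rewrite -(ler_pXn2r (n := 2)) ?nnegrE ?addr_ge0// real_normK ?num_real//.
  have -> : (2 * (A * d)) ^+ 2 = 4 * (A ^+ 2 * d ^+ 2) by ring.
  have := ler_wpM2r (sqr_ge0 d) AwS; rewrite -XY.
  by have := sqr_ge0 (X - Y); nra.
have -> : (w + p) * (S + p^-1 * d ^+ 2) = w * S + X + Y + d ^+ 2.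
  by rewrite /X /Y; field; rewrite gt_eqF.
by rewrite sqrrD; lra.
Qed.

(** Cauchy-Schwarz with the weights 2^-k, whose tail from [n] on sums to 2 * 2^-n. *)
Lemma geometric_increments (a : nat -> R) g :
  (forall n, \sum_(k < n) 2 ^+ k * (a k.+1 - a k) ^+ 2 <= g) ->
  exists2 l, a n @[n --> \oo] --> l & forall n, (a n - l) ^+ 2 <= 2 * 2^-1 ^+ n * g.
Proof.
move=> ag; have h0 (n : nat) : 0 < (2^-1 : R) ^+ n by rewrite exprn_gt0.
have g0 : 0 <= g by have := ag 0%N; rewrite big_ord0.
have key m n : (a (n + m)%N - a m) ^+ 2 <= (2 * 2^-1 ^+ m - 2 * 2^-1 ^+ (n + m)) *
    \sum_(k < n + m) 2 ^+ k * (a k.+1 - a k) ^+ 2.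
  elim: n => [|n IH]; first by rewrite add0n !subrr mul0r expr0n.
  have dec : (2^-1 : R) ^+ (n + m) <= 2^-1 ^+ m.
    by apply: ler_wiXn2l; [lra|lra|rewrite leq_addl].
  have := weighted_sqr_add (a (n.+1 + m)%N - a (n + m)%N) _ _ (h0 (n + m)%N) IH.
  rewrite [a (n + m)%N - a m + _]addrC subrKA addSn big_ord_recr /= (exprS 2^-1) -[X in X * (_ - _) ^+ 2]exprVn invrK.
  have -> : 2 * (2^-1 * 2^-1 ^+ (n + m)) = (2^-1 : R) ^+ (n + m) by field.
  have -> : 2 * 2^-1 ^+ m - 2 * 2^-1 ^+ (n + m) + 2^-1 ^+ (n + m) =
    2 * 2^-1 ^+ m - (2^-1 : R) ^+ (n + m) by lra.
  apply; first lra.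
  by apply: sumr_ge0 => k _; apply: mulr_ge0; [exact: exprn_ge0|exact: sqr_ge0].
have key2 m n : (m <= n)%N -> (a n - a m) ^+ 2 <= 2 * 2^-1 ^+ m * g.
  move=> mn; rewrite -(subnK mn); apply: (le_trans (key _ _)).
  apply: ler_pM => //.
  - rewrite subr_ge0 ler_pM2l//; apply: ler_wiXn2l; [lra|lra|by rewrite leq_addl].
  - by apply: sumr_ge0 => k _; apply: mulr_ge0; [exact: exprn_ge0|exact: sqr_ge0].
  - by rewrite lerBlDr lerDl mulr_ge0// ltW.
have small e : 0 < e -> exists m, 2 * 2^-1 ^+ m * g < e.
  move=> e0.
  have : (2^-1 : R) ^+ n @[n --> \oo] --> 0 by apply: cvg_expr; rewrite ger0_norm; lra.
  have e1 : 0 < e / (2 * g + 1) by rewrite divr_gt0//; lra.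
  move=> /cvgrPdist_lt /(_ _ e1) [n _ /(_ n (leqnn _))] /=.
  rewrite sub0r normrN ger0_norm ?(ltW (h0 _))// ltr_pdivlMr; last by lra.
  by move=> H; exists n; have := h0 n; nra.
have ca : cvgn a.
  apply/cauchy_cvgP; apply: cauchy_exP => e e0.
  have [m me] := small (e ^+ 2) (exprn_gt0 2 e0).
  exists (a m), m => // n /= mn; rewrite /ball /= distrC.
  rewrite -(ltr_pXn2r (n := 2)) ?nnegrE ?(ltW e0)// real_normK ?num_real//.
  exact: le_lt_trans (key2 _ _ mn) me.
exists (limn a) => // m.
have cs : (a m - a n) ^+ 2 @[n --> \oo] --> (a m - limn a) ^+ 2.
  by rewrite expr2; under eq_fun do rewrite expr2; apply: cvgM; apply: cvgB => //; exact: cvg_cst.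
rewrite -(cvg_lim _ cs)//; apply: limr_le; first by apply/cvg_ex; eexists; exact: cs.
by exists m => // n /= mn; rewrite -opprB sqrrN; exact: key2.
Qed.

(** Squared increments of order 4^-n remain summable after multiplication by 2^n; the resulting
    series [G] has integral at most 2 K and dominates the error pointwise. *)
Lemma L2_complete (D : set plane) (u : nat -> R * R -> R) K :
  measurable D -> (forall n, L2 D (u n)) ->
  (forall n, inner D (u n.+1 - u n) (u n.+1 - u n) <= K * 4^-1 ^+ n) ->
  exists2 v, L2 D v & forall n, inner D (u n - v) (u n - v) <= 4 * K * 2^-1 ^+ n.
Proof.
move=> mD Lu uK; have sL := L2_subspace mD.
pose t k (x : plane) : \bar R := (2 ^+ k * (u k.+1 x - u k x) ^+ 2)%:E.
have t0 k x : (0 <= t k x)%E by rewrite lee_fin; apply: mulr_ge0; [exact: exprn_ge0|exact: sqr_ge0].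
have mu_ n : measurable_fun D (u n : plane -> R) by exact: L2_measurable.
have mt k : measurable_fun D (t k).
  apply/measurable_EFinP; apply: measurable_funM; first exact: measurable_cst.
  by apply: measurable_funX; apply: measurable_funB.
pose G x : \bar R := (\sum_(0 <= k <oo) t k x)%E.
have mG : measurable_fun D G.
  by apply: (ge0_emeasurable_sum (P := xpredT)) => [k x _ _|k _]; [exact: t0|exact: mt].
have G0 x : (0 <= G x)%E by apply: nneseries_ge0.
have iG : (\int[mu]_(x in D) G x <= (2 * K)%:E)%E.
  rewrite integral_nneseries//; apply: lime_le.
    by apply: is_cvg_nneseries => n _ _; apply: integral_ge0.
  apply: nearW => n.
  have tE k : (\int[mu]_(x in D) t k x <= (K * 2^-1 ^+ k)%:E)%E.
    rewrite /t; under eq_integral do rewrite EFinM.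
    have Lk := subspaceB sL (Lu k.+1) (Lu k).
    rewrite ge0_integralZl_EFin ?exprn_ge0//; last 2 first.
    - by move=> x _; rewrite lee_fin sqr_ge0.
    - by apply/measurable_EFinP; apply: measurable_funX; apply: measurable_funB.
    rewrite (inner_EFin mD Lk) -EFinM lee_fin.
    apply: (@le_trans _ _ (2 ^+ k * (K * 4^-1 ^+ k))).
      by rewrite ler_wpM2l// exprn_ge0.
    rewrite mulrCA -exprMn; have -> // : 2 * 4^-1 = 2^-1 :> R by field.
  have -> : ((\sum_(0 <= k < n) \int[mu]_(x in D) t k x) <= (2 * K)%:E)%E.
    apply: (@le_trans _ _ (\sum_(0 <= k < n) (K * 2^-1 ^+ k)%:E)%E).
      by apply: lee_sum => k _.
    rewrite sumEFin lee_fin -mulr_sumr mulrC.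
    have K0 : 0 <= K.
      have := uK 0%N; rewrite expr0 mulr1; apply: le_trans.
      exact: form_ge0 (inner_form mD) _ (subspaceB sL (Lu 1%N) (Lu 0%N)).
    rewrite ler_wpM2r//.
    suff -> : \sum_(0 <= i < n) 2^-1 ^+ i = 2 - 2 * 2^-1 ^+ n :> R.
      by rewrite lerBlDr lerDl mulr_ge0// exprn_ge0.
    elim: n => [|n IH]; first by rewrite big_nil expr0; lra.
    by rewrite big_nat_recr//= IH exprS; field.
  by [].
(* The upper limit is measurable and is the true limit wherever [G] is finite. Where [G] is infinite
   the bound [uv] is trivial, so no null set has to be removed. *)
pose v x := fine (limn_esup (fun n => (u n x)%:E)).
have mv : measurable_fun D (v : plane -> R).
  apply: (measurableT_comp (fine_measurable measurableT)).
  by apply: measurable_fun_limn_esup => n; apply/measurable_EFinP.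
have uv n x : (((u n x - v x) ^+ 2)%:E <= (2 * 2^-1 ^+ n)%:E * G x)%E.
  have h0 : 0 < 2 * (2^-1 : R) ^+ n by rewrite mulr_gt0// exprn_gt0.
  have [Gfin|] := boolP (G x \is a fin_num); last first.
    by rewrite ge0_fin_numE// -leNgt leye_eq => /eqP ->; rewrite gt0_muley ?leey// lte_fin.
  have [|l ul lP] := @geometric_increments (u ^~ x) (fine (G x)).
    move=> m; rewrite -lee_fin fineK// -sumEFin.
    apply: le_trans (nneseries_lim_ge m _); last by move=> k _ _; exact: t0.
    by rewrite big_mkord.
  rewrite -(fineK Gfin) -EFinM lee_fin.
  suff -> : v x = l by exact: lP.
  have ul' : (u n x)%:E @[n --> \oo] --> l%:E by apply: cvg_EFin => //; exact: nearW.
  rewrite /v is_cvg_limn_esupE; last by apply/cvg_ex; exists l%:E.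
  by rewrite (cvg_lim _ ul').
have bound n : (\int[mu]_(x in D) ((u n x - v x) ^+ 2)%:E <= (4 * K * 2^-1 ^+ n)%:E)%E.
  apply: (@le_trans _ _ (\int[mu]_(x in D) ((2 * 2^-1 ^+ n)%:E * G x))%E).
    apply: ge0_le_integral => [//|x _|||x _].
    - by rewrite lee_fin sqr_ge0.
    - by apply/measurable_EFinP; apply: measurable_funX; apply: measurable_funB.
    - by apply: emeasurable_funM => //; exact: measurable_cst.
    - exact: uv.
  rewrite ge0_integralZl_EFin ?mulr_ge0 ?exprn_ge0//.
  have -> : 4 * K * 2^-1 ^+ n = (2 * 2^-1 ^+ n) * (2 * K) by ring.
  rewrite [X in (_ <= X)%E]EFinM; apply: lee_wpmul2l => //.
have Luv n : L2 D (u n - v).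
  split; first exact: measurable_funB.
  exact: le_lt_trans (bound n) (ltry _).
have Lv : L2 D v by rewrite -[v](subKr (u 0%N)); apply: subspaceB.
exists v => // n; rewrite -lee_fin -(inner_EFin mD (Luv n)); exact: bound.
Qed.

End completeness.

Import HBNNSimple.

(** * Closure of a subspace in L^2: from indicators to all functions *)

Section L2_density.
Context {R : realType}.
Local Notation plane := (measurableTypeR R * measurableTypeR R)%type.
Local Notation mu := (@lebesgue2 R).
Variables (Q : set plane).
Hypotheses (mQ : measurable Q) (fQ : (mu Q < +oo)%E).
Implicit Types (u v w : R * R -> R).

Lemma bounded_L2 v (M : R) : @measurable_fun _ _ plane R Q v ->
  (forall x, Q x -> `|v x| <= M) -> L2 Q v.
Proof.
move=> mv vM; apply: L2_intro => //.
apply: measurable_bounded_integrable => //; first exact: measurable_funX.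
exists (M ^+ 2); split; first exact: num_real.
move=> N MN x Qx; rewrite /= normrX; apply: le_trans (ltW MN).
by rewrite ler_pXn2r ?nnegrE//; [exact: vM|apply: le_trans (vM x Qx)].
Qed.

Lemma L2_dominated_cvg v (vn : nat -> R * R -> R) h :
  L2 Q h -> L2 Q v -> (forall n, L2 Q (vn n)) ->
  (forall n x, Q x -> `|vn n x| <= h x) -> (forall x, Q x -> `|v x| <= h x) ->
  (forall x, Q x -> vn n x @[n --> \oo] --> v x) ->
  inner Q (v - vn n) (v - vn n) @[n --> \oo] --> 0.
Proof.
move=> Lh Lv Ln nh vh cv; have sL := L2_subspace mQ.
have c0 : (\int[mu]_(x in Q) ((v x - vn n x) ^+ 2)%:E)%E @[n --> \oo] --> (\int[mu]_(x in Q) (cst 0 x))%E.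
  apply: (dominated_cvg mQ (g := fun x => (4 * h x ^+ 2)%:E)).
  - move=> n; apply/measurable_EFinP; apply: measurable_funX.
    by apply: measurable_funB; exact: L2_measurable.
  - move=> x Qx; apply: cvg_EFin; first exact: nearW.
    rewrite [X in _ --> X](_ : _ = 0 * 0); last by rewrite mulr0.
    have cB : v x - vn n x @[n --> \oo] --> 0.
      by rewrite -(subrr (v x)); apply: cvgB; [exact: cvg_cst|exact: cv].
    by rewrite [X in X @ _ --> _](_ : _ = (fun n => (v x - vn n x) * (v x - vn n x)));
      [exact: cvgM|apply/funext => n /=; rewrite expr2].
  - by [].
  - exact: (integrableZl mQ 4 (L2_sqr_integrable mQ Lh)).
  - move=> n x Qx; rewrite /= lee_fin normrX.
    have h2 : `|v x - vn n x| <= 2 * h x.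
      by have := ler_normB (v x) (vn n x); have := vh x Qx; have := nh n x Qx; lra.
    by have := normr_ge0 (v x - vn n x); nra.
rewrite integral0 in c0.
have -> : (fun n => inner Q (v - vn n) (v - vn n)) =
    (fun n => fine (\int[mu]_(x in Q) ((v x - vn n x) ^+ 2)%:E)%E).
  by apply/funext => n; rewrite (inner_EFin mQ (subspaceB sL Lv (Ln n))).
exact: fine_cvg c0.
Qed.

Variable V : set (R * R -> R).
Hypotheses (sV : subspace V) (VL : V `<=` L2 Q).

Definition approximable v := L2 Q v /\
  forall e, 0 < e -> exists2 f, V f & inner Q (v - f) (v - f) < e.

Let sL := L2_subspace mQ.
Let fI := inner_form mQ.

Lemma approximable_close v : L2 Q v ->
  (forall e, 0 < e -> exists2 w, approximable w & inner Q (v - w) (v - w) < e) ->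
  approximable v.
Proof.
move=> Lv vw; split => // e e0.
have [w [Lw wf] vwe] := vw (e / 4) ltac:(lra).
have [f Vf wfe] := wf (e / 4) ltac:(lra).
exists f => //; rewrite -[v - f](subrKA w).
by have := form_sqrD_le sL fI (subspaceB sL Lv Lw) (subspaceB sL Lw (VL Vf)); lra.
Qed.

Lemma approximable_cvg v (vn : nat -> R * R -> R) h :
  L2 Q h -> L2 Q v -> (forall n, approximable (vn n)) ->
  (forall n x, Q x -> `|vn n x| <= h x) -> (forall x, Q x -> `|v x| <= h x) ->
  (forall x, Q x -> vn n x @[n --> \oo] --> v x) -> approximable v.
Proof.
move=> Lh Lv An nh vh cv; apply: approximable_close => // e e0.
have /cvgrPdist_lt /(_ e e0) [n _ /(_ n (leqnn _))] :=
  L2_dominated_cvg Lh Lv (fun n => (An n).1) nh vh cv.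
rewrite sub0r normrN => H; exists (vn n) => //.
exact: le_lt_trans (ler_norm _) H.
Qed.

Lemma approximable_subspace : subspace approximable.
Proof.
split.
  split; first by case: sL.
  move=> e e0; exists 0; first by case: sV.
  rewrite subr0 (linear_on0 sL (form_linl fI (proj1 sL)))//.
move=> k u v [Lu uf] [Lv vf]; split; first by case: sL => _; apply.
move=> e e0; have k0 : 0 < 4 * (k ^+ 2 + 1) by have := sqr_ge0 k; lra.
have [f Vf fe] := uf (e / (4 * (k ^+ 2 + 1))) (divr_gt0 e0 k0).
have [g Vg ge] := vf (e / 4) ltac:(lra).
exists (k *: f + g); first by case: sV => _; apply.
have -> : k *: u + v - (k *: f + g) = k *: (u - f) + (v - g).
  by rewrite scalerBr opprD addrACA.
have Luf := subspaceB sL Lu (VL Vf); have Lvg := subspaceB sL Lv (VL Vg).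
have := form_sqrD_le sL fI (subspaceZ k sL Luf) Lvg; rewrite (form_sqrZ sL fI)//.
move: fe; rewrite ltr_pdivlMr// => fe.
by have := form_ge0 fI Luf; have := sqr_ge0 k; nra.
Qed.

Lemma approximable_ext v w : L2 Q w -> (forall x, Q x -> v x = w x) ->
  approximable v -> approximable w.
Proof.
move=> Lw vw Av; apply: approximable_close => // e e0; exists v => //.
have -> : inner Q (w - v) (w - v) = \int[mu]_(x in Q) 0.
  apply: eq_Rintegral => x; rewrite inE => Qx.
  by have -> : (w - v) x = w x - v x by []; rewrite vw// subrr mul0r.
by rewrite Rintegral_cst// mul0r.
Qed.

Lemma indic_L2 (A : set plane) : measurable A -> L2 Q (\1_A : R * R -> R).
Proof.
move=> mA; apply: (@bounded_L2 _ 1); first by apply: measurable_funTS; exact: measurable_indic.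
by move=> x _; rewrite indicE ger0_norm// lern1 leq_b1.
Qed.

(** Proper differences come from linearity, increasing unions from dominated convergence. The map
    [F] and the set [E] are free so that the lemma applies to each coordinate in turn and then to
    the whole plane. *)
Lemma approximable_lambda d (T : measurableType d) (F : plane -> T) (E : set plane) :
  measurable_fun setT F -> measurable E -> approximable (\1_E) ->
  lambda_system setT [set A | measurable A /\ approximable (\1_(F @^-1` A `&` E))].
Proof.
move=> mF mE AE.
have mFE A : measurable A -> measurable (F @^-1` A `&` E).
  by move=> mA; apply: measurableI => //; rewrite -[_ @^-1` _]setTI; exact: mF.
split=> //=.
- by split => //; rewrite preimage_setT setTI.
- move=> A B BA [mA AA] [mB AB]; split; first exact: measurableD.
  have -> : \1_(F @^-1` (A `\` B) `&` E) = \1_(F @^-1` A `&` E) - \1_(F @^-1` B `&` E) :> (R * R -> R).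
    apply/funext => x; have -> : (\1_(F @^-1` A `&` E) - \1_(F @^-1` B `&` E)) x =
      \1_(F @^-1` A `&` E) x - \1_(F @^-1` B `&` E) x :> R by [].
    rewrite !indicE; have [Ex|Ex] := pselect (E x); last first.
      by rewrite !(@memNset _ _ x) ?subrr// => -[].
    have [Bx|Bx] := pselect (B (F x)).
      have Ax := BA _ Bx.
      rewrite (@memNset _ (_ `&` _)) ?(@mem_set _ (F @^-1` A `&` E) x) ?(@mem_set _ (F @^-1` B `&` E) x) ?subrr//.
      by move=> [[]].
    rewrite (@memNset _ (F @^-1` B `&` E)) ?subr0; last by move=> [].
    have [Ax|Ax] := pselect (A (F x)).
      by rewrite !mem_set.
    by rewrite !memNset// => -[] // [].
  exact: subspaceB approximable_subspace AA AB.
- move=> A ndA AA; split; first by apply: bigcup_measurable => n _; case: (AA n).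
  apply: (@approximable_cvg _ (fun n => \1_(F @^-1` (A n) `&` E)) (cst 1)).
  + by apply: (@bounded_L2 _ 1) => // x _; rewrite normr1.
  + apply: indic_L2; apply: mFE; by apply: bigcup_measurable => n _; case: (AA n).
  + by move=> n; case: (AA n).
  + by move=> n x _; rewrite indicE ger0_norm// lern1 leq_b1.
  + by move=> x _; rewrite indicE ger0_norm// lern1 leq_b1.
  + move=> x _; have [[[k _ Akx] Ex]|nx] := pselect ((F @^-1` (\bigcup_n A n) `&` E) x).
      apply: cvg_near_cst; exists k => // n /= kn; rewrite !indicE !mem_set//.
      * by split => //; exists k.
      * by split => //; have /subsetPset := ndA _ _ kn; apply.
    apply: cvg_near_cst; apply: nearW => n; rewrite !indicE !memNset//.
    by move=> [Anx Ex]; apply: nx; split => //; exists n.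
Qed.

Lemma approximable_L2 w : (forall A : set plane, measurable A -> approximable (\1_A)) ->
  L2 Q w -> approximable w.
Proof.
move=> Aind Lw; have sA := approximable_subspace.
have Asimple (g : {nnsfun plane >-> R}) : approximable (fun x : plane => g x).
  have -> : (fun x : plane => g x) = \sum_(y \in range g) (y *: (\1_(g @^-1` [set y]) : R * R -> R)).
    rewrite fsbig_finite//=; apply/funext => x; rewrite fimfunE fsbig_finite//=.
    by rewrite fct_sumE.
  rewrite fsbig_finite//=; elim/big_ind: _ => [|u v Au Av|y _].
  - by case: sA.
  - exact: subspaceD.
  - apply: subspaceZ => //; apply: Aind.
    by rewrite -[_ @^-1` _]setTI; exact: measurable_funP.
have pos v : L2 Q v -> (forall x, 0 <= v x) -> approximable v.
  move=> Lv v0.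
  have mv : measurable_fun Q (EFin \o v : plane -> \bar R).
    by apply/measurable_EFinP; exact: L2_measurable.
  have [g [ndg gv]] := @approximation _ plane R Q mQ _ mv (fun x _ => v0 x).
  have gv' x : Q x -> g n x @[n --> \oo] --> v x.
    by move=> Qx; have /fine_cvg := gv x Qx.
  have gle n x : Q x -> g n x <= v x.
    move=> Qx; rewrite -(cvg_lim _ (gv' x Qx))//; apply: nondecreasing_cvgn_le.
      by move=> i j ij; have /lefP := ndg _ _ ij; apply.
    by apply/cvg_ex; exists (v x); exact: gv'.
  apply: (@approximable_cvg _ (fun n => g n) v) => //.
  - by move=> n x Qx; rewrite ger0_norm// gle.
  - by move=> x Qx; rewrite ger0_norm.
have Labs : L2 Q (fun x => `|w x|).
  have [mw iw] := Lw; split; first exact: measurableT_comp.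
  by under eq_integral do rewrite real_normK ?num_real//.
(* Positive and negative parts of [w]. *)
have -> : w = 2^-1 *: ((fun x => `|w x|) + w) - 2^-1 *: ((fun x => `|w x|) - w).
  apply/funext => x.
  by have -> : (2^-1 *: ((fun x => `|w x|) + w) - 2^-1 *: ((fun x => `|w x|) - w)) x
    = 2^-1 * (`|w x| + w x) - 2^-1 * (`|w x| - w x) by []; field.
apply: subspaceB => //; apply: subspaceZ => //; apply: pos.
- exact: subspaceD.
- by move=> x; have -> : ((fun x => `|w x|) + w) x = `|w x| + w x by []; have := ler_norm (- w x); rewrite normrN; lra.
- exact: subspaceB.
- by move=> x; have -> : ((fun x => `|w x|) - w) x = `|w x| - w x by []; have := ler_norm (w x); lra.
Qed.

(** The duality principle behind the Poincare inequality: a norm is controlled by pairings with a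
    dense class only. *)
Lemma dense_norm_bound w K : approximable w ->
  (forall f, V f -> inner Q w f ^+ 2 <= K * inner Q f f) ->
  0 <= K -> inner Q w w <= K.
Proof.
move=> [Lw wf] wK K0; apply/ler_addgt0Pr => e e0.
have [f Vf fe] := wf e e0; have Lf := VL Vf.
have := form_sqrB sL fI Lw Lf; have F0 := form_ge0 fI Lf.
(* Young's inequality suffices here: expanding [w - f] then gives [inner Q w w < K + e], with no
   division by the norm of [f]. *)
have h : 2 * inner Q w f <= K + inner Q f f.
  apply: (le_trans (ler_norm _)).
  rewrite -(ler_pXn2r (n := 2)) ?nnegrE ?addr_ge0// real_normK ?num_real//.
  have := wK f Vf; rewrite exprMn; have := sqr_ge0 (K - inner Q f f); nra.
lra.
Qed.

End L2_density.

Ltac split_bools := repeat match goal with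
  | H : is_true (_ && _) |- _ => move/andP: H => H
  | H : _ /\ _ |- _ => destruct H
  | |- is_true (_ && _) => apply/andP
  | |- _ /\ _ => split
  end; try by [].

(** * Density of tensor products of test functions in L^2 of a box *)

Section tensor_span.
Context {R : realType}.
Local Notation plane := (measurableTypeR R * measurableTypeR R)%type.
Local Notation mu := (@lebesgue2 R).
Variables x0 x1 y0 y1 : R.
Local Notation Q := (box x0 x1 y0 y1 : set plane).
Implicit Types (f g v w : R * R -> R).

(** Finite sums of tensors; scalars are absorbed into the first factor. The inductive form lets
    identities be proved one tensor at a time. *)
Inductive tensor_span : set (R * R -> R) :=
| tensor_span0 : tensor_span 0
| tensor_span_add (a b : R -> R) f : test1 x0 x1 a -> test1 y0 y1 b -> tensor_span f ->
    tensor_span (tensor a b + f).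

Lemma tensor_span_tensor (a b : R -> R) : test1 x0 x1 a -> test1 y0 y1 b ->
  tensor_span (tensor a b).
Proof.
by move=> ta tb; rewrite -[tensor a b]addr0; apply: tensor_span_add => //; exact: tensor_span0.
Qed.

Lemma tensor_span_subspace : subspace tensor_span.
Proof.
split; first exact: tensor_span0.
move=> k u v su sv; elim: su => [|a b f ta tb _ IH]; first by rewrite scaler0 add0r.
have -> : k *: (tensor a b + f) + v = tensor (fun x => k * a x) b + (k *: f + v).
  rewrite scalerDr -addrA; congr (_ + _); apply/funext => p.
  by have -> : (k *: tensor a b) p = k * (a p.1 * b p.2) by []; rewrite /tensor mulrA.
by apply: tensor_span_add => //; exact: test1Z.
Qed.

Lemma boxE (a b c d : R) : box a b c d = `]a, b[ `*` `]c, d[.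
Proof. by apply/seteqP; split => p; rewrite /box /= !in_itv. Qed.

Lemma measurable_box (a b c d : R) : measurable (box a b c d : set plane).
Proof. by rewrite boxE; apply: measurableX; exact: measurable_itv. Qed.

Lemma box_area (a b c d : R) : a <= b -> c <= d ->
  mu (box a b c d : set plane) = ((b - a) * (d - c))%:E.
Proof.
move=> ab cd; rewrite boxE.
apply: etrans (product_measure1E (@lebesgue_measure R) (@lebesgue_measure R)
  (measurable_itv `]a, b[) (measurable_itv `]c, d[)) _.
have len (u v : R) : u <= v -> @lebesgue_measure R `]u, v[%classic = (v - u)%:E.
  move=> uv; rewrite lebesgue_measure_itv /= lte_fin; case: ltP => // vu.
  by rewrite (_ : v = u) ?subrr//; apply/eqP; rewrite eq_le vu.
by rewrite EFinM; congr (_ * _)%E; exact: len.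
Qed.

Lemma box_finite (a b c d : R) : (mu (box a b c d : set plane) < +oo)%E.
Proof.
have [ab|ab] := ltP a b; have [cd|cd] := ltP c d.
- by rewrite box_area ?ltW// ltry.
all: rewrite (_ : box _ _ _ _ = set0) ?measure0//.
all: by apply/seteqP; split => // p [] /andP[? ?] /andP[? ?] /=; lra.
Qed.

Let mQ := measurable_box x0 x1 y0 y1.
Let fQ := box_finite x0 x1 y0 y1.

Lemma measurable_tensor (a b : R -> R) (D : set plane) : continuous a -> continuous b ->
  @measurable_fun _ _ plane R D (tensor a b).
Proof.
move=> ca cb; apply: measurable_funTS; apply: measurable_funM.
  by apply: measurableT_comp => //; exact: continuous_measurable_fun.
by apply: measurableT_comp => //; exact: continuous_measurable_fun.
Qed.

Lemma test1_bounded x0' x1' (a : R -> R) : test1 x0' x1' a ->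
  exists2 M, 0 <= M & forall x, `|a x| <= M.
Proof.
move=> [sa ua]; have [xx|xx] := leP x0' x1'; last first.
  exists 0 => // x; rewrite (supported_out ua) ?normr0//.
  by have [//|h] := leP x x0'; rewrite /= ltW// (lt_trans xx).
have cn : {within `[x0', x1'], continuous (fun x => `|a x|)}.
  apply: continuous_subspaceT => x.
  have ca := smooth_continuous sa.
  by apply: (continuous_comp (ca x)); exact: norm_continuous.
have [c _ cmax] := EVT_max xx cn; exists `|a c| => // x.
have [xin|xout] := boolP (x \in `[x0', x1']); first exact: cmax.
rewrite (supported_out ua) ?normr0//; move: xout; rewrite in_itv /= negb_and -!ltNge.
by case/orP => /ltW ->; rewrite ?orbT.
Qed.

Lemma tensor_L2 (D : set plane) x0' x1' y0' y1' (a b : R -> R) :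
  measurable D -> (mu D < +oo)%E -> test1 x0' x1' a -> test1 y0' y1' b ->
  L2 D (tensor a b).
Proof.
move=> mD fD ta tb; have [M M0 aM] := test1_bounded ta; have [N N0 bN] := test1_bounded tb.
apply: (bounded_L2 mD fD (M := M * N)).
  by apply: measurable_tensor; apply: smooth_continuous; [case: ta|case: tb].
by move=> p _; rewrite normrM ler_pM.
Qed.

Lemma tensor_span_L2 (D : set plane) : measurable D -> (mu D < +oo)%E ->
  tensor_span `<=` L2 D.
Proof.
move=> mD fD f; elim => [|a b {}f ta tb _ IH]; first by case: (L2_subspace mD).
by apply: subspaceD => //; [exact: L2_subspace|exact: tensor_L2 ta tb].
Qed.

Let VL := tensor_span_L2 mQ fQ.
Let sV := tensor_span_subspace.
Local Notation approx := (approximable Q tensor_span).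

Lemma approximable_span f : tensor_span f -> approx f.
Proof.
move=> sf; split; first exact: VL.
move=> e e0; exists f => //; rewrite subrr.
have [L0 _] := L2_subspace mQ.
by have -> : inner Q 0 0 = 0 :> R by exact: (linear_on0 (L2_subspace mQ) (form_linl (inner_form mQ) L0)).
Qed.

(** Only the trace on the box matters, so unbounded strips may be replaced by boxes inside [Q]. *)
Let ext (A B : set plane) : measurable B -> A `&` Q = B `&` Q ->
  approx \1_A -> approx \1_B.
Proof.
move=> mB AB; apply: (approximable_ext mQ VL); first exact: indic_L2.
move=> p Qp; rewrite !indicE; congr (nat_of_bool _)%:R.
apply/idP/idP; rewrite !inE => h.
  by have [] : (B `&` Q) p by rewrite -AB.
by have [] : (A `&` Q) p by rewrite AB.
Qed.

Let measurable_strip (A B : set (measurableTypeR R)) : measurable A -> measurable B ->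
  measurable (fst @^-1` A `&` snd @^-1` B : set plane).
Proof.
move=> mA mB; apply: measurableI; rewrite -[_ @^-1` _]setTI.
  exact: measurable_fst.
exact: measurable_snd.
Qed.

(** Products of plateaus converge pointwise to the indicator and are bounded by 1. *)
Let approx_inner (a b c d : R) : x0 <= a -> b <= x1 -> y0 <= c -> d <= y1 ->
  approx \1_(box a b c d : set plane).
Proof.
move=> xa bx yc dy.
have pc (u v : R) k : continuous (plateau u v k.+1%:R^-1).
  by apply: smooth_continuous; case: (@test1_plateau R u v k.+1%:R^-1 _); rewrite ?invr_gt0.
apply: (@approximable_cvg _ _ mQ _ VL _
  (fun k => tensor (plateau a b k.+1%:R^-1) (plateau c d k.+1%:R^-1)) (cst 1)).
- by apply: (bounded_L2 mQ fQ (M := 1)) => // x _; rewrite normr1.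
- by apply: indic_L2 => //; exact: measurable_box.
- move=> k; apply: approximable_span; apply: tensor_span_tensor.
    by apply: (test1W xa bx); apply: test1_plateau; rewrite invr_gt0.
  by apply: (test1W yc dy); apply: test1_plateau; rewrite invr_gt0.
- move=> k p _; rewrite ger0_norm; last by apply: mulr_ge0; exact: plateau_ge0.
  by apply: mulr_ile1; rewrite ?plateau_ge0 ?plateau_le1.
- by move=> p _; rewrite indicE ger0_norm// lern1 leq_b1.
move=> p _.
have -> : \1_(box a b c d) p = \1_(`]a, b[%classic) p.1 * \1_(`]c, d[%classic) p.2 :> R.
  rewrite !indicE -natrM mulnb; congr (nat_of_bool _)%:R.
  rewrite boxE; apply/idP/andP; rewrite !inE; first by case.
  by case.
by apply: cvgM; exact: plateau_cvg.
Qed.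

Let opens_setI_closed : setI_closed (RGenOpens.G (R := R)).
Proof.
move=> _ _ [a [b ->]] [a' [b' ->]]; exists (Num.max a a'), (Num.min b b').
apply/seteqP; split => x; rewrite /= !in_itv /= gt_max lt_min.
  by move=> ?; split_bools.
by move=> ?; split_bools.
Qed.

(** First use of the pi-lambda theorem, in the first coordinate: open intervals generate, and the
    second coordinate stays in a fixed interval. *)
Let approx_strip (A : set (measurableTypeR R)) (c d : R) : measurable A ->
  approx \1_(fst @^-1` A `&` snd @^-1` `]c, d[%classic : set plane).
Proof.
have E : approx \1_(snd @^-1` `]c, d[%classic : set plane).
  apply: (@ext (box x0 x1 (Num.max c y0) (Num.min d y1))).
  - by rewrite -[_ @^-1` _]setTI; exact: measurable_snd.
  - apply/seteqP; split => -[x y] /=; rewrite /box /= !in_itv /= !gt_max !lt_min.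
      by move=> ?; split_bools.
    by move=> ?; split_bools.
  - by apply: approx_inner; rewrite ?le_max ?ge_min lexx ?orbT.
move=> mA.
have H := @approximable_lambda _ _ mQ fQ _ sV VL _ (measurableTypeR R) fst _ measurable_fst
  (measurable_strip measurableT (measurable_itv `]c, d[)).
rewrite preimage_setT setTI in H; have {}H := H E.
have S := lambda_system_subset opens_setI_closed H.
move: mA; rewrite RGenOpens.measurableE => mA.
apply: (S _ _ A mA).2; last by move=> X _ x _.
move=> _ [a [b ->]]; split; first exact: measurable_itv.
apply: (@ext (box (Num.max a x0) (Num.min b x1) (Num.max c y0) (Num.min d y1))).
- by apply: measurable_strip; exact: measurable_itv.
- apply/seteqP; split => -[x y] /=; rewrite /box /= !in_itv /= !gt_max !lt_min.
    by move=> ?; split_bools.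
  by move=> ?; split_bools.
- by apply: approx_inner; rewrite ?le_max ?ge_min lexx ?orbT.
Qed.

(** The same argument in the second coordinate, with the first now in an arbitrary measurable
    set. *)
Let approx_rectangle (A B : set (measurableTypeR R)) : measurable A -> measurable B ->
  approx \1_(fst @^-1` A `&` snd @^-1` B : set plane).
Proof.
move=> mA mB; rewrite setIC.
have E : approx \1_(fst @^-1` A : set plane).
  apply: (ext _ _ (approx_strip y0 y1 mA)).
  - by rewrite -[_ @^-1` _]setTI; exact: measurable_fst.
  - apply/seteqP; split => -[x y] /=; rewrite /box /= in_itv /=; by move=> ?; split_bools.
have mfA : measurable (fst @^-1` A : set plane).
  by rewrite -[_ @^-1` _]setTI; exact: measurable_fst.
have H := @approximable_lambda _ _ mQ fQ _ sV VL _ (measurableTypeR R) snd _ measurable_snd mfA E.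
have S := lambda_system_subset opens_setI_closed H.
move: mB; rewrite RGenOpens.measurableE => mB.
apply: (S _ _ B mB).2; last by move=> X _ x _.
move=> _ [c [d ->]]; split; first exact: measurable_itv.
by rewrite setIC; exact: approx_strip.
Qed.

(** A third pi-lambda argument, from measurable rectangles to the product sigma-algebra. *)
Lemma approximable_box w : L2 Q w -> approx w.
Proof.
apply: (approximable_L2 mQ sV VL) => E mE.
have := @approximable_lambda _ _ mQ fQ _ sV VL _ plane id setT (@measurable_id _ _ _) measurableT.
have AT : approx \1_(setT : set plane).
  have := approx_rectangle measurableT measurableT; rewrite !preimage_setT setTI.
  by [].
move=> /(_ AT) /lambda_system_subset S.
move: mE; rewrite measurable_prod_measurableType => mE.
have := (S _ _ _ _ E mE).2; rewrite setIT; apply.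
- move=> _ _ [A mA [B mB <-]] [A' mA' [B' mB' <-]].
  exists (A `&` A'); first exact: measurableI.
  by exists (B `&` B'); [exact: measurableI|rewrite setXI].
- move=> _ [A mA [B mB <-]]; split; first exact: measurableX.
  by rewrite setIT; exact: approx_rectangle.
- by move=> X _ x _.
Qed.

End tensor_span.

(** * Moving the mass of a function of one variable onto a bump *)

Section transport.
Context {R : realType}.
Implicit Types (f g h : R -> R) (a b c x : R).
Local Notation mu := (@lebesgue_measure R).

Lemma Rintegral_test1D a b f g : test1 a b f -> test1 a b g ->
  \int[mu]_x (f x + g x) = \int[mu]_x f x + \int[mu]_x g x.
Proof.
move=> tf tg; rewrite RintegralD//.
- exact: test1_integrable tf.
- exact: test1_integrable tg.
Qed.

Lemma Rintegral_test1Z a b c f : test1 a b f ->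
  \int[mu]_x (c * f x) = c * \int[mu]_x f x.
Proof. by move=> tf; rewrite RintegralZl//; exact: test1_integrable tf. Qed.

Lemma test1_sqr a b f : test1 a b f -> test1 a b (fun x => f x ^+ 2).
Proof.
move=> [sf uf]; split; first by under eq_fun do rewrite expr2; exact: smoothM.
by under eq_fun do rewrite expr2; exact: supportedZ.
Qed.

(* Moves the mass of [f] onto the bump. *)
Definition transport a b f : R -> R :=
  primitive (fun x => f x - (\int[mu]_t f t) * bump a b x).

Section interval.
Variables (a b : R).
Hypothesis ab : a < b.
Let tb := test1_bump ab.

Let len : fine (mu `[a, b]%classic) = b - a.
Proof. by rewrite lebesgue_measure_itv /= lte_fin ab. Qed.

Let continuous_integrable g : continuous g -> mu.-integrable `[a, b]%classic (EFin \o g).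
Proof.
move=> cg; apply: continuous_compact_integrable; first exact: segment_compact.
exact: continuous_subspaceT.
Qed.

Let continuous_cst (c : R) : continuous (fun _ : R => c).
Proof. by move=> x; exact: cvg_cst. Qed.

Let continuous_abs f : continuous f -> continuous (fun x => `|f x|).
Proof. by move=> cf x; apply: (continuous_comp (cf x)); exact: norm_continuous. Qed.

Let corrected f : test1 a b f ->
  test1 a b (fun x => f x - (\int[mu]_t f t) * bump a b x).
Proof. by move=> tf; apply: test1B => //; exact: test1Z. Qed.

Lemma test1_transport f : test1 a b f -> test1 a b (transport a b f).
Proof.
move=> tf; apply: test1_primitive; first exact: corrected.
have tZ := test1Z (- \int[mu]_t f t) tb.
under [LHS]eq_Rintegral => x _ do rewrite -mulNr.
by rewrite (Rintegral_test1D tf tZ) (Rintegral_test1Z _ tb) Rintegral_bump// mulr1 subrr.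
Qed.

Lemma transport_derive f x : test1 a b f ->
  is_derive x 1 (transport a b f) (f x - (\int[mu]_t f t) * bump a b x).
Proof. by move=> tf; exact: primitive_derive (corrected tf). Qed.

Lemma transport_linear c f g x : test1 a b f -> test1 a b g ->
  transport a b (fun x => c * f x + g x) x = c * transport a b f x + transport a b g x.
Proof.
move=> tf tg; have tcf := test1Z c tf.
rewrite /transport -(primitiveZ _ _ (corrected tf)).
rewrite -(primitiveD _ (test1Z c (corrected tf)) (corrected tg)).
congr (primitive _ _); apply/funext => t.
by rewrite (Rintegral_test1D tcf tg) (Rintegral_test1Z _ tf); ring.
Qed.

Lemma sqr_Rintegral_abs f : test1 a b f ->
  (\int[mu]_x `|f x|) ^+ 2 <= (b - a) * \int[mu]_x f x ^+ 2.
Proof.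
move=> tf; have [sf uf] := tf.
have uabs : supported a b (fun x => `|f x|).
  by case: uf => [c [d [ac db fcd]]]; exists c, d; split => // x; rewrite normr_eq0; exact: fcd.
have usq := (test1_sqr tf).2.
rewrite -(Rintegral_supported uabs (A := `[a, b]%classic))//.
rewrite -(Rintegral_supported usq (A := `[a, b]%classic))//.
have cf := smooth_continuous sf.
have cabs := continuous_abs cf.
have csq : continuous (fun x => f x ^+ 2) by apply: smooth_continuous; case: (test1_sqr tf).
have L0 : 0 < b - a by rewrite subr_gt0.
set I := \int[mu]_(x in _) `|f x|; set J := \int[mu]_(x in _) _.
(* The mean of |f|: nonnegativity of the variance is the desired Cauchy-Schwarz inequality. *)
pose t := I / (b - a).
have : 0 <= \int[mu]_(x in `[a, b]) (`|f x| - t) ^+ 2.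
  by apply: Rintegral_ge0 => x _; exact: sqr_ge0.
have -> : \int[mu]_(x in `[a, b]) (`|f x| - t) ^+ 2 =
    \int[mu]_(x in `[a, b]) ((f x ^+ 2 + (- (2 * t)) * `|f x|) + t ^+ 2).
  by apply: eq_Rintegral => x _; rewrite sqrrB real_normK ?num_real//; ring.
have i2 : mu.-integrable `[a, b]%classic (EFin \o (fun x => - (2 * t) * `|f x|)).
  by apply: continuous_integrable => x; apply: cvgM; [exact: cvg_cst|exact: cabs].
have i12 : mu.-integrable `[a, b]%classic (EFin \o (fun x => f x ^+ 2 + - (2 * t) * `|f x|)).
  by apply: continuous_integrable => x; apply: cvgD; [exact: csq|apply: cvgM; [exact: cvg_cst|exact: cabs]].
rewrite RintegralD//; last exact: continuous_integrable.
rewrite RintegralD//; last exact: continuous_integrable.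
rewrite RintegralZl//; last exact: continuous_integrable.
rewrite Rintegral_cst// [fine _]len -/I -/J.
have -> : J + - (2 * t) * I + t ^+ 2 * (b - a) = (((b - a) * J) - I ^+ 2) / (b - a).
  by rewrite /t; field; rewrite gt_eqF.
by rewrite pmulr_lge0 ?invr_gt0// subr_ge0.
Qed.

(** The integrated function has L^1 norm at most (1 + N) times that of [f], and 1 <= N. *)
Lemma transport_abs N f x : 1 <= N -> (forall x, `|bump a b x| <= N / (b - a)) ->
  test1 a b f -> `|transport a b f x| <= 2 * N * \int[mu]_x `|f x|.
Proof.
move=> N1 bN tf; apply: (le_trans (primitive_le _ (corrected tf))).
set m := \int[mu]_t f t; set I := \int[mu]_x `|f x|.
have mI : `|m| <= I by apply: le_normr_Rintegral => //; exact: test1_integrable tf.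
have uabs g : test1 a b g -> supported a b (fun x => `|g x|).
  by case=> _ [c [d [ac db fcd]]]; exists c, d; split => // t; rewrite normr_eq0; exact: fcd.
have ints g : test1 a b g -> mu.-integrable `[a, b]%classic (EFin \o (fun x => `|g x|)).
  by move=> tg; apply: integrable_norm; exact: integrableS (test1_integrable tg).
rewrite -(Rintegral_supported (uabs _ (corrected tf)) (A := `[a, b]%classic))//.
apply: (@le_trans _ _ (\int[mu]_(x in `[a, b]) (`|f x| + `|m| * (N / (b - a))))).
  apply: le_Rintegral => //.
  - exact: ints (corrected tf).
  - apply: continuous_integrable => t; apply: cvgD; last exact: cvg_cst.
    by apply: continuous_abs; apply: smooth_continuous; case: tf.
  move=> t _; apply: (le_trans (ler_normB _ _)); rewrite lerD2l normrM.
  by rewrite ler_wpM2l.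
rewrite RintegralD//; last 2 first.
- exact: ints.
- exact: continuous_integrable.
rewrite (Rintegral_supported (uabs _ tf)) // Rintegral_cst// [fine _]len -/I.
have -> : `|m| * (N / (b - a)) * (b - a) = `|m| * N by field; rewrite subr_eq0 gt_eqF.
by have := normr_ge0 m; nra.
Qed.

Lemma transport_sqr N f x : 1 <= N -> (forall x, `|bump a b x| <= N / (b - a)) ->
  test1 a b f -> transport a b f x ^+ 2 <= 4 * N ^+ 2 * (b - a) * \int[mu]_x f x ^+ 2.
Proof.
move=> N1 bN tf; have h := transport_abs x N1 bN tf.
rewrite -real_normK ?num_real//.
apply: (@le_trans _ _ ((2 * N * \int[mu]_x `|f x|) ^+ 2)).
  by rewrite ler_pXn2r// nnegrE//; apply: le_trans h.
rewrite exprMn -[leRHS]mulrA; have -> : (2 * N) ^+ 2 = 4 * N ^+ 2 by ring.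
apply: ler_wpM2l; first by rewrite mulr_ge0 ?sqr_ge0.
exact: sqr_Rintegral_abs.
Qed.

Lemma transport_L2 N f : 1 <= N -> (forall x, `|bump a b x| <= N / (b - a)) ->
  test1 a b f ->
  \int[mu]_x transport a b f x ^+ 2 <= 4 * N ^+ 2 * (b - a) ^+ 2 * \int[mu]_x f x ^+ 2.
Proof.
move=> N1 bN tf; have tt := test1_sqr (test1_transport tf).
rewrite -(Rintegral_supported tt.2 (A := `[a, b]%classic))//.
set K := 4 * N ^+ 2 * (b - a) * \int[mu]_x f x ^+ 2.
apply: (@le_trans _ _ (\int[mu]_(x in `[a, b]) K)).
  apply: le_Rintegral => //.
  - exact: integrableS (test1_integrable tt).
  - exact: continuous_integrable.
  - by move=> x _; exact: transport_sqr.
rewrite Rintegral_cst// [fine _]len /K.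
by rewrite expr2 !mulrA [leLHS]mulrAC.
Qed.

End interval.

End transport.

(** * Fubini and Tonelli for tensors on a box *)

Section box_integrals.
Context {R : realType}.
Local Notation plane := (measurableTypeR R * measurableTypeR R)%type.
Local Notation mu2 := (@lebesgue2 R).
Local Notation mu := (@lebesgue_measure R).
Variables x0 x1 y0 y1 : R.
Local Notation Q := (box x0 x1 y0 y1 : set plane).
Let mQ := measurable_box x0 x1 y0 y1.
Let fQ := box_finite x0 x1 y0 y1.
Let sL := L2_subspace mQ.
Let fI := inner_form mQ.

Lemma EFin_Rintegral_test1 (a b : R) f : test1 a b f ->
  (\int[mu]_x (f x)%:E)%E = (\int[mu]_x f x)%:E.
Proof.
move=> tf; rewrite /Rintegral fineK//.
by apply: integrable_fin_num => //; exact: test1_integrable tf.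
Qed.

Lemma tensor_out a b p : test1 x0 x1 a -> test1 y0 y1 b -> ~ Q p -> tensor a b p = 0.
Proof.
move=> [_ ua] [_ ub] nQ; rewrite /tensor.
have [/andP[h1 h2]|h] := boolP (x0 < p.1 < x1).
  have [h'|h'] := boolP (y0 < p.2 < y1).
    by exfalso; apply: nQ; split => //; rewrite h1.
  by rewrite (supported_out ub) ?mulr0//; move: h'; rewrite negb_and -!leNgt.
by rewrite (supported_out ua) ?mul0r//; move: h; rewrite negb_and -!leNgt.
Qed.

Lemma tensor_span_out f p : tensor_span x0 x1 y0 y1 f -> ~ Q p -> f p = 0.
Proof.
move=> + nQ; elim => [//|a b {}f ta tb _ IH].
have -> : (tensor a b + f) p = tensor a b p + f p by [].
by rewrite IH tensor_out// addr0.
Qed.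

Lemma integral_box_setT (v : R * R -> R) : (forall p, ~ Q p -> v p = 0) ->
  (\int[mu2]_(p in Q) (v p)%:E = \int[mu2]_p (v p)%:E)%E.
Proof.
move=> v0; rewrite integral_mkcond; apply: eq_integral => p _.
by rewrite /patch; case: ifPn => //; rewrite notin_setE => /v0 ->.
Qed.

Lemma tensor_integral a b : test1 x0 x1 a -> test1 y0 y1 b ->
  \int[mu2]_(p in Q) tensor a b p = (\int[mu]_x a x) * (\int[mu]_y b y).
Proof.
move=> ta tb.
have LT : L2 Q (tensor a b) by apply: (tensor_L2 mQ fQ ta tb).
have L1 : L2 Q (cst 1) by apply: (bounded_L2 mQ fQ (M := 1)) => // x _; rewrite normr1.
have iQ : mu2.-integrable Q (EFin \o tensor a b).
  by apply: eq_integrable (L2_integrable mQ LT L1) => // p _; rewrite /= mulr1.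
have iT : mu2.-integrable setT (EFin \o tensor a b).
  have := iQ; rewrite integrable_mkcond//; congr (_.-integrable _ _).
  apply/funext => p; rewrite /patch; case: ifPn => //; rewrite notin_setE => nQ.
  by rewrite /= tensor_out.
have E x : fubini_F mu (EFin \o tensor a b) x = ((\int[mu]_y b y) * a x)%:E.
  rewrite /fubini_F /=; under eq_integral do rewrite /tensor /= EFinM.
  rewrite integralZl//; last exact: test1_integrable tb.
  by rewrite (EFin_Rintegral_test1 tb) -EFinM mulrC.
have I : (\int[mu2]_(p in Q) (tensor a b p)%:E = ((\int[mu]_y b y) * \int[mu]_x a x)%:E)%E.
  rewrite integral_box_setT; last by move=> p; exact: tensor_out.
  apply: etrans (esym (@integral12_prod_meas1 _ _ _ _ R mu mu _ iT)) _.
  apply: etrans; first by apply: eq_integral => x _; exact: E.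
  by rewrite (EFin_Rintegral_test1 (test1Z _ ta)) /= (Rintegral_test1Z _ ta).
by rewrite /Rintegral I /= mulrC.
Qed.

Lemma slice_integral_le (F G : R * R -> R) (C : R) : 0 <= C ->
  measurable_fun setT (F : plane -> R) -> measurable_fun setT (G : plane -> R) ->
  (forall p, 0 <= F p) -> (forall p, 0 <= G p) ->
  (forall y, (\int[mu]_x (F (x, y))%:E <= C%:E * \int[mu]_x (G (x, y))%:E)%E) ->
  (\int[mu2]_p (F p)%:E <= C%:E * \int[mu2]_p (G p)%:E)%E.
Proof.
move=> C0 mF mG F0 G0 FG.
have TF H : measurable_fun setT (H : plane -> R) -> (forall p, 0 <= H p) ->
    (\int[mu2]_p (H p)%:E = \int[mu]_y \int[mu]_x (H (x, y))%:E)%E /\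
    measurable_fun setT (fun y : measurableTypeR R => \int[mu]_x (H (x, y))%:E)%E.
  move=> mH H0; have mEH : measurable_fun setT (EFin \o H : plane -> \bar R) by exact/measurable_EFinP.
  have H0' p : (0 <= (EFin \o H : plane -> \bar R) p)%E by rewrite lee_fin.
  split; first exact: (@fubini_tonelli2 _ _ _ _ R mu mu _ mEH H0').
  exact: (@measurable_fun_fubini_tonelli_G _ _ _ _ R mu _ mEH H0').
have [-> mF'] := TF _ mF F0; have [-> mG'] := TF _ mG G0.
have Gs y : (0 <= \int[mu]_x (G (x, y))%:E)%E by apply: integral_ge0 => x _; rewrite lee_fin.
rewrite -ge0_integralZl_EFin//.
apply: ge0_le_integral => //.
- by move=> y _; apply: integral_ge0 => x _; rewrite lee_fin.
- by apply: emeasurable_funM => //; exact: measurable_cst.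
Qed.

End box_integrals.

(** * Marginals and transport slice by slice *)

Section slices.
Context {R : realType}.
Local Notation plane := (measurableTypeR R * measurableTypeR R)%type.
Local Notation mu2 := (@lebesgue2 R).
Local Notation mu := (@lebesgue_measure R).
Variables x0 x1 y0 y1 : R.
Hypotheses (x01 : x0 < x1) (y01 : y0 < y1).
Local Notation Q := (box x0 x1 y0 y1 : set plane).
Local Notation span := (tensor_span x0 x1 y0 y1).
Let mQ := measurable_box x0 x1 y0 y1.
Let fQ := box_finite x0 x1 y0 y1.

Definition marginal (f : R * R -> R) y := \int[mu]_x f (x, y).

(** Its derivative in the first variable is [f] minus the product of [bump x0 x1] and
    [marginal f]. *)
Definition transport1 (f : R * R -> R) : R * R -> R :=
  fun p => transport x0 x1 (fun x => f (x, p.2)) p.1.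

Lemma slice_test1 f y : span f -> test1 x0 x1 (fun x => f (x, y)).
Proof.
elim => [|a b {}f ta tb _ IH].
  have := test1Z 0 (test1_bump x01); congr test1; apply/funext => x.
  by rewrite mul0r.
have -> : (fun x => (tensor a b + f) (x, y)) = (fun x => b y * a x + f (x, y)).
  by apply/funext => x; have -> : (tensor a b + f) (x, y) = a x * b y + f (x, y) by []; rewrite mulrC.
by apply: test1D => //; exact: test1Z.
Qed.

Lemma marginal_add a b f : test1 x0 x1 a -> span f ->
  marginal (tensor a b + f) = (fun y => (\int[mu]_x a x) * b y + marginal f y).
Proof.
move=> ta sf; apply/funext => y; rewrite /marginal.
have -> : (fun x => (tensor a b + f) (x, y)) = (fun x => b y * a x + f (x, y)).
  by apply/funext => x; have -> : (tensor a b + f) (x, y) = a x * b y + f (x, y) by []; rewrite mulrC.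
by rewrite (Rintegral_test1D (test1Z _ ta) (slice_test1 y sf)) (Rintegral_test1Z _ ta) mulrC.
Qed.

Lemma marginal0 : marginal 0 = (fun=> 0).
Proof. by apply/funext => y; rewrite /marginal Rintegral_cst// mul0r. Qed.

Lemma test1_marginal f : span f -> test1 y0 y1 (marginal f).
Proof.
elim => [|a b {}f ta tb sf IH].
  have := test1Z 0 (test1_bump y01); congr test1; apply/funext => x.
  by rewrite marginal0 mul0r.
by rewrite marginal_add//; apply: test1D => //; exact: test1Z.
Qed.

Lemma transport1_add a b f : test1 x0 x1 a -> span f ->
  transport1 (tensor a b + f) = tensor (transport x0 x1 a) b + transport1 f.
Proof.
move=> ta sf; apply/funext => p.
have -> : (tensor (transport x0 x1 a) b + transport1 f) p =
  transport x0 x1 a p.1 * b p.2 + transport1 f p by [].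
rewrite /transport1.
have -> : (fun x => (tensor a b + f) (x, p.2)) = (fun x => b p.2 * a x + f (x, p.2)).
  by apply/funext => x; have -> : (tensor a b + f) (x, p.2) = a x * b p.2 + f (x, p.2) by []; rewrite mulrC.
by rewrite (transport_linear x01 _ _ ta (slice_test1 p.2 sf)) mulrC.
Qed.

Lemma transport1_0 : transport1 0 = 0.
Proof.
apply/funext => p; rewrite /transport1.
have tb := test1Z 0 (test1_bump x01).
have -> : (fun x => (0 : R * R -> R) (x, p.2)) = (fun x => 0 * bump x0 x1 x + 0 * bump x0 x1 x).
  by apply/funext => x; rewrite !mul0r addr0.
rewrite (transport_linear x01 _ _ (test1_bump x01) tb) mul0r add0r.
have -> : (fun x => 0 * bump x0 x1 x) = (fun x => 0 * bump x0 x1 x + 0 * bump x0 x1 x).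
  by apply/funext => x; rewrite !mul0r addr0.
rewrite (transport_linear x01 _ _ (test1_bump x01) tb) mul0r add0r.
have z : (\int[mu]_t (0 * bump x0 x1 t)) = 0 by rewrite (Rintegral_test1Z _ (test1_bump x01)) mul0r.
rewrite /transport z /primitive; under eq_Rintegral do rewrite !mul0r subr0.
by rewrite Rintegral_cst// mul0r.
Qed.

Lemma span_transport1 f : span f -> span (transport1 f).
Proof.
elim => [|a b {}f ta tb sf IH]; first by rewrite transport1_0; exact: tensor_span0.
by rewrite transport1_add//; apply: tensor_span_add => //; exact: test1_transport.
Qed.

Lemma span_measurable f : span f -> measurable_fun setT (f : plane -> R).
Proof.
elim => [|a b {}f ta tb sf IH]; first exact: measurable_cst.
by apply: measurable_funD => //; apply: measurable_tensor; apply: smooth_continuous; [case: ta|case: tb].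
Qed.

Lemma span_L2 f : span f -> L2 Q f.
Proof. exact: tensor_span_L2. Qed.

Lemma integral_span f : span f -> inner Q (cst 1) f = \int[mu]_y marginal f y.
Proof.
have L1 : L2 Q (cst 1) by apply: (bounded_L2 mQ fQ (M := 1)) => // x _; rewrite normr1.
have lin := form_linr (L2_subspace mQ) (inner_form mQ) L1.
elim => [|a b {}f ta tb sf IH].
  by rewrite marginal0 Rintegral_cst// mul0r (linear_on0 (L2_subspace mQ) lin).
have Lt : L2 Q (tensor a b) by apply: (tensor_L2 mQ fQ ta tb).
rewrite (linear_onD lin Lt (span_L2 sf)) IH marginal_add//.
rewrite (Rintegral_test1D (test1Z _ tb) (test1_marginal sf)) (Rintegral_test1Z _ tb).
congr (_ + _); rewrite -(tensor_integral ta tb).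
by apply: eq_Rintegral => p _; rewrite /= mul1r.
Qed.

Lemma inner_span_setT f : span f ->
  (\int[mu2]_p (f p ^+ 2)%:E)%E = (inner Q f f)%:E.
Proof.
move=> sf; rewrite -(inner_EFin mQ (span_L2 sf)).
rewrite (integral_box_setT (v := fun p => f p ^+ 2))// => p nQ.
by rewrite (tensor_span_out sf nQ) expr0n.
Qed.

Variable N : R.
Hypotheses (N1 : 1 <= N) (bN : forall a b x : R, a < b -> `|bump a b x| <= N / (b - a)).

Let slice_sqr f y : span f ->
  (\int[mu]_x ((f (x, y)) ^+ 2)%:E)%E = (\int[mu]_x (f (x, y) ^+ 2))%:E.
Proof. by move=> sf; exact: EFin_Rintegral_test1 (test1_sqr (slice_test1 y sf)). Qed.

Lemma transport1_le f : span f ->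
  inner Q (transport1 f) (transport1 f) <= 4 * N ^+ 2 * (x1 - x0) ^+ 2 * inner Q f f.
Proof.
move=> sf; have st := span_transport1 sf.
rewrite -lee_fin EFinM -(inner_span_setT st) -(inner_span_setT sf).
apply: slice_integral_le.
- by apply: mulr_ge0; [apply: mulr_ge0 => //; exact: sqr_ge0|exact: sqr_ge0].
- by apply: measurable_funX; exact: span_measurable st.
- by apply: measurable_funX; exact: span_measurable sf.
- by move=> p; exact: sqr_ge0.
- by move=> p; exact: sqr_ge0.
move=> y; rewrite !slice_sqr// -EFinM lee_fin.
exact: (transport_L2 x01 N1 (fun x => bN x x01) (slice_test1 y sf)).
Qed.

(** Cauchy-Schwarz in each horizontal slice, then integration over the slices by Tonelli. *)
Lemma marginal_le f : span f ->
  \int[mu]_y marginal f y ^+ 2 <= (x1 - x0) * inner Q f f.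
Proof.
move=> sf; have tm := test1_marginal sf.
have L0 : 0 < x1 - x0 by rewrite subr_gt0.
have mf2 := measurable_funX 2 (span_measurable sf).
have E : (\int[mu2]_p (f p ^+ 2)%:E = \int[mu]_y \int[mu]_x (f (x, y) ^+ 2)%:E)%E /\
    measurable_fun setT (fun y : measurableTypeR R => \int[mu]_x (f (x, y) ^+ 2)%:E)%E.
  pose g2 : plane -> \bar R := fun p => (f p ^+ 2)%:E.
  have mEH : measurable_fun setT g2 by exact/measurable_EFinP.
  have H0' p : (0 <= g2 p)%E by rewrite lee_fin sqr_ge0.
  split; first exact: (@fubini_tonelli2 _ _ _ _ R mu mu _ mEH H0').
  exact: (@measurable_fun_fubini_tonelli_G _ _ _ _ R mu _ mEH H0').
rewrite -lee_fin EFinM -(inner_span_setT sf) E.1 -(EFin_Rintegral_test1 (test1_sqr tm)).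
rewrite -ge0_integralZl_EFin ?(ltW L0)//; last 2 first.
- by move=> y _; apply: integral_ge0 => x _; rewrite lee_fin sqr_ge0.
- exact: E.2.
apply: ge0_le_integral => //.
- by move=> y _; rewrite lee_fin sqr_ge0.
- apply/measurable_EFinP; apply: measurable_funX; apply: continuous_measurable_fun.
  by apply: smooth_continuous; case: tm.
- by apply: emeasurable_funM; [exact: measurable_cst|exact: E.2].
move=> y _; rewrite slice_sqr// -EFinM lee_fin.
have ts := slice_test1 y sf.
apply: le_trans (sqr_Rintegral_abs x01 ts).
have h : `|marginal f y| <= \int[mu]_x `|f (x, y)|.
  by apply: le_normr_Rintegral => //; exact: test1_integrable ts.
rewrite -(real_normK (num_real (marginal f y))); apply: lerXn2r; last exact: h.
  exact: normr_ge0.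
by rewrite nnegrE; apply: le_trans h.
Qed.

End slices.

(** * The Poincare inequality on a box, by duality *)

Section box_poincare.
Context {R : realType}.
Local Notation plane := (measurableTypeR R * measurableTypeR R)%type.
Local Notation mu2 := (@lebesgue2 R).
Local Notation mu := (@lebesgue_measure R).
Implicit Types (u f : R * R -> R) (Om : set plane).

Lemma inner_restrict Om (D : set plane) u f : D `<=` Om ->
  (forall p, ~ D p -> f p = 0) -> inner Om u f = inner D u f.
Proof.
move=> DO f0; rewrite /inner Rintegral_mkcond [RHS]Rintegral_mkcond.
congr (Rintegral _ _ _); apply/funext => p; rewrite /patch.
have [Dp|nD] := pselect (D p).
  by rewrite !mem_set//; exact: DO.
by rewrite (memNset nD) f0// mulr0; case: ifP.
Qed.

Section weak.
Variables (Om : set plane) (u g1 g2 : R * R -> R) (x0 x1 y0 y1 : R).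
Hypotheses (mOm : measurable Om) (Hu : H1 Om u g1 g2).
Local Notation Q := (box x0 x1 y0 y1 : set plane).
Hypothesis QOm : Q `<=` Om.

Lemma box_weak1 (a a' b : R -> R) : test1 x0 x1 a -> test1 y0 y1 b ->
  (forall x : R, is_derive x 1 a (a' x)) ->
  test1 x0 x1 a' ->
  inner Q u (tensor a' b) = - inner Q g1 (tensor a b).
Proof.
move=> ta tb da ta'; have [_ _ _ w1 _] := Hu.
have := w1 _ (test_tensor QOm ta tb).
rewrite -/(inner Om g1 (tensor a b)).
have -> : \int[mu2]_(x in Om) (u x * 'D_e1 (tensor a b) x) = inner Om u (tensor a' b).
  by apply: eq_Rintegral => p _; have /(congr1 (@^~ p)) /= -> := derive_tensor_e1 b da.
rewrite !(inner_restrict _ QOm)// => p; exact: tensor_out.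
Qed.

Lemma box_weak2 (a b b' : R -> R) : test1 x0 x1 a -> test1 y0 y1 b ->
  (forall x : R, is_derive x 1 b (b' x)) ->
  test1 y0 y1 b' ->
  inner Q u (tensor a b') = - inner Q g2 (tensor a b).
Proof.
move=> ta tb db tb'; have [_ _ _ _ w2] := Hu.
have := w2 _ (test_tensor QOm ta tb).
rewrite -/(inner Om g2 (tensor a b)).
have -> : \int[mu2]_(x in Om) (u x * 'D_e2 (tensor a b) x) = inner Om u (tensor a b').
  by apply: eq_Rintegral => p _; have /(congr1 (@^~ p)) /= -> := derive_tensor_e2 a db.
rewrite !(inner_restrict _ QOm)// => p; exact: tensor_out.
Qed.

Let mQ := measurable_box x0 x1 y0 y1.
Let fQ := box_finite x0 x1 y0 y1.
Let sL := L2_subspace mQ.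
Let fI := inner_form mQ.
Let Lu : L2 Q u. Proof. by case: Hu => + _ _ _ _; exact: L2_subset. Qed.
Let Lg1 : L2 Q g1. Proof. by case: Hu => _ + _ _ _; exact: L2_subset. Qed.
Let Lg2 : L2 Q g2. Proof. by case: Hu => _ _ + _ _; exact: L2_subset. Qed.
Hypotheses (x01 : x0 < x1) (y01 : y0 < y1).
Local Notation bx := (bump x0 x1).
Local Notation bY := (bump y0 y1).

Definition bump_moment := inner Q u (tensor bx bY).

Let tensorL2 (a b : R -> R) : test1 x0 x1 a -> test1 y0 y1 b -> L2 Q (tensor a b).
Proof. exact: tensor_L2. Qed.

Let linu := form_linr sL fI Lu.

(** Testing the weak derivative along [e1] with [transport1 x0 x1 f] trades [f] for a function
    concentrated on the bump in [x], at the price of one pairing with [g1]. *)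
Let move_x (f : R * R -> R) : tensor_span x0 x1 y0 y1 f ->
  inner Q u f = inner Q u (tensor bx (marginal f)) - inner Q g1 (transport1 x0 x1 f).
Proof.
have tbx := test1_bump x01.
have lin1 := form_linr sL fI Lg1.
elim => [|a b {}f ta tb sf IH].
  rewrite (transport1_0 x01) marginal0 (linear_on0 sL linu) (linear_on0 sL lin1) subr0.
  have -> : tensor bx (fun=> 0) = 0 by apply/funext => p; rewrite /tensor mulr0.
  by rewrite (linear_on0 sL linu).
have tT := test1_transport x01 ta.
have tm := test1_marginal x01 y01 sf.
have st := span_transport1 x01 sf.
rewrite (linear_onD linu (tensorL2 ta tb) (span_L2 sf)) IH.
rewrite (transport1_add x01 b ta sf).
rewrite (linear_onD lin1 (tensorL2 tT tb) (span_L2 st)).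
have -> : tensor bx (marginal (tensor a b + f)) =
    (\int[mu]_x a x) *: tensor bx b + tensor bx (marginal f).
  rewrite (marginal_add x01 b ta sf); apply/funext => p.
  have -> : ((\int[mu]_x a x) *: tensor bx b + tensor bx (marginal f)) p =
    (\int[mu]_x a x) * (bx p.1 * b p.2) + bx p.1 * marginal f p.2 by [].
  by rewrite /tensor; ring.
rewrite (linu _ (tensorL2 tbx tb) (tensorL2 tbx tm)).
have dT x := transport_derive x01 x ta.
have tc : test1 x0 x1 (fun x => a x - (\int[mu]_t a t) * bx x).
  by apply: test1B => //; exact: test1Z.
have := box_weak1 tT tb dT tc.
have -> : tensor (fun x => a x - (\int[mu]_t a t) * bx x) b =
    tensor a b - (\int[mu]_t a t) *: tensor bx b.
  apply/funext => p; have -> : (tensor a b - (\int[mu]_t a t) *: tensor bx b) p =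
    a p.1 * b p.2 - (\int[mu]_t a t) * (bx p.1 * b p.2) by [].
  by rewrite /tensor; ring.
rewrite (linear_onB sL linu (tensorL2 ta tb) (subspaceZ _ sL (tensorL2 tbx tb))).
rewrite (linear_onZ sL linu _ (tensorL2 tbx tb)); lra.
Qed.

(** The same trade in [y] finishes the concentration: what remains of [h] is its integral times the
    moment. *)
Let move_y (h : R -> R) : test1 y0 y1 h ->
  inner Q u (tensor bx h) = (\int[mu]_y h y) * bump_moment - inner Q g2 (tensor bx (transport y0 y1 h)).
Proof.
move=> th; have tbx := test1_bump x01; have tby := test1_bump y01.
have dT y := transport_derive y01 y th.
have tc : test1 y0 y1 (fun y => h y - (\int[mu]_t h t) * bY y).
  by apply: test1B => //; exact: test1Z.
have := box_weak2 tbx (test1_transport y01 th) dT tc.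
have -> : tensor bx (fun y => h y - (\int[mu]_t h t) * bY y) =
    tensor bx h - (\int[mu]_t h t) *: tensor bx bY.
  apply/funext => p; have -> : (tensor bx h - (\int[mu]_t h t) *: tensor bx bY) p =
    bx p.1 * h p.2 - (\int[mu]_t h t) * (bx p.1 * bY p.2) by [].
  by rewrite /tensor; ring.
rewrite (linear_onB sL linu (tensorL2 tbx th) (subspaceZ _ sL (tensorL2 tbx tby))).
rewrite (linear_onZ sL linu _ (tensorL2 tbx tby)) /bump_moment; lra.
Qed.

Variable N : R.
Hypotheses (N1 : 1 <= N) (bN : forall a b x : R, a < b -> `|bump a b x| <= N / (b - a)).
Hypotheses (x11 : x1 - x0 <= 1) (y11 : y1 - y0 <= 1).

Let L1 : L2 Q (cst 1 : R * R -> R).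
Proof. by apply: (bounded_L2 mQ fQ (M := 1)) => // x _; rewrite normr1. Qed.

Lemma bump_sqr_integral : \int[mu]_x bx x ^+ 2 <= N ^+ 2 / (x1 - x0).
Proof.
have L0 : 0 < x1 - x0 by rewrite subr_gt0.
have tt := test1_sqr (test1_bump x01).
rewrite -(Rintegral_supported tt.2 (A := `[x0, x1]%classic))//.
apply: (@le_trans _ _ (\int[mu]_(x in `[x0, x1]) (N / (x1 - x0)) ^+ 2)).
  apply: le_Rintegral => //.
  - exact: integrableS (test1_integrable tt).
  - apply: continuous_compact_integrable; [exact: segment_compact|apply: continuous_subspaceT => t; exact: cvg_cst].
  - move=> x _; rewrite -(real_normK (num_real (bx x))); apply: lerXn2r => //.
      by rewrite nnegrE; apply: le_trans (bN x x01).
    exact: bN.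
rewrite Rintegral_cst//.
have -> : fine (mu `[x0, x1]%classic) = x1 - x0 by rewrite lebesgue_measure_itv /= lte_fin x01.
by rewrite le_eqVlt; apply/orP; left; apply/eqP; field; rewrite gt_eqF.
Qed.

(** The factor 1 / (x1 - x0) in the squared norm of the bump is cancelled by the factor x1 - x0 in
    [marginal_le]. Only (y1 - y0)^2 <= 1 remains, so the constant does not blow up on thin boxes. *)
Let transport2_le f : tensor_span x0 x1 y0 y1 f ->
  inner Q (tensor bx (transport y0 y1 (marginal f)))
    (tensor bx (transport y0 y1 (marginal f))) <= 4 * N ^+ 4 * inner Q f f.
Proof.
move=> sf; set X := tensor bx _; have tm := test1_marginal x01 y01 sf.
have tT := test1_transport y01 tm; have tbx := test1_bump x01.
have L0 : 0 < x1 - x0 by rewrite subr_gt0.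
have -> : inner Q X X = (\int[mu]_x bx x ^+ 2) * (\int[mu]_y transport y0 y1 (marginal f) y ^+ 2).
  rewrite -(tensor_integral (test1_sqr tbx) (test1_sqr tT)).
  by apply: eq_Rintegral => p _; rewrite /X /tensor; ring.
have F0 := form_ge0 fI (span_L2 sf).
have h1 := transport_L2 y01 N1 (fun y => bN y y01) tm.
have h2 := marginal_le x01 y01 sf.
have h3 := bump_sqr_integral.
have I0 : 0 <= \int[mu]_x bx x ^+ 2 by apply: Rintegral_ge0 => x _; exact: sqr_ge0.
have J0 : 0 <= \int[mu]_y transport y0 y1 (marginal f) y ^+ 2 by apply: Rintegral_ge0 => x _; exact: sqr_ge0.
have h4 : \int[mu]_y transport y0 y1 (marginal f) y ^+ 2 <= 4 * N ^+ 2 * ((x1 - x0) * inner Q f f).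
  apply: (le_trans h1).
  apply: (@le_trans _ _ (4 * N ^+ 2 * \int[mu]_y marginal f y ^+ 2)).
    apply: ler_wpM2r; first by apply: Rintegral_ge0 => x _; exact: sqr_ge0.
    apply: ler_piMr; first by apply: mulr_ge0 => //; exact: sqr_ge0.
    by apply: exprn_ile1; rewrite ?subr_ge0 ?(ltW x01) ?(ltW y01).
  by rewrite ler_wpM2l// mulr_ge0// sqr_ge0.
apply: (le_trans (ler_pM I0 J0 h3 h4)).
rewrite le_eqVlt; apply/orP; left; apply/eqP.
by field; rewrite gt_eqF.
Qed.

Lemma box_poincare :
  inner Q (u - cst bump_moment) (u - cst bump_moment) <=
  8 * N ^+ 4 * (inner Q g1 g1 + inner Q g2 g2).
Proof.
have G1 := form_ge0 fI Lg1; have G2 := form_ge0 fI Lg2.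
have Lc : L2 Q (cst bump_moment : R * R -> R).
  have -> : (cst bump_moment : R * R -> R) = bump_moment *: (cst 1 : R * R -> R).
    by apply/funext => p; have -> : (bump_moment *: (cst 1 : R * R -> R)) p = bump_moment * 1 by []; rewrite mulr1.
  exact: subspaceZ.
have Lw := subspaceB sL Lu Lc.
have K0 : 0 <= 8 * N ^+ 4 * (inner Q g1 g1 + inner Q g2 g2).
  by rewrite mulr_ge0 ?addr_ge0// mulr_ge0// exprn_ge0// (le_trans ler01).
apply: (dense_norm_bound mQ (@tensor_span_L2 _ _ _ _ _ _ mQ fQ) (approximable_box Lw)) => // f sf.
have Lf := span_L2 sf; have F0 := form_ge0 fI Lf.
have tm := test1_marginal x01 y01 sf.
(* The two moves leave the moment times the integral of [f], which is exactly what subtracting the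
   constant removes. *)
have -> : inner Q (u - cst bump_moment) f = - (inner Q g1 (transport1 x0 x1 f) +
    inner Q g2 (tensor bx (transport y0 y1 (marginal f)))).
  rewrite (linear_onB sL (form_linl fI Lf) Lu Lc) (move_x sf) (move_y tm).
  have -> : inner Q (cst bump_moment) f = bump_moment * inner Q (cst 1) f.
    have -> : (cst bump_moment : R * R -> R) = bump_moment *: (cst 1 : R * R -> R).
      by apply/funext => p; have -> : (bump_moment *: (cst 1 : R * R -> R)) p = bump_moment * 1 by []; rewrite mulr1.
    by rewrite (linear_onZ sL (form_linl fI Lf) _ L1).
  by rewrite (integral_span x01 y01 sf); ring.
have h1 := form_cauchy_schwarz sL fI Lg1 (span_L2 (span_transport1 x01 sf)).
have h2 := form_cauchy_schwarz sL fI Lg2 (tensorL2 (test1_bump x01) (test1_transport y01 tm)).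
have h3 : inner Q (transport1 x0 x1 f) (transport1 x0 x1 f) <= 4 * N ^+ 4 * inner Q f f.
  apply: (le_trans (transport1_le x01 N1 bN sf)).
  rewrite ler_wpM2r//.
  apply: (@le_trans _ _ (4 * N ^+ 2)).
    apply: ler_piMr; first by apply: mulr_ge0 => //; exact: sqr_ge0.
    by apply: exprn_ile1; rewrite ?subr_ge0 ?(ltW x01) ?(ltW y01).
  rewrite ler_wpM2l//.
  by apply: ler_weXn2l.
have h4 := transport2_le sf.
move: h1 h2; set s := inner Q g1 _; set t := inner Q g2 (tensor _ _) => h1 h2.
have h5 := ler_wpM2l G1 h3; have h6 := ler_wpM2l G2 h4.
have h7 : (s + t) ^+ 2 <= 2 * s ^+ 2 + 2 * t ^+ 2 by have := sqr_ge0 (s - t); rewrite sqrrB sqrrD; lra.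
by rewrite sqrrN; apply: (le_trans h7); rewrite -/s -/t in h1 h2 *; lra.
Qed.

Lemma box_norm_le : inner Q u u <= 2 * ((x1 - x0) * (y1 - y0)) * bump_moment ^+ 2 +
  16 * N ^+ 4 * (inner Q g1 g1 + inner Q g2 g2).
Proof.
have Lc : L2 Q (cst bump_moment : R * R -> R).
  by apply: (bounded_L2 mQ fQ (M := `|bump_moment|)).
have := form_sqrD_le sL fI (subspaceB sL Lu Lc) Lc; rewrite subrK.
have -> : inner Q (cst bump_moment) (cst bump_moment) = bump_moment ^+ 2 * ((x1 - x0) * (y1 - y0)).
  have -> : inner Q (cst bump_moment) (cst bump_moment) =
    \int[mu2]_(p in Q) (bump_moment ^+ 2) by rewrite expr2.
  rewrite Rintegral_cst//; congr (_ * _).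
  by rewrite -[RHS]/(fine ((x1 - x0) * (y1 - y0))%:E) -(box_area (ltW x01) (ltW y01)).
have := box_poincare; lra.
Qed.

End weak.

End box_poincare.

(** * Comparing the averages of consecutive tail cells *)

Section chain.
Context {R : realType}.
Local Notation plane := (measurableTypeR R * measurableTypeR R)%type.
Local Notation mu2 := (@lebesgue2 R).
Implicit Types (u f : R * R -> R) (Om : set plane).

(** Far to the left both steps are 0 and far to the right both are 1, so the difference is a test
    function although neither step is. *)
Lemma test1_step_diff (lo hi a b a' b' : R) : a < b -> a' < b' ->
  lo <= a -> lo <= a' -> b <= hi -> b' <= hi ->
  test1 lo hi (fun x => step_on a b x - step_on a' b' x).
Proof.
move=> ab ab' la la' bh bh'; split.
  by apply: smoothB; exact: smooth_step_on.
exists (Num.min (a + (b - a) / 4) (a' + (b' - a') / 4)),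
  (Num.max (b - (b - a) / 4) (b' - (b' - a') / 4)); split.
- by rewrite lt_min; apply/andP; split; lra.
- by rewrite gt_max; apply/andP; split; lra.
move=> x; apply: contra_neqT; rewrite negb_and -!ltNge lt_min gt_max.
case/orP=> /andP[h1 h2].
  by rewrite !step_on0 ?subrr// ltW.
by rewrite !step_on1 ?subrr// ltW.
Qed.

Lemma step_diff_le1 (a b a' b' x : R) : `|step_on a b x - step_on a' b' x| <= 1.
Proof.
have := step_on_ge0 a b x; have := step_on_le1 a b x.
have := step_on_ge0 a' b' x; have := step_on_le1 a' b' x.
by rewrite ler_norml => *; apply/andP; split; lra.
Qed.

Lemma tensorBl (a a' b : R -> R) :
  tensor (fun t => a t - a' t) b = tensor a b - tensor a' b.
Proof. by apply/funext => p; apply: mulrBl. Qed.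

Lemma tensorBr (a b b' : R -> R) :
  tensor a (fun t => b t - b' t) = tensor a b - tensor a b'.
Proof. by apply/funext => p; apply: mulrBr. Qed.

Lemma inner_box_bound (x0 x1 y0 y1 M : R) u : x0 <= x1 -> y0 <= y1 ->
  L2 (box x0 x1 y0 y1) u -> (forall p, `|u p| <= M) ->
  inner (box x0 x1 y0 y1) u u <= M ^+ 2 * ((x1 - x0) * (y1 - y0)).
Proof.
move=> xx yy Lu uM; have mQ := measurable_box x0 x1 y0 y1.
have fQ := box_finite x0 x1 y0 y1.
have M0 : 0 <= M by apply: le_trans (uM (0, 0)).
apply: (@le_trans _ _ (\int[mu2]_(p in (box x0 x1 y0 y1 : set plane)) (M ^+ 2))).
  apply: le_Rintegral => //.
  - exact: (L2_integrable mQ Lu Lu).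
  - apply: measurable_bounded_integrable => //.
    exists (M ^+ 2); split; first exact: num_real.
    by move=> t Mt p _ /=; rewrite ger0_norm ?sqr_ge0// ltW.
  move=> p _; rewrite -expr2 -(real_normK (num_real (u p))); apply: lerXn2r; last exact: uM.
    exact: normr_ge0.
  by [].
rewrite Rintegral_cst//.
by rewrite -[X in _ <= _ * X]/(fine ((x1 - x0) * (y1 - y0))%:E) -(box_area xx yy).
Qed.

Lemma subset_box (x0 x1 y0 y1 a0 a1 b0 b1 : R) :
  a0 <= x0 -> x1 <= a1 -> b0 <= y0 -> y1 <= b1 ->
  box x0 x1 y0 y1 `<=` box a0 a1 b0 b1.
Proof.
move=> h1 h2 h3 h4 p [/andP[h5 h6] /andP[h7 h8]].
by split; apply/andP; split; lra.
Qed.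

(** The product bump of the tall cell is carried to that of the next cell in two moves: inside the
    tall cell its vertical profile is squeezed from height [h] to [h'], then it slides sideways in
    the box of height [h'] that spans both cells. *)
Lemma chain_step Om u (g1 g2 : R * R -> R) (x h h' N : R) :
  1 <= N -> (forall a b x : R, a < b -> `|bump a b x| <= N / (b - a)) ->
  measurable Om -> H1 Om u g1 g2 -> 0 < h' -> h' <= h -> h <= 1 ->
  box x (x + 1) 0 h `<=` Om -> box x (x + 2) 0 h' `<=` Om ->
  h' * (bump_moment u (x + 1) (x + 2) 0 h' - bump_moment u x (x + 1) 0 h) ^+ 2 <=
  4 * N ^+ 2 * (inner (box x (x + 2) 0 h') g1 g1 + inner (box x (x + 1) 0 h) g2 g2).
Proof.
move=> N1 bN mOm Hu h'0 hh h1 TO BO.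
set T := box x (x + 1) 0 h; set B := box x (x + 2) 0 h'.
have [Lu Lg1 Lg2 _ _] := Hu.
have mT : measurable (T : set plane) := measurable_box _ _ _ _.
have mB : measurable (B : set plane) := measurable_box _ _ _ _.
have fT : (mu2 T < +oo)%E := box_finite _ _ _ _.
have fB : (mu2 B < +oo)%E := box_finite _ _ _ _.
have h0 : 0 < h by lra.
have x1 : x < x + 1 by lra.
have x2 : x + 1 < x + 2 by lra.
have sub3 : box (x + 1) (x + 2) 0 h' `<=` B by apply: subset_box; lra.
have sub4 : box x (x + 1) 0 h' `<=` B by apply: subset_box; lra.
have sub5 : box x (x + 1) 0 h' `<=` T by apply: subset_box; lra.
pose bx := bump x (x + 1); pose bx' := bump (x + 1) (x + 2).
pose th := bump 0 h; pose th' := bump 0 h'.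
have tbx : test1 x (x + 1) bx := test1_bump x1.
have tbx' : test1 (x + 1) (x + 2) bx' := test1_bump x2.
have tth : test1 0 h th := test1_bump h0.
have tth' : test1 0 h' th' := test1_bump h'0.
have tbxB : test1 x (x + 2) bx by apply: test1W tbx; lra.
have tbx'B : test1 x (x + 2) bx' by apply: test1W tbx'; lra.
have tth'T : test1 0 h th' by apply: test1W tth'; lra.
pose A t := step_on (x + 1) (x + 2) t - step_on x (x + 1) t.
pose E t := step_on 0 h' t - step_on 0 h t.
have tA : test1 x (x + 2) A by apply: test1_step_diff; lra.
have tE : test1 0 h E by apply: test1_step_diff; lra.
have dA (t : R) : is_derive t 1 A (bx' t - bx t).
  by apply: is_deriveB; exact: step_on_derive.
have dE (t : R) : is_derive t 1 E (th' t - th t).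
  by apply: is_deriveB; exact: step_on_derive.
(* The field of the sideways move has squared norm at most 2 N^2 / h', which the weight [h'] in the
   conclusion compensates. *)
have n1 : inner B (tensor A th') (tensor A th') <= (N / h') ^+ 2 * (2 * h').
  have -> : 2 * h' = (x + 2 - x) * (h' - 0) by ring.
  apply: inner_box_bound; [lra|lra|exact: (tensor_L2 mB fB tA tth')|].
  move=> p; rewrite normrM -[N / h']mul1r; apply: ler_pM => //; first exact: step_diff_le1.
  by have := bN 0 h' p.2 h'0; rewrite subr0.
have n2 : inner T (tensor bx E) (tensor bx E) <= N ^+ 2 * h.
  have -> : h = (x + 1 - x) * (h - 0) by ring.
  apply: inner_box_bound; [lra|lra|exact: (tensor_L2 mT fT tbx tE)|].
  move=> p; rewrite normrM -[N]mulr1; apply: ler_pM => //; last exact: step_diff_le1.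
  have := bN x (x + 1) p.1 x1; rewrite (_ : x + 1 - x = 1); last by rewrite addrAC subrr add0r.
  by rewrite divr1.
have e3 : inner B u (tensor bx' th') = bump_moment u (x + 1) (x + 2) 0 h'.
  by apply: inner_restrict => // p; exact: tensor_out.
have e5 : bump_moment u x (x + 1) 0 h = inner T u (tensor bx th).
  exact: erefl.
have e4 : inner B u (tensor bx th') = inner T u (tensor bx th').
  have o p : ~ box x (x + 1) 0 h' p -> tensor bx th' p = 0 by exact: tensor_out.
  exact: etrans (inner_restrict u sub4 o) (esym (inner_restrict u sub5 o)).
have w1 := box_weak1 Hu BO tA tth' dA (test1B tbx'B tbxB).
have w2 := box_weak2 Hu TO tbx tE dE (test1B tth'T tth).
have LB a b : test1 x (x + 2) a -> test1 0 h' b -> L2 B (tensor a b) := tensor_L2 mB fB.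
have LT a b : test1 x (x + 1) a -> test1 0 h b -> L2 T (tensor a b) := tensor_L2 mT fT.
have LuB := L2_subset mOm mB BO Lu; have LuT := L2_subset mOm mT TO Lu.
have Lg1B := L2_subset mOm mB BO Lg1; have Lg2T := L2_subset mOm mT TO Lg2.
rewrite e5 -e3.
move: w1 w2; rewrite -/B -/T tensorBl tensorBr.
move: e4 n1 n2.
clear e3 e5 dA dE mOm Hu bN TO BO Lu Lg1 Lg2 fT fB.
clearbody A E bx bx' th th' B T.
have fB := inner_form mB; have fT := inner_form mT.
have linB := form_linr (L2_subspace mB) fB LuB.
have linT := form_linr (L2_subspace mT) fT LuT.
rewrite (linear_onB (L2_subspace mB) linB (LB _ _ tbx'B tth') (LB _ _ tbxB tth')).
rewrite (linear_onB (L2_subspace mT) linT (LT _ _ tbx tth'T) (LT _ _ tbx tth)).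
have c1 := form_cauchy_schwarz (L2_subspace mB) fB Lg1B (LB _ _ tA tth').
have c2 := form_cauchy_schwarz (L2_subspace mT) fT Lg2T (LT _ _ tbx tE).
have G1 := form_ge0 fB Lg1B; have G2 := form_ge0 fT Lg2T.
move: c1 c2 G1 G2.
move: (inner B g1 (tensor A th')) (inner T g2 (tensor bx E)) => s t.
move: (inner B u (tensor bx' th')) (inner B u (tensor bx th')) => a b.
move: (inner T u (tensor bx th')) (inner T u (tensor bx th)) => b' c.
move: (inner B g1 g1) (inner T g2 g2) => k1 k2.
move: (inner B (tensor A th') (tensor A th')) (inner T (tensor bx E) (tensor bx E)) => m1 m2.
clear -N1 h'0 hh h1 h0 => c1 c2 G1 G2 -> n1 n2 w1 w2.
have -> : a - c = - (s + t) by lra.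
have h7 : (s + t) ^+ 2 <= 2 * s ^+ 2 + 2 * t ^+ 2 by have := sqr_ge0 (s - t); rewrite sqrrB sqrrD; lra.
have h8 : h' * s ^+ 2 <= 2 * N ^+ 2 * k1.
  have := ler_wpM2l (ltW h'0) (le_trans c1 (ler_wpM2l G1 n1)).
  have -> // : h' * (k1 * ((N / h') ^+ 2 * (2 * h'))) = 2 * N ^+ 2 * k1.
  by field; rewrite gt_eqF.
have h9 : h' * t ^+ 2 <= N ^+ 2 * k2.
  have := ler_wpM2l (ltW h'0) (le_trans c2 (ler_wpM2l G2 n2)).
  have : h' * h <= 1 by nra.
  have := mulr_ge0 (sqr_ge0 N) G2; nra.
have := ler_wpM2l (ltW h'0) h7; rewrite sqrrN.
by have := mulr_ge0 (sqr_ge0 N) G2; lra.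
Qed.

End chain.

(** * Sums of integrals over packings and over coverings up to null sets *)

Section coverings.
Context {R : realType}.
Local Notation plane := (measurableTypeR R * measurableTypeR R)%type.
Local Notation mu2 := (@lebesgue2 R).
Implicit Types (Om D : set plane) (v : R * R -> R).

Let restrict D v : R * R -> R := fun p => \1_D p * v p.

Let restrict_le D v p : restrict D v p ^+ 2 <= v p ^+ 2.
Proof.
by rewrite exprMn ler_piMl ?sqr_ge0// indicE; case: (_ \in _); rewrite ?expr1n// expr0n.
Qed.

Let restrict_L2 Om D v : measurable Om -> measurable D -> L2 Om v -> L2 Om (restrict D v).
Proof.
move=> mOm mD Lv; have mr : @measurable_fun _ _ plane R Om (restrict D v).
  apply: measurable_funM; last exact: L2_measurable Lv.
  exact: measurable_indic.
apply: L2_intro => //.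
apply: le_integrable (L2_sqr_integrable mOm Lv) => //.
  by apply/measurable_EFinP; exact: measurable_funX.
by move=> p _ /=; rewrite lee_fin !ger0_norm ?sqr_ge0// restrict_le.
Qed.

Let inner_restr Om D v : D `<=` Om -> inner Om v (restrict D v) = inner D v v.
Proof.
move=> DOm; rewrite (@inner_restrict _ Om D)//; last first.
  by move=> p pD; rewrite /restrict indicE memNset// mul0r.
by apply: eq_Rintegral => p /set_mem pD; rewrite /restrict indicE mem_set// mul1r.
Qed.

Let inner_sum_restr (I : finType) Om (D : I -> set plane) v : measurable Om ->
  (forall i, measurable (D i)) -> (forall i, D i `<=` Om) -> L2 Om v ->
  L2 Om (\sum_i restrict (D i) v) /\
  inner Om v (\sum_i restrict (D i) v) = \sum_i inner (D i) v v.
Proof.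
move=> mOm mD DOm Lv; have sL := L2_subspace mOm; have fI := inner_form mOm.
have Lr i : L2 Om (restrict (D i) v) by exact: restrict_L2.
split; first exact: subspace_sum.
rewrite (linear_on_sum sL (form_linr sL fI Lv) Lr).
by apply: eq_bigr => i _; exact: inner_restr.
Qed.

Let sum_restrict (I : finType) (D : I -> set plane) v p :
  (\sum_i restrict (D i) v) p = (\sum_i \1_(D i) p) * v p.
Proof. by rewrite fct_sumE mulr_suml. Qed.

Lemma packing_inner (I : finType) Om (D : I -> set plane) v (K : nat) : measurable Om ->
  (forall i, measurable (D i)) -> (forall i, D i `<=` Om) -> L2 Om v ->
  (forall p, \sum_i (\1_(D i) p : R) <= K%:R) ->
  \sum_i inner (D i) v v <= K%:R * inner Om v v.
Proof.
move=> mOm mD DOm Lv DK; have sL := L2_subspace mOm; have fI := inner_form mOm.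
have [Ls <-] := inner_sum_restr mOm mD DOm Lv.
rewrite -(linear_onZ sL (form_linr sL fI Lv) _ Lv).
apply: le_Rintegral => //.
- exact: L2_integrable.
- apply: L2_integrable => //; exact: subspaceZ.
move=> p _; rewrite sum_restrict.
have -> : (K%:R *: v) p = K%:R * v p by [].
by rewrite ![v p * _]mulrC -!mulrA ler_wpM2r// -expr2 sqr_ge0.
Qed.

Lemma inner_setD_null Om (N : set plane) v : measurable Om -> measurable N ->
  mu2 N = 0%E -> L2 Om v -> inner Om v v = inner (Om `\` N) v v.
Proof.
move=> mOm mN N0 Lv; congr fine.
by apply: negligible_integral => //; exact: L2_integrable.
Qed.

Lemma covering_inner (I : finType) Om (D : I -> set plane) (N : set plane) v :
  measurable Om -> (forall i, measurable (D i)) -> (forall i, D i `<=` Om) -> L2 Om v ->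
  measurable N -> mu2 N = 0%E -> (forall p, Om p -> ~ N p -> exists i, D i p) ->
  inner Om v v <= \sum_i inner (D i) v v.
Proof.
move=> mOm mD DOm Lv mN N0 cover.
have mON : measurable (Om `\` N) by exact: measurableD.
have LN : L2 (Om `\` N) v by exact: (L2_subset mOm mON (@subDsetl _ _ _) Lv).
rewrite (inner_setD_null mOm mN N0 Lv).
apply: (@le_trans _ _ (\sum_i inner (D i `\` N) v v)); last first.
  apply: ler_sum => i _; apply: inner_subset => //; first exact: measurableD.
  exact: (L2_subset mOm (mD i) (@DOm i) Lv).
have mDN i : measurable (D i `\` N) by exact: measurableD.
have DN i : D i `\` N `<=` Om `\` N by apply: setSD; exact: DOm.
have [Ls <-] := inner_sum_restr mON mDN DN LN.
apply: le_Rintegral => //; [exact: L2_integrable|exact: L2_integrable|].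
move=> p [Op Np]; rewrite sum_restrict.
have [i Dip] := cover p Op Np.
have h1 : 1 <= \sum_j \1_(D j `\` N) p :> R.
  by rewrite (bigD1 i)//= indicE mem_set//= lerDl; apply: sumr_ge0.
by rewrite mulrCA -[leLHS]mul1r; apply: ler_wpM2r => //; rewrite -expr2 sqr_ge0.
Qed.

(** It contains the lines along which neighbouring open cells abut, the only points of the horn that
    the cells miss. *)
Definition integer_grid : set plane :=
  range (fun k : nat => k%:R : R) `*` setT `|` setT `*` range (fun k : nat => k%:R : R).

Let countable_naturals : countable (range (fun k : nat => k%:R : R)).
Proof. exact: card_image_le. Qed.

Let measurable_naturals :
  measurable (range (fun k : nat => k%:R : R) : set (measurableTypeR R)).
Proof. exact: countable_measurable. Qed.

Lemma measurable_integer_grid : measurable integer_grid.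
Proof.
apply: measurableU; apply: measurableX => //; exact: measurable_naturals.
Qed.

Lemma integer_grid_null : mu2 integer_grid = 0%E.
Proof.
apply/eqP; rewrite eq_le measure_ge0 andbT.
have m1 : measurable (range (fun k : nat => k%:R : R) `*` setT : set plane).
  by apply: measurableX => //; exact: measurable_naturals.
have m2 : measurable (setT `*` range (fun k : nat => k%:R : R) : set plane).
  by apply: measurableX => //; exact: measurable_naturals.
have mu0 := countable_lebesgue_measure0 countable_naturals.
have e1 : mu2 (range (fun k : nat => k%:R : R) `*` setT) = 0%E.
  rewrite [LHS](product_measure1E _ _ measurable_naturals measurableT).
  by rewrite [X in (X * _)%E]mu0 mul0e.
have e2 : mu2 (setT `*` range (fun k : nat => k%:R : R)) = 0%E.
  rewrite [LHS](product_measure1E _ _ measurableT measurable_naturals).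
  by rewrite [X in (_ * X)%E]mu0 mule0.
apply: (le_trans (measureU2 mu2 m1 m2)).
by rewrite [X in (X + _)%E]e1 [X in (_ + X)%E]e2 adde0.
Qed.

End coverings.

(** * The domain, its cells and the gap inequality *)

Section horn.
Context {R : realType}.
Local Notation plane := (measurableTypeR R * measurableTypeR R)%type.
Local Notation mu2 := (@lebesgue2 R).
Implicit Types (x y a : R) (p : R * R).

Lemma box_indic x0 x1 y0 y1 p :
  \1_(box x0 x1 y0 y1 : set plane) p = (x0 < p.1 < x1)%R%:R * (y0 < p.2 < y1)%R%:R :> R.
Proof.
rewrite indicE -natrM mulnb; congr (nat_of_bool _)%:R.
by apply/idP/idP => [/set_mem[-> ->]//|/andP[h1 h2]]; exact/mem_set.
Qed.

Lemma unit_strips_disjoint x m : \sum_(i < m) (i%:R < x < i%:R + 1)%R%:R <= 1 :> R.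
Proof.
(* The induction needs the extra term: a point beyond [m] has not met an earlier strip and may still
   enter the next one. *)
suff : \sum_(i < m) (i%:R < x < i%:R + 1)%R%:R + (m%:R < x)%R%:R <= 1 :> R.
  by apply: le_trans; rewrite lerDl.
elim: m => [|m IH]; first by rewrite big_ord0 add0r; case: (_ < _).
rewrite big_ord_recr /= -addrA; apply: le_trans IH; rewrite lerD2l -natr1.
by have [] := ltP m%:R x; have [] := ltP x (m%:R + 1); have [] := ltP (m%:R + 1) x => /=; lra.
Qed.

Lemma double_strips_overlap a x m : \sum_(i < m) (a + i%:R < x < a + i%:R + 2)%R%:R <= 2 :> R.
Proof.
(* Two extra terms reserve the strips to come: one for a point past the start of strip [m], another
   for a point past its middle. *)
suff : \sum_(i < m) (a + i%:R < x < a + i%:R + 2)%R%:R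
    + ((a + m%:R < x)%R%:R + (a + m%:R + 1 < x)%R%:R) <= 2 :> R.
  by apply: le_trans; rewrite lerDl addr_ge0.
elim: m => [|m IH].
  by rewrite big_ord0 add0r; case: (_ < x); case: (_ < x) => /=; lra.
rewrite big_ord_recr /= -addrA; apply: le_trans IH; rewrite lerD2l -[m.+1%:R]natr1.
have [] := ltP (a + m%:R) x; have [] := ltP x (a + m%:R + 2);
  have [] := ltP (a + m%:R + 1) x; have [] := ltP (a + (m%:R + 1)) x;
  have [] := ltP (a + (m%:R + 1) + 1) x => /= *; lra.
Qed.

(** Since c_{i+1}^2 <= 2 c_i^2 + 2 (c_{i+1} - c_i)^2 while the weight drops by 4, the old average
    contributes half of its previous term; these halves sum to the factor 2. *)
Lemma geometric_chain (c e : nat -> R) n :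
  (forall i, (i < n)%N -> 4^-1 ^+ i.+1 * (c i.+1 - c i) ^+ 2 <= e i) ->
  \sum_(i < n.+1) 4^-1 ^+ i * c i ^+ 2 <= 2 * c 0 ^+ 2 + 4 * \sum_(i < n) e i.
Proof.
move=> ce.
(* The last term is counted twice, as the remainder of a geometric series of ratio 1/2. *)
have H m : (m <= n)%N -> \sum_(i < m.+1) 4^-1 ^+ i * c i ^+ 2 + 4^-1 ^+ m * c m ^+ 2
    <= 2 * c 0 ^+ 2 + 4 * \sum_(i < m) e i.
  elim: m => [|m IH] mn; first by rewrite big_ord_recr !big_ord0 /= expr0; lra.
  rewrite big_ord_recr [in leRHS]big_ord_recr /=.
  have := IH (ltnW mn); have := ce _ mn; rewrite !exprS.
  have q0 : 0 <= 4^-1 ^+ m :> R by rewrite exprn_ge0.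
  (* This square is the defect in c'^2 <= 2 c^2 + 2 (c' - c)^2. *)
  have : 0 <= 4^-1 ^+ m * (c m.+1 - 2 * c m) ^+ 2 by rewrite mulr_ge0// sqr_ge0.
  move: (\sum_(i < m.+1) _) (\sum_(i < m) _) => s t.
  move: q0 (4^-1 ^+ m) => _ q; lra.
apply: le_trans (H n (leqnn n)); rewrite lerDl mulr_ge0 ?sqr_ge0// exprn_ge0//.
Qed.

(** Every box starts at the origin instead of at the end of the preceding one. The union is then
    open with no interface to glue, and star-shaped about any point common to the boxes. *)
Definition horn (S n : nat) : set (R * R) :=
  [set p | box 0 S%:R 0 S%:R p \/
    exists2 i, (i <= n)%N & box 0 ((S + i)%:R + 1) 0 (4^-1 ^+ i) p].

Lemma measurable_horn S n : measurable (horn S n : set plane).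
Proof.
have -> : horn S n = box 0 S%:R 0 S%:R `|`
    \bigcup_(i in [set i | (i <= n)%N]) box 0 ((S + i)%:R + 1) 0 (4^-1 ^+ i).
  by rewrite eqEsubset; split => p [bp|[i ni bp]]; [left|right; exists i|left|right; exists i].
apply: (@measurableU _ plane); first exact: measurable_box.
by apply: (@bigcup_measurable _ plane) => i _; exact: measurable_box.
Qed.

Section cells.
Variables (S n : nat).
Hypothesis S0 : (0 < S)%N.

Definition square_cell (jk : 'I_S * 'I_S) : set (R * R) :=
  box jk.1%:R (jk.1%:R + 1) jk.2%:R (jk.2%:R + 1).

Definition tail_cell (i : nat) : set (R * R) :=
  box (S + i)%:R ((S + i)%:R + 1) 0 (4^-1 ^+ i).

Lemma square_cell_horn jk : square_cell jk `<=` horn S n.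
Proof.
case: jk => j k p pQ; left; apply: subset_box pQ => //=;
  by rewrite natr1 ler_nat.
Qed.

Lemma tail_cell_horn i : (i <= n)%N -> tail_cell i `<=` horn S n.
Proof. by move=> ni p pQ; right; exists i => //; apply: subset_box pQ. Qed.

Lemma tail_link_horn i : (i < n)%N ->
  box (S + i)%:R ((S + i)%:R + 2) 0 (4^-1 ^+ i.+1) `<=` horn S n.
Proof.
move=> ni p pQ; right; exists i.+1 => //; apply: subset_box pQ => //.
by rewrite addnS -[(S + i).+1%:R]natr1 -addrA.
Qed.

Lemma square_cells_disjoint p : \sum_jk \1_(square_cell jk : set plane) p <= 1 :> R.
Proof.
under eq_bigr do rewrite box_indic.
rewrite -(pair_bigA _ (fun j k : 'I_S =>
  (j%:R < p.1 < j%:R + 1)%R%:R * (k%:R < p.2 < k%:R + 1)%R%:R))/=.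
rewrite -big_distrlr/= -[leRHS]mulr1.
by apply: ler_pM; rewrite ?unit_strips_disjoint// sumr_ge0.
Qed.

Lemma tail_links_overlap (m : nat) p :
  \sum_(i < m) \1_(box (S + i)%:R ((S + i)%:R + 2) 0 (4^-1 ^+ i.+1) : set plane) p
    <= 2 :> R.
Proof.
apply: le_trans (double_strips_overlap S%:R p.1 m); apply: ler_sum => i _.
by rewrite box_indic natrD ler_piMr// lern1 leq_b1.
Qed.

Lemma tail_cells_overlap (m : nat) p :
  \sum_(i < m) \1_(tail_cell i : set plane) p <= 2 :> R.
Proof.
apply: le_trans (double_strips_overlap S%:R p.1 m); apply: ler_sum => i _.
rewrite box_indic natrD; apply: (@le_trans _ _ (S%:R + i%:R < p.1 < S%:R + i%:R + 1)%R%:R).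
  by rewrite ler_piMr// lern1 leq_b1.
rewrite ler_nat; case: (ltP _ p.1) => //= h1; case: ltP => //= h2.
by rewrite (lt_trans h2)// ltrD2l ltr1n.
Qed.

(** The integer parts of the coordinates pick the cell; off the grid the inequalities are strict. *)
Lemma horn_cover p : horn S n p -> ~ integer_grid p ->
  exists i : 'I_S * 'I_S + 'I_n.+1,
    match i with inl jk => square_cell jk | inr i => tail_cell i end p.
Proof.
have S1 : 1 <= S%:R :> R by rewrite ler1n.
move=> hp gp.
have off (t : R) : 0 < t -> ~ range (fun k : nat => k%:R : R) t ->
    (Num.truncn t)%:R < t < (Num.truncn t)%:R + 1.
  move=> t0 nt; have /andP[h1 h2] := truncn_itv (ltW t0).
  rewrite natr1 h2 andbT lt_neqAle h1 andbT; apply/eqP => e.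
  by apply: nt; exists (Num.truncn t).
have [p1 p2] : 0 < p.1 /\ 0 < p.2.
  by case: hp => [[/andP[? _] /andP[? _]]|[i _ [/andP[? _] /andP[? _]]]].
have o1 : (Num.truncn p.1)%:R < p.1 < (Num.truncn p.1)%:R + 1.
  by apply: off => // h; apply: gp; left.
have o2 : (Num.truncn p.2)%:R < p.2 < (Num.truncn p.2)%:R + 1.
  by apply: off => // h; apply: gp; right.
have [pS|Sp] := ltP p.1 S%:R.
  have qS : p.2 < S%:R.
    case: hp => [[_ /andP[]]//|[i _ [_ /andP[_ h]]]].
    by apply: (lt_le_trans h); apply: le_trans S1; apply: exprn_ile1; lra.
  have j1 : (Num.truncn p.1 < S)%N by rewrite truncn_lt_nat// ltW.
  have j2 : (Num.truncn p.2 < S)%N by rewrite truncn_lt_nat// ltW.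
  by exists (inl (Ordinal j1, Ordinal j2)).
case: hp => [[/andP[_ h] _]|[i ni [/andP[_ h1] /andP[_ h2]]]].
  by have := lt_le_trans h Sp; rewrite ltxx.
have ST : (S <= Num.truncn p.1)%N.
  by rewrite leqNgt truncn_lt_nat ?(ltW p1)// ltNge Sp.
have Ti : (Num.truncn p.1 - S <= i)%N.
  rewrite leq_subLR; have /andP[h3 _] := o1.
  by rewrite -ltnS -(ltr_nat R) -natr1; exact: lt_trans h1.
have Tn : (Num.truncn p.1 - S < n.+1)%N by rewrite ltnS (leq_trans Ti).
(* The index found is at most the [i] of the box containing the point, so this tail cell is at least
   as high as that box. *)
exists (inr (Ordinal Tn)); rewrite /= /tail_cell subnKC//; split => //=.
rewrite p2 /=; apply: (lt_le_trans h2).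
by apply: ler_wiXn2l => //; lra.
Qed.

(** The square contributes 16 N^4 to the gradient constant, the tail cells 16 * 2 and the chain 2 *
    16 * 2; their total of 112 is rounded up to 120. The moments enter as 2 [MQ] and 4 [m]. *)
Let gap_arithmetic (N U SQ ST MQ m X a1 a2 b1 b2 d1 f2 G1 G2 : R) : 1 <= N ->
  U <= SQ + ST -> SQ <= 2 * MQ + 16 * N ^+ 4 * (a1 + a2) ->
  ST <= 2 * X + 16 * N ^+ 4 * (b1 + b2) -> X <= 2 * m + 4 * (4 * N ^+ 2 * (d1 + f2)) ->
  a1 <= 1%:R * G1 -> a2 <= 1%:R * G2 -> b1 <= 2%:R * G1 -> b2 <= 2%:R * G2 ->
  d1 <= 2%:R * G1 -> f2 <= 2%:R * G2 -> 0 <= G1 -> 0 <= G2 -> 0 <= MQ ->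
  U <= 120 * N ^+ 4 * (G1 + G2) + 4 * (m + MQ).
Proof.
move=> N1 U1 SQ1 ST1 X1 h1 h2 h3 h4 h5 h6 G10 G20 MQ0.
have N24 : N ^+ 2 <= N ^+ 4 by apply: ler_weXn2l.
have N40 : 0 <= N ^+ 4 by rewrite exprn_ge0// (le_trans ler01).
have N20 : 0 <= N ^+ 2 by exact: sqr_ge0.
have k1 : N ^+ 4 * (a1 + a2) <= N ^+ 4 * (G1 + G2) by apply: ler_wpM2l => //; lra.
have k2 : N ^+ 4 * (b1 + b2) <= N ^+ 4 * (2 * (G1 + G2)) by apply: ler_wpM2l => //; lra.
have k3 : N ^+ 2 * (d1 + f2) <= N ^+ 2 * (2 * (G1 + G2)) by apply: ler_wpM2l => //; lra.
have k4 : N ^+ 2 * (2 * (G1 + G2)) <= N ^+ 4 * (2 * (G1 + G2)) by apply: ler_wpM2r => //; lra.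
have k5 : 0 <= N ^+ 4 * (G1 + G2) by apply: mulr_ge0 => //; lra.
move: k1 k2 k3 k4 k5 SQ1 ST1 X1; rewrite -!mulrA !(mulrCA _ 2).
move: (N ^+ 4 * (G1 + G2)) (N ^+ 4 * (a1 + a2)) (N ^+ 4 * (b1 + b2)) => A B C.
move: (N ^+ 2 * (d1 + f2)) (N ^+ 2 * (G1 + G2)) => D E; lra.
Qed.

(* The weights [4^-i] of the tail decay faster than the moments can grow, so
   the moment of the first tail cell controls all of them. *)
Lemma horn_gap (N : R) u g1 g2 : 1 <= N ->
  (forall a b x : R, a < b -> `|bump a b x| <= N / (b - a)) ->
  H1 (horn S n) u g1 g2 ->
  inner (horn S n) u u <= 120 * N ^+ 4 * (inner (horn S n) g1 g1 + inner (horn S n) g2 g2) +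
    4 * (bump_moment u S%:R (S%:R + 1) 0 1 ^+ 2 +
      \sum_(jk : 'I_S * 'I_S) bump_moment u jk.1%:R (jk.1%:R + 1) jk.2%:R (jk.2%:R + 1) ^+ 2).
Proof.
move=> N1 bN Hu; have mOm := measurable_horn S n.
have [Lu Lg1 Lg2 _ _] := Hu.
pose Om : set plane := horn S n.
have mQ jk : measurable (square_cell jk : set plane) := measurable_box _ _ _ _.
have mT i : measurable (tail_cell i : set plane) := measurable_box _ _ _ _.
pose cell (i : ('I_S * 'I_S) + 'I_n.+1) : set plane :=
  match i with inl jk => square_cell jk | inr i => tail_cell i end.
have mcell i : measurable (cell i) by case: i => [jk|i]; [exact: mQ|exact: mT].
have cellOm i : cell i `<=` Om.
  by case: i => [jk|i]; [exact: square_cell_horn|apply: tail_cell_horn; rewrite -ltnS].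
have c0 := covering_inner mOm mcell cellOm Lu measurable_integer_grid integer_grid_null
  (@horn_cover).
rewrite big_sumType/= in c0.
have q0 i : 0 < 4^-1 ^+ i :> R by rewrite exprn_gt0.
have q1 i : 4^-1 ^+ i <= 1 :> R by apply: exprn_ile1; lra.
have l1 (z : R) : z < z + 1 by rewrite ltrDl.
have w1 (z : R) : z + 1 - z = 1 by rewrite addrAC subrr add0r.
have le1 (z : R) : z + 1 - z <= 1 by rewrite w1.
have cQ jk := box_norm_le mOm Hu (@square_cell_horn jk) (l1 _) (l1 _) N1 bN (le1 _) (le1 _).
have cT (i : 'I_n.+1) : inner (tail_cell i) u u <= _ :=
  box_norm_le mOm Hu (@tail_cell_horn i (ltn_ord i)) (l1 _) (q0 i) N1 bN (le1 _)
    (etrans (congr1 (fun z => z <= 1) (subr0 _)) (q1 i)).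
pose c i := bump_moment u (S + i)%:R ((S + i)%:R + 1) 0 (4^-1 ^+ i).
pose e i := 4 * N ^+ 2 * (inner (box (S + i)%:R ((S + i)%:R + 2) 0 (4^-1 ^+ i.+1)) g1 g1 +
   inner (tail_cell i) g2 g2).
(* The end of tail cell [i] is the start of tail cell [i.+1], which makes the moments of
   [chain_step] those of consecutive cells. *)
have ce i : (i < n)%N -> 4^-1 ^+ i.+1 * (c i.+1 - c i) ^+ 2 <= e i.
  move=> ni; have hh : 4^-1 ^+ i.+1 <= 4^-1 ^+ i :> R by rewrite exprS; have := q0 i; lra.
  have := chain_step N1 bN mOm Hu (q0 i.+1) hh (q1 i) (@tail_cell_horn i (ltnW ni)) (@tail_link_horn i ni).
  have E1 : (S + i)%:R + 1 = (S + i.+1)%:R :> R by rewrite addnS natr1.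
  have E2 : (S + i)%:R + 2 = (S + i.+1)%:R + 1 :> R by rewrite -E1 -addrA.
  by rewrite /c -E2 -E1.
have chain := geometric_chain ce.
have p1 g : L2 Om g -> \sum_jk inner (square_cell jk) g g <= 1%:R * inner Om g g.
  move=> Lg; apply: packing_inner => //; [exact: square_cell_horn|exact: square_cells_disjoint].
have p2 g : L2 Om g -> \sum_(i < n.+1) inner (tail_cell i) g g <= 2%:R * inner Om g g.
  move=> Lg; apply: (@packing_inner _ _ _ (fun i : 'I_n.+1 => tail_cell i : set plane)) => //.
    by move=> i; apply: tail_cell_horn; rewrite -ltnS.
  by move=> p; exact: tail_cells_overlap.
have p2' g : L2 Om g -> \sum_(i < n) inner (tail_cell i) g g <= 2%:R * inner Om g g.
  move=> Lg; apply: (@packing_inner _ _ _ (fun i : 'I_n => tail_cell i : set plane)) => //.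
    by move=> i; apply: tail_cell_horn; exact: ltnW.
  by move=> p; exact: tail_cells_overlap.
have p3 g : L2 Om g -> \sum_(i < n)
    inner (box (S + i)%:R ((S + i)%:R + 2) 0 (4^-1 ^+ i.+1)) g g <= 2%:R * inner Om g g.
  move=> Lg; apply: (@packing_inner _ _ _ (fun i : 'I_n =>
    box (S + i)%:R ((S + i)%:R + 2) 0 (4^-1 ^+ i.+1) : set plane)) => //.
  - by move=> i; exact: measurable_box.
  - by move=> i; exact: tail_link_horn.
  - by move=> p; exact: tail_links_overlap.
have p1u g : L2 Om g -> 0 <= inner Om g g by move=> Lg; exact: (form_ge0 (inner_form mOm)).
have e0 : c 0 = bump_moment u S%:R (S%:R + 1) 0 1 by rewrite /c addn0 expr0.
have cQ' : \sum_jk inner (square_cell jk) u u <=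
    2 * \sum_(jk : 'I_S * 'I_S) bump_moment u jk.1%:R (jk.1%:R + 1) jk.2%:R (jk.2%:R + 1) ^+ 2 +
    16 * N ^+ 4 * (\sum_jk inner (square_cell jk) g1 g1 + \sum_jk inner (square_cell jk) g2 g2).
  rewrite -big_split !mulr_sumr -big_split /=; apply: ler_sum => jk _.
  by have := cQ jk; rewrite !w1 !mulr1.
have cT' : \sum_(i < n.+1) inner (tail_cell i) u u <=
    2 * \sum_(i < n.+1) 4^-1 ^+ i * c i ^+ 2 +
    16 * N ^+ 4 * (\sum_(i < n.+1) inner (tail_cell i) g1 g1 + \sum_(i < n.+1) inner (tail_cell i) g2 g2).
  rewrite -big_split !mulr_sumr -big_split /=; apply: ler_sum => i _.
  by have := cT i; rewrite w1 subr0 mul1r mulrA.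
have eE : \sum_(i < n) e i = 4 * N ^+ 2 * (\sum_(i < n)
    inner (box (S + i)%:R ((S + i)%:R + 2) 0 (4^-1 ^+ i.+1)) g1 g1 +
    \sum_(i < n) inner (tail_cell i) g2 g2).
  by rewrite -big_split mulr_sumr.
rewrite eE e0 in chain.
have MQ0 : 0 <= \sum_(jk : 'I_S * 'I_S)
    bump_moment u jk.1%:R (jk.1%:R + 1) jk.2%:R (jk.2%:R + 1) ^+ 2.
  by apply: sumr_ge0 => jk _; exact: sqr_ge0.
exact: (gap_arithmetic N1 c0 cQ' cT' chain (p1 _ Lg1) (p1 _ Lg2) (p2 _ Lg1) (p2 _ Lg2)
  (p3 _ Lg1) (p2' _ Lg2) (p1u _ Lg1) (p1u _ Lg2) MQ0).
Qed.

End cells.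
End horn.

(** * Test functions of the plane: measurability, bounds, linearity *)

Section test_functions.
Context {R : realType}.
Local Notation plane := (measurableTypeR R * measurableTypeR R)%type.
Local Notation mu2 := (@lebesgue2 R).
Implicit Types (phi psi : R * R -> R) (Om D : set plane) (e : R * R).

(** The measurable sets here form the product sigma-algebra, so an open set is written as a
    countable union of boxes with rational corners. *)
Lemma open_measurable_plane (A : set (R * R)) : open A -> measurable (A : set plane).
Proof.
move=> oA.
pose bq (q : rat * rat * rat * rat) : set plane :=
  box (ratr q.1.1.1) (ratr q.1.1.2) (ratr q.1.2) (ratr q.2).
pose F q : set plane := [set p | bq q p /\ bq q `<=` A].
have -> : A = \bigcup_q F q.
  rewrite eqEsubset; split => [p Ap|p [q _]]; last by case => bp sub; exact: sub.
  have /nbhs_ballP[r r0 rA] := open_nbhs_nbhs (conj oA Ap).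
  have /= r0' : 0 < r := r0.
  have [a /andP[a1 a2]] := @rat_in_itvoo R (p.1 - r) p.1 ltac:(lra).
  have [b /andP[b1 b2]] := @rat_in_itvoo R p.1 (p.1 + r) ltac:(lra).
  have [c /andP[c1 c2]] := @rat_in_itvoo R (p.2 - r) p.2 ltac:(lra).
  have [d /andP[d1 d2]] := @rat_in_itvoo R p.2 (p.2 + r) ltac:(lra).
  rewrite !bnd_simp in a1 a2 b1 b2 c1 c2 d1 d2.
  exists (a, b, c, d) => //; split; first by rewrite /bq /box /= a2 b1 c2 d1.
  move=> q [/andP[/= h1 h2] /andP[/= h3 h4]]; apply: rA.
  by split; rewrite /ball /= ltr_norml; apply/andP; split; lra.
apply: countable_bigcupT_measurable => // q.
have [sub|nsub] := pselect (bq q `<=` A).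
  rewrite (_ : F q = bq q); first exact: measurable_box.
  by rewrite eqEsubset; split => p; [case|].
by rewrite (_ : F q = set0)// -subset0 => p [].
Qed.

Lemma continuous_measurable_plane phi D : continuous phi ->
  @measurable_fun _ _ plane R D phi.
Proof.
move=> cphi; apply: (measurable_funS (E := setT)) => //.
apply: (measurability _ (RGenOInfty.measurableE R)).
move=> /= _ [_ [a ->]] <-; rewrite setTI; apply: open_measurable_plane.
by apply: open_comp => //= x _; exact: cphi.
Qed.

Lemma test_bounded Om phi : test_function Om phi -> exists M, forall x, `|phi x| <= M.
Proof.
move=> [/(_ 0%N) /= cphi cK _].
have /compact_bounded[M [_ MP]] : compact (phi @` closure [set x | phi x != 0]).
  by apply: continuous_compact => //; exact: continuous_subspaceT.
exists (Num.max 0 (M + 1)) => x; have [->|px] := eqVneq (phi x) 0.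
  by rewrite normr0 le_max lexx.
rewrite le_max; apply/orP; right; apply: (MP (M + 1)); first by rewrite ltrDl.
by exists x => //; apply: subset_closure.
Qed.

Lemma test_L2 Om D phi : measurable D -> (mu2 D < +oo)%E -> test_function Om phi ->
  L2 D phi.
Proof.
move=> mD fD tphi; have [M phiM] := test_bounded tphi.
apply: (bounded_L2 mD fD (M := M)) => [|x _]; last exact: phiM.
by have [/(_ 0%N) /= cphi _ _] := tphi; exact: continuous_measurable_plane.
Qed.

Let derive_out phi e x : ~ closure [set x | phi x != 0] x -> 'D_e phi x = 0.
Proof.
move=> nx; have phi0 : {near x, phi =1 cst 0}.
  have : nbhs x (~` closure [set x | phi x != 0]).
    apply: open_nbhs_nbhs; split => //; apply: closed_openC; exact: closed_closure.
  apply: filterS => y ny; apply: contra_notP ny => /eqP py.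
  by apply: subset_closure.
by rewrite (near_eq_derive _ phi0); exact: derive_cst.
Qed.

Let support_derive phi e :
  closure [set x | 'D_e phi x != 0] `<=` closure [set x | phi x != 0].
Proof.
rewrite [X in _ `<=` X](closure_id _).1; last exact: closed_closure.
apply: closureS => x /= /eqP nx; apply: contrapT => h; apply: nx.
exact: derive_out.
Qed.

Lemma test_derive1 Om phi : test_function Om phi -> test_function Om (fun x => 'D_e1 phi x).
Proof.
move=> [sphi cK KOm]; split.
- by move=> n; have [] := sphi n.+1.
- apply: (subclosed_compact _ cK); [exact: closed_closure|exact: support_derive].
- exact: subset_trans (@support_derive phi e1) KOm.
Qed.

Lemma test_derive2 Om phi : test_function Om phi -> test_function Om (fun x => 'D_e2 phi x).
Proof.
move=> [sphi cK KOm]; split.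
- by move=> n; have [] := sphi n.+1.
- apply: (subclosed_compact _ cK); [exact: closed_closure|exact: support_derive].
- exact: subset_trans (@support_derive phi e2) KOm.
Qed.

Lemma derive_linear k phi psi e : (forall x, derivable phi x e) ->
  (forall x, derivable psi x e) ->
  (fun x => 'D_e (k *: phi + psi) x) = k *: (fun x => 'D_e phi x) + (fun x => 'D_e psi x).
Proof.
move=> dphi dpsi; apply/funext => x.
rewrite deriveD//; last exact: derivableZ.
by rewrite deriveZ.
Qed.

Lemma Ck_linear n k phi psi : Ck n phi -> Ck n psi -> Ck n (k *: phi + psi).
Proof.
have cl f g : continuous f -> continuous g -> continuous (k *: f + g : R * R -> R).
  by move=> cf cg x; apply: cvgD; [apply: cvgZr; exact: cf|exact: cg].
elim: n phi psi => [|n IH] phi psi; first exact: cl.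
move=> [c1 d1 C1 d2 C2] [c1' d1' C1' d2' C2'].
have dl e : (forall x, derivable phi x e) -> (forall x, derivable psi x e) ->
    forall x, derivable (k *: phi + psi) x e.
  by move=> df dg x; apply: derivableD => //; exact: derivableZ.
split; [exact: cl|exact: dl| |exact: dl|].
- by rewrite derive_linear//; exact: IH.
- by rewrite derive_linear//; exact: IH.
Qed.

Lemma test_linear Om k phi psi : test_function Om phi -> test_function Om psi ->
  test_function Om (k *: phi + psi).
Proof.
move=> [s1 c1 K1] [s2 c2 K2].
have sub : closure [set x | (k *: phi + psi) x != 0] `<=`
    closure [set x | phi x != 0] `|` closure [set x | psi x != 0].
  rewrite -closureU; apply: closureS => x /=.
  have -> : (k *: phi + psi) x = k * phi x + psi x by [].
  have [->|] := eqVneq (phi x) 0; last by left.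
  by rewrite mulr0 add0r; right.
split; first by move=> n; apply: Ck_linear.
- apply: (subclosed_compact _ (compactU c1 c2)) => //; exact: closed_closure.
- by move=> x /sub[/K1|/K2].
Qed.

Lemma test_derivable Om phi : test_function Om phi ->
  (forall x, derivable phi x e1) /\ (forall x, derivable phi x e2).
Proof. by move=> [/(_ 1%N)[_ d1 _ d2 _] _ _]. Qed.

Lemma test0 Om : test_function Om (0 : R * R -> R).
Proof.
have e0 : closure [set x | (0 : R * R -> R) x != 0] = set0.
  rewrite -closure0; congr closure; rewrite -subset0 => x /=.
  by rewrite eqxx.
split; [|by rewrite e0; exact: compact0|by rewrite e0].
have d0 e : (fun x => 'D_e (0 : R * R -> R) x) = 0.
  by apply/funext => x; exact: derive_cst.
elim=> [|n IH]; first by move=> x; exact: cvg_cst.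
by split; rewrite ?d0// => x; (exact: cvg_cst || exact: derivable_cst).
Qed.

End test_functions.

(** * Sobolev spaces as spaces of functions with a chosen weak gradient *)

Section sobolev.
Context {R : realType}.
Local Notation plane := (measurableTypeR R * measurableTypeR R)%type.
Local Notation mu2 := (@lebesgue2 R).
Local Notation field := (R * R -> R).

(* A function together with its weak gradient. *)
Definition graph := (field * (field * field))%type.
Implicit Types (w v : graph) (u g : field) (phi : field).

Definition test_graph phi : graph := (phi, (fun x => 'D_e1 phi x, fun x => 'D_e2 phi x)).

Definition mass (Om : set plane) w v : R := inner Om w.1 v.1.
(** On graphs this is a genuine form, although a weak gradient is determined by its function only
    almost everywhere. *)
Definition dirichlet (Om : set plane) w v : R :=
  inner Om w.2.1 v.2.1 + inner Om w.2.2 v.2.2.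
Definition energy Om w v : R := dirichlet Om w v + mass Om w v.

Definition H1_graph (Om : set plane) : set graph := [set w | H1 Om w.1 w.2.1 w.2.2].
Definition H10_graph (Om : set plane) : set graph := [set w | H10 Om w.1 w.2.1 w.2.2].

Lemma psd_formS (V : lmodType R) (D D' : set V) (a : V -> V -> R) : D `<=` D' ->
  psd_form D' a -> psd_form D a.
Proof.
move=> DD' [h1 h2 h3]; split => [u v Du Dv|w Dw k u v Du Dv|u Du].
- by apply: h1; exact: DD'.
- by apply: h2; exact: DD'.
- by apply: h3; exact: DD'.
Qed.

Lemma graph_linear1 k w v : (k *: w + v).1 = k *: w.1 + v.1.
Proof. by case: w; case: v. Qed.

Lemma graph_linear21 k w v : (k *: w + v).2.1 = k *: w.2.1 + v.2.1.
Proof. by case: w => ? []; case: v => ? []. Qed.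

Lemma graph_linear22 k w v : (k *: w + v).2.2 = k *: w.2.2 + v.2.2.
Proof. by case: w => ? []; case: v => ? []. Qed.

Definition graph_linear := (graph_linear1, graph_linear21, graph_linear22).

Lemma graph_ext w v : w.1 = v.1 -> w.2.1 = v.2.1 -> w.2.2 = v.2.2 -> w = v.
Proof. by case: w => ? []; case: v => ? [] ? ? ? ? /= -> -> ->. Qed.

Let lt_two_quarters (x y z : R) : x < z / 4 -> y < z / 4 -> 2 * x + 2 * y < z.
Proof. lra. Qed.

Let scaled_lt (k x z : R) : 0 <= x -> x < z / (4 * (k ^+ 2 + 1)) -> k ^+ 2 * x < z / 4.
Proof.
have k1 : 0 < k ^+ 2 + 1 by apply: ltr_wpDl => //; exact: sqr_ge0.
move=> x0; rewrite ltr_pdivlMr ?mulr_gt0// => h; have := sqr_ge0 k; nra.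
Qed.

Section domain.
Variable Om : set plane.
Hypotheses (mOm : measurable Om) (fOm : (mu2 Om < +oo)%E).

Definition L2_graph : set graph := [set w | [/\ L2 Om w.1, L2 Om w.2.1 & L2 Om w.2.2]].

Let sL := L2_subspace mOm.
Let fI := inner_form mOm.

Lemma L2_graph_subspace : subspace L2_graph.
Proof.
have [L0 LD] := sL; split => [|k w v [w1 w2 w3] [v1 v2 v3]]; first by split.
by split; rewrite graph_linear; apply: LD.
Qed.

Lemma mass_form : psd_form L2_graph (mass Om).
Proof.
split => [u v [u1 _ _] [v1 _ _]|w [w1 _ _] k u v [u1 _ _] [v1 _ _]|u [u1 _ _]].
- exact: (formC fI).
- by rewrite /mass graph_linear; exact: (form_linl fI w1).
- exact: (form_ge0 fI).
Qed.

Lemma dirichlet_form : psd_form L2_graph (dirichlet Om).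
Proof.
split => [u v [_ u2 u3] [_ v2 v3]|w [_ w2 w3] k u v [_ u2 u3] [_ v2 v3]|u [_ u2 u3]].
- by rewrite /dirichlet (formC fI u2 v2) (formC fI u3 v3).
- have /= h1 := form_linl fI w2 k u2 v2; have /= h2 := form_linl fI w3 k u3 v3.
  by rewrite /dirichlet !graph_linear h1 h2 mulrDr addrACA.
- by rewrite addr_ge0//; apply: (form_ge0 fI).
Qed.

Lemma energy_form : psd_form L2_graph (energy Om).
Proof.
have [a1 a2 a3] := dirichlet_form; have [b1 b2 b3] := mass_form.
split => [u v Du Dv|w Dw k u v Du Dv|u Du].
- by rewrite /energy a1// b1.
- have /= h1 := a2 w Dw k u v Du Dv; have /= h2 := b2 w Dw k u v Du Dv.
  rewrite -[LHS]/(dirichlet Om (k *: u + v) w + mass Om (k *: u + v) w) h1 h2 addrACA -mulrDr.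
  by [].
- by rewrite /energy addr_ge0// ?a3// b3.
Qed.

Lemma integral_energy u g1 g2 : L2_graph (u, (g1, g2)) ->
  (\int[mu2]_(x in Om) (u x ^+ 2 + g1 x ^+ 2 + g2 x ^+ 2)%:E)%E =
  (energy Om (u, (g1, g2)) (u, (g1, g2)))%:E.
Proof.
move=> [/= Lu L1 L2'].
have msq (f : field) : L2 Om f -> @measurable_fun _ _ plane R Om (fun x => f x ^+ 2).
  by move=> Lf; apply: measurable_funX; exact: L2_measurable Lf.
under eq_integral do rewrite EFinD.
rewrite ge0_integralD//=; last 4 first.
- by move=> x _; rewrite lee_fin addr_ge0// sqr_ge0.
- by apply/measurable_EFinP; apply: measurable_funD; exact: msq.
- by move=> x _; rewrite lee_fin sqr_ge0.
- by apply/measurable_EFinP; exact: msq.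
under eq_integral do rewrite EFinD.
rewrite ge0_integralD//=; last 4 first.
- by move=> x _; rewrite lee_fin sqr_ge0.
- by apply/measurable_EFinP; exact: msq.
- by move=> x _; rewrite lee_fin sqr_ge0.
- by apply/measurable_EFinP; exact: msq.
rewrite !inner_EFin// -!EFinD; congr EFin.
by rewrite /energy /dirichlet /mass /= -addrA addrC.
Qed.

Lemma test_graph_L2 phi : test_function Om phi -> L2_graph (test_graph phi).
Proof.
move=> tphi; split => /=; apply: (test_L2 mOm fOm (Om := Om)) => //.
  exact: test_derive1.
exact: test_derive2.
Qed.

Lemma test_graph_linear k phi psi : test_function Om phi -> test_function Om psi ->
  test_graph (k *: phi + psi) = k *: test_graph phi + test_graph psi.
Proof.
move=> /test_derivable[d1 d2] /test_derivable[d1' d2'].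
apply: graph_ext; rewrite graph_linear; [exact: erefl|exact: derive_linear|exact: derive_linear].
Qed.

Lemma H1_L2 w : H1_graph Om w -> L2_graph w.
Proof. by case. Qed.

Let weak_linear e k u g u' g' :
  (forall phi, test_function Om phi -> test_function Om (fun x => 'D_e phi x)) ->
  L2 Om u -> L2 Om g -> L2 Om u' -> L2 Om g' ->
  weak_derivative Om e u g -> weak_derivative Om e u' g' ->
  weak_derivative Om e (k *: u + u') (k *: g + g').
Proof.
move=> te Lu Lg Lu' Lg' wu wu' phi tphi.
have Lphi := test_L2 mOm fOm tphi; have Ld := test_L2 mOm fOm (te _ tphi).
have h1 := form_linl fI Ld k Lu Lu'; have h2 := form_linl fI Lphi k Lg Lg'.
apply: (etrans h1); rewrite [inner Om u _](wu _ tphi) [inner Om u' _](wu' _ tphi).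
by rewrite -[RHS]/(- inner Om (k *: g + g') phi) [in RHS]h2 opprD mulrN.
Qed.

Lemma H1_subspace : subspace (H1_graph Om).
Proof.
have [L0 LD] := sL; split.
  split => //= phi tphi;
    rewrite -[LHS]/(inner Om 0 _) -[RHS]/(- inner Om 0 phi);
    rewrite (linear_on0 sL (form_linl fI (test_L2 mOm fOm tphi))) oppr0;
    apply: (linear_on0 sL (form_linl fI (test_L2 mOm fOm _))).
  - exact: test_derive1 tphi.
  - exact: test_derive2 tphi.
move=> k w v [w1 w2 w3 w4 w5] [v1 v2 v3 v4 v5]; split; rewrite ?graph_linear; try exact: LD.
- by apply: weak_linear => // phi; exact: test_derive1.
- by apply: weak_linear => // phi; exact: test_derive2.
Qed.

Lemma H10P w : H10_graph Om w <-> H1_graph Om w /\ forall eps, 0 < eps ->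
  exists2 phi, test_function Om phi &
    energy Om (w - test_graph phi) (w - test_graph phi) < eps.
Proof.
split=> -[Hw app]; split => // eps e0; have [phi tphi h] := app _ e0; exists phi => //.
- have Lw := subspaceB L2_graph_subspace (H1_L2 Hw) (test_graph_L2 tphi).
  by rewrite -lte_fin; move: h; rewrite (integral_energy Lw).
- have Lw := subspaceB L2_graph_subspace (H1_L2 Hw) (test_graph_L2 tphi).
  by rewrite -lte_fin -(integral_energy Lw) in h.
Qed.

(** An approximant in [H10] is in turn approximated by a test function; a quarter of [eps] for each
    suffices, as the energy of a sum is at most twice the sum of the energies. *)
Lemma H10_close w : H1_graph Om w ->
  (forall eps, 0 < eps -> exists2 v, H10_graph Om v & energy Om (w - v) (w - v) < eps) ->
  H10_graph Om w.
Proof.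
move=> Hw app; apply/H10P; split => // eps e0.
have sLg := L2_graph_subspace; have fE := energy_form.
have [v Hv wv] := app (eps / 4) ltac:(lra).
have [H1v /(_ (eps / 4) ltac:(lra))[phi tphi vphi]] := (H10P v).1 Hv.
exists phi => //.
have L1 := subspaceB sLg (H1_L2 Hw) (H1_L2 H1v).
have L2' := subspaceB sLg (H1_L2 H1v) (test_graph_L2 tphi).
have := form_sqrD_le sLg fE L1 L2'; rewrite addrA subrK => h.
exact: (le_lt_trans h (lt_two_quarters wv vphi)).
Qed.

Lemma H10_subspace : subspace (H10_graph Om).
Proof.
have sLg := L2_graph_subspace; have fE := energy_form.
have [H0 HD] := H1_subspace.
split.
  apply/H10P; split => // eps e0; exists 0; first exact: test0.
  have -> : test_graph 0 = 0.
    by congr (_, (_, _)); apply/funext => x; exact: derive_cst.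
  rewrite subrr (linear_on0 sLg (form_linl fE _))//; exact: (H1_L2 H0).
move=> k w v /H10P[Hw aw] /H10P[Hv av]; apply/H10P; split; first exact: HD.
move=> eps e0; have [phi tphi wphi] := aw (eps / (4 * (k ^+ 2 + 1)))
  ltac:(apply: divr_gt0 => //; apply: mulr_gt0 => //; apply: ltr_wpDl => //; exact: sqr_ge0).
have [psi tpsi vpsi] := av (eps / 4) ltac:(lra).
exists (k *: phi + psi); first exact: test_linear.
rewrite test_graph_linear// opprD addrACA -scalerN -scalerDr.
have L1 := subspaceB sLg (H1_L2 Hw) (test_graph_L2 tphi).
have L2' := subspaceB sLg (H1_L2 Hv) (test_graph_L2 tpsi).
have h := form_sqrD_le sLg fE (subspaceZ k sLg L1) L2'.
apply: (le_lt_trans h); rewrite (form_sqrZ sLg fE)//.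
apply: lt_two_quarters vpsi.
exact: scaled_lt (form_ge0 fE L1) wphi.
Qed.

End domain.
End sobolev.

(** * Completeness of the form domain of the Dirichlet Laplacian *)

Section sobolev_completeness.
Context {R : realType}.
Local Notation plane := (measurableTypeR R * measurableTypeR R)%type.
Local Notation mu2 := (@lebesgue2 R).
Local Notation field := (R * R -> R).
Variable Om : set plane.
Hypotheses (mOm : measurable Om) (fOm : (mu2 Om < +oo)%E).

Let sL := L2_subspace mOm.
Let fI := inner_form mOm.

Let small_square (x y p q eps : R) : 0 <= p -> 0 <= q -> 0 < eps ->
  x ^+ 2 <= eps / (4 * (p + q + 1)) * p -> y ^+ 2 <= eps / (4 * (p + q + 1)) * q ->
  (x + y) ^+ 2 <= eps.
Proof.
move=> p0 q0 e0; have k0 : 0 < p + q + 1 by lra.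
set k := eps / _ => xp yq.
have kk : k * (p + q + 1) = eps / 4 by rewrite /k; field; rewrite gt_eqF.
have := sqr_ge0 (x - y); rewrite sqrrB sqrrD.
have k00 : 0 < k by apply: divr_gt0 => //; apply: mulr_gt0.
by move: kk; rewrite !mulrDr mulr1; lra.
Qed.

(** The defect in the integration by parts identity is linear in the pair and vanishes for the
    approximants, so Cauchy-Schwarz bounds it by their distance to the limit. *)
Lemma weak_derivative_limit e (u g : field) :
  (forall phi, test_function Om phi -> test_function Om (fun x => 'D_e phi x)) ->
  L2 Om u -> L2 Om g ->
  (forall eps, 0 < eps -> exists u' g', [/\ L2 Om u', L2 Om g', weak_derivative Om e u' g',
     inner Om (u' - u) (u' - u) < eps & inner Om (g' - g) (g' - g) < eps]) ->
  weak_derivative Om e u g.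
Proof.
move=> te Lu Lg app phi tphi.
have Lphi := test_L2 mOm fOm tphi; have Ld := test_L2 mOm fOm (te _ tphi).
rewrite -[LHS]/(inner Om u (fun x => 'D_e phi x)) -[RHS]/(- inner Om g phi).
have fl := form_linl fI Lphi; have fd := form_linl fI Ld.
set psi := (fun x => 'D_e phi x) in Ld fd *.
have p0 := form_ge0 fI Lphi; have q0 := form_ge0 fI Ld.
suff : forall eps, 0 < eps -> (inner Om u psi + inner Om g phi) ^+ 2 <= eps.
  move=> small; apply/eqP; rewrite -addr_eq0 -[_ == 0](@expf_eq0 _ _ 2) eq_le sqr_ge0 andbT.
  by apply/ler_addgt0Pl => eps e0; rewrite addr0; exact: small.
move=> eps e0.
have k0 : 0 < eps / (4 * (inner Om psi psi + inner Om phi phi + 1)).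
  by apply: divr_gt0 => //; apply: mulr_gt0 => //; apply: ltr_wpDl => //; exact: addr_ge0.
have [u' [g' [Lu' Lg' wu' uu' gg']]] := app _ k0.
have w : inner Om u' psi = - inner Om g' phi by exact: wu'.
have -> : inner Om u psi + inner Om g phi = - (inner Om (u' - u) psi + inner Om (g' - g) phi).
  rewrite (linear_onB sL fd Lu' Lu) (linear_onB sL fl Lg' Lg) w opprD !opprB.
  by move: (inner Om u psi) (inner Om g phi) (inner Om g' phi) => x y z; ring.
rewrite sqrrN; apply: (small_square q0 p0 e0).
  apply: (le_trans (form_cauchy_schwarz sL fI (subspaceB sL Lu' Lu) Ld)).
  by apply: ler_wpM2r => //; exact: ltW.
apply: (le_trans (form_cauchy_schwarz sL fI (subspaceB sL Lg' Lg) Lphi)).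
by apply: ler_wpM2r => //; exact: ltW.
Qed.

Lemma graph_sub1 (w v : @graph R) : (w - v).1 = w.1 - v.1.
Proof. by case: w; case: v. Qed.

Lemma graph_sub21 (w v : @graph R) : (w - v).2.1 = w.2.1 - v.2.1.
Proof. by case: w => ? []; case: v => ? []. Qed.

Lemma graph_sub22 (w v : @graph R) : (w - v).2.2 = w.2.2 - v.2.2.
Proof. by case: w => ? []; case: v => ? []. Qed.

Lemma le_energy w : L2_graph Om w -> [/\ inner Om w.1 w.1 <= energy Om w w,
  inner Om w.2.1 w.2.1 <= energy Om w w & inner Om w.2.2 w.2.2 <= energy Om w w].
Proof.
move=> [/(form_ge0 fI) h1 /(form_ge0 fI) h2 /(form_ge0 fI) h3].
rewrite /energy /dirichlet /mass; split.
- by rewrite lerDr addr_ge0.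
- by rewrite -addrA lerDl addr_ge0.
- by rewrite addrAC lerDr addr_ge0.
Qed.

(** The hypothesis has the shape that [ground_state] provides; consecutive increments give an L^2
    limit of the function and of each gradient component. *)
Lemma H10_complete (u : nat -> @graph R) K : (forall n, H10_graph Om (u n)) ->
  (forall m n, (m <= n)%N -> energy Om (u n - u m) (u n - u m) <= K * 4^-1 ^+ m) ->
  exists2 v, H10_graph Om v & forall e, 0 < e -> exists N, forall n, (N <= n)%N ->
    energy Om (u n - v) (u n - v) < e.
Proof.
move=> Hu cauchy; have sLg := L2_graph_subspace mOm.
have H1u n : H1_graph Om (u n) by case: (Hu n).
have Lu n : L2_graph Om (u n) := H1_L2 (H1u n).
have Ld n := le_energy (subspaceB sLg (Lu n.+1) (Lu n)).
have step n := cauchy n n.+1 (leqnSn n).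
have L1 n : L2 Om (u n).1 by case: (Lu n).
have L21 n : L2 Om (u n).2.1 by case: (Lu n).
have L22 n : L2 Om (u n).2.2 by case: (Lu n).
have [v1 Lv1 v1P] := @L2_complete R Om (fun n => (u n).1) K mOm L1 (fun n => ltac:(
  have [h _ _] := Ld n; rewrite graph_sub1 in h; exact: (le_trans h (step n)))).
have [v2 Lv2 v2P] := @L2_complete R Om (fun n => (u n).2.1) K mOm L21 (fun n => ltac:(
  have [_ h _] := Ld n; rewrite graph_sub21 in h; exact: (le_trans h (step n)))).
have [v3 Lv3 v3P] := @L2_complete R Om (fun n => (u n).2.2) K mOm L22 (fun n => ltac:(
  have [_ _ h] := Ld n; rewrite graph_sub22 in h; exact: (le_trans h (step n)))).
pose v : @graph R := (v1, (v2, v3)).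
have Lv : L2_graph Om v by split.
have lim e : 0 < e -> exists N, forall n, (N <= n)%N -> energy Om (u n - v) (u n - v) < e.
  move=> e0.
  have : (12 * K) * 2^-1 ^+ n @[n --> \oo] --> (0 : R).
    rewrite -[X in _ --> X](mulr0 (12 * K)); apply: cvgMr.
    by apply: cvg_expr; rewrite ger0_norm; lra.
  move=> /cvgrPdist_lt /(_ e e0) [N _ NP]; exists N => n Nn.
  have := NP n Nn; rewrite sub0r normrN /= => h.
  apply: (le_lt_trans _ h); apply: le_trans (ler_norm _).
  rewrite /energy /dirichlet /mass graph_sub1 graph_sub21 graph_sub22.
  apply: (le_trans (lerD (lerD (v2P n) (v3P n)) (v1P n))).
  rewrite le_eqVlt; apply/orP; left; apply/eqP; ring.
have Hv : H1_graph Om v.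
  split => //.
  - apply: weak_derivative_limit => // [phi|eps e0]; first exact: test_derive1.
    have [N /(_ N (leqnn N)) NP] := lim eps e0; have [_ _ _ w1 _] := H1u N.
    have [h1 h2 _] := le_energy (subspaceB sLg (Lu N) Lv).
    rewrite graph_sub1 in h1; rewrite graph_sub21 in h2.
    by exists (u N).1, (u N).2.1; split => //; [exact: le_lt_trans h1 NP|exact: le_lt_trans h2 NP].
  - apply: weak_derivative_limit => // [phi|eps e0]; first exact: test_derive2.
    have [N /(_ N (leqnn N)) NP] := lim eps e0; have [_ _ _ _ w1] := H1u N.
    have [h1 _ h2] := le_energy (subspaceB sLg (Lu N) Lv).
    rewrite graph_sub1 in h1; rewrite graph_sub22 in h2.
    by exists (u N).1, (u N).2.2; split => //; [exact: le_lt_trans h1 NP|exact: le_lt_trans h2 NP].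
exists v => //; apply: H10_close => // eps e0.
have [N /(_ N (leqnn N)) NP] := lim eps e0; exists (u N) => //.
rewrite -(opprB (u N)) -scaleN1r (form_sqrZ sLg (energy_form mOm)).
  by rewrite sqrrN expr1n mul1r.
exact: subspaceB.
Qed.

End sobolev_completeness.

(** * Counting eigenvalues with multiplicity *)

Section counting.
Context {R : realType}.
Local Notation plane := (measurableTypeR R * measurableTypeR R)%type.
Local Notation mu2 := (@lebesgue2 R).
Local Notation field := (R * R -> R).
Local Notation graph := (@graph R).
Variable Om : set plane.
Hypothesis mOm : measurable Om.

Let sLg := L2_graph_subspace mOm.
Let fM := mass_form mOm.

Lemma inner_eq0 (u : field) : L2 Om u ->
  inner Om u u = 0 <-> {ae mu2, forall x, Om x -> u x = 0}.
Proof.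
move=> Lu; have mu : @measurable_fun _ _ plane R Om u := L2_measurable Lu.
have msq : measurable_fun Om (fun x => (u x ^+ 2)%:E).
  by apply/measurable_EFinP; exact: measurable_funX.
have H := ae_eq_integral_abs mu2 mOm msq.
have E : (\int[mu2]_(x in Om) `|(u x ^+ 2)%:E|)%E = (inner Om u u)%:E.
  rewrite -(inner_EFin mOm Lu); apply: eq_integral => x _.
  by rewrite gee0_abs// lee_fin sqr_ge0.
rewrite E in H; split.
- move=> u0; rewrite u0 in H; have := H.1 erefl.
  apply: filterS => x h Ox; have := h Ox => -[/eqP].
  by rewrite sqrf_eq0 => /eqP.
- move=> u0; suff /H.2 [] : ae_eq mu2 Om (fun x => (u x ^+ 2)%:E) (cst 0%E) by [].
  by move: u0; apply: filterS => x h Ox; rewrite h// expr0n.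
Qed.

Lemma dirichletE (w v : graph) : L2_graph Om w -> L2_graph Om v ->
  \int[mu2]_(x in Om) (w.2.1 x * v.2.1 x + w.2.2 x * v.2.2 x) = dirichlet Om w v.
Proof.
move=> [_ w2 w3] [_ v2 v3]; apply: RintegralD => //; exact: L2_integrable.
Qed.

Section domain.
Variable dom : field -> field -> field -> Prop.
Local Notation D := [set w : graph | dom w.1 w.2.1 w.2.2].
Hypothesis DL : D `<=` L2_graph Om.

Lemma eigenspaceP t (u : field) : Defs.eigenspace Om dom t u <->
  exists w : graph, [/\ w.1 = u, D w & forall v, D v -> dirichlet Om w v = t * mass Om w v].
Proof.
split=> [[g1 [g2 [Du eu]]]|[[u' [g1 g2]] [/= <- Du eu]]].
- exists (u, (g1, g2)); split => // -[v [h1 h2]] Dv.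
  by rewrite -dirichletE; [exact: eu Dv|exact: DL|exact: DL].
- exists g1, g2; split => // v h1 h2 Dv.
  have Dv' : D (v, (h1, h2)) by [].
  by have := eu _ Dv'; rewrite -dirichletE; [|exact: DL|exact: DL].
Qed.

Lemma eigenvalue_count_ge1 t (w : graph) : D w ->
  (forall v, D v -> dirichlet Om w v = t * mass Om w v) -> 0 < mass Om w w ->
  (1%:E <= eigenvalue_count Om dom t)%E.
Proof.
move=> Dw ew w0; apply: (@le_trans _ _ (multiplicity Om dom t)).
  apply: ereal_sup_ubound; exists 1%N => //=.
  exists (fun=> w.1); split => [_|c c0 i].
    by apply/eigenspaceP; exists w.
  apply/eqP; apply: contraT => ci.
  have [Lw _ _] := DL Dw.
  suff : inner Om w.1 w.1 = 0 by move=> e; move: w0; rewrite /mass e ltxx.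
  apply: (inner_eq0 Lw).2; move: c0; apply: (@filterS _ _ (ae_filter_ringOfSetsType mu2)) => x h Ox.
  have := h Ox; rewrite big_ord1 => /eqP.
  by rewrite (ord1 i) in ci; rewrite mulf_eq0 (negbTE ci) => /eqP.
apply: ereal_sup_ubound; exists [set t]; last by rewrite fsbig_set1.
by split; [exact: finite_set1|move=> _ ->; rewrite /= lexx].
Qed.

Section gap.
Variables (M : nat) (l : 'I_M -> graph -> R) (C : R).
Hypotheses (sD : subspace D) (C0 : 0 <= C) (ll : forall j, linear_on D (l j)).
Hypothesis gap : forall w, D w -> (forall j, l j w = 0) -> mass Om w w <= C * dirichlet Om w w.

(** With more than [M] eigenfunctions some nontrivial combination annihilates all functionals.
    Grouped by eigenvalue, its parts are null by [eigenvectors_dependent], against independence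
    within a group. *)
Lemma eigenfamily_size (I : finType) (t : I -> R) (n : I -> nat)
    (u : forall i, 'I_(n i) -> field) : injective t -> (forall i, C * t i < 1) ->
  (forall i k, Defs.eigenspace Om dom (t i) (u i k)) ->
  (forall i, ae_linearly_independent Om (u i)) -> (\sum_i n i <= M)%N.
Proof.
move=> tinj Ct eu iu; rewrite leqNgt; apply/negP => Mn.
pose J := {i : I & 'I_(n i)}.
pose tg i (k : 'I_(n i)) : J := Tagged (fun i => 'I_(n i)) k.
have MJ : (M < #|{: J}|)%N.
  rewrite -sum1_card -(@sig_big_dep _ _ _ I (fun i => 'I_(n i)) xpredT (fun _ => xpredT) (fun _ _ => 1%N)) /=.
  by under eq_bigr do rewrite sum1_card card_ord.
have /choice[W WP] : forall p : J, exists w : graph, [/\ w.1 = u (tag p) (tagged p), D w &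
    forall v, D v -> dirichlet Om w v = t (tag p) * mass Om w v].
  by move=> p; apply/eigenspaceP; exact: eu.
have DW p : D (W p) by case: (WP p).
have [c [[p0 cp0] cl]] := nontrivial_relation (fun p => l ^~ (W p)) MJ.
pose w i := \sum_(k < n i) c (tg i k) *: W (tg i k).
have Dc p : D (c p *: W p) by apply: subspaceZ.
have Dw i : D (w i) by apply: (subspace_sum sD) => k.
have sumw : \sum_i w i = \sum_p c p *: W p.
  by rewrite (@sig_big_dep _ _ _ I (fun i => 'I_(n i)) xpredT (fun _ => xpredT) (fun i k => c (tg i k) *: W (tg i k)))/=; apply: eq_bigr => -[].
have aD := psd_formS DL (dirichlet_form mOm); have bD := psd_formS DL fM.
have ew i v : D v -> dirichlet Om (w i) v = t i * mass Om (w i) v.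
  move=> Dv; rewrite (linear_on_sum sD (form_linl aD Dv))//.
  rewrite (linear_on_sum sD (form_linl bD Dv))// mulr_sumr; apply: eq_bigr => k _.
  rewrite (linear_onZ sD (form_linl aD Dv))// (linear_onZ sD (form_linl bD Dv))//.
  by have [_ _ ->//] := WP (tg _ k); rewrite mulrCA.
have lw j : l j (\sum_i w i) = 0.
  rewrite sumw (linear_on_sum sD (ll j))// -[RHS](cl j); apply: eq_bigr => p _.
  by rewrite (linear_onZ sD (ll j)).
have w0 := eigenvectors_dependent sD aD bD Dw tinj C0 Ct ew (gap (subspace_sum sD Dw) lw) (tag p0).
have [Lw _ _] := DL (Dw (tag p0)).
have wu : (w (tag p0)).1 = \sum_(k < n (tag p0)) c (tg _ k) *: u (tag p0) k.
  rewrite /w (big_morph (fun w : graph => w.1) (id1 := 0) (op1 := +%R))//; apply: eq_bigr => k _.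
  by have [<- _ _] := WP (tg _ k).
have z := (inner_eq0 Lw).1 w0.
have := iu (tag p0) (fun k => c (tg _ k)) _ (tagged p0).
have -> : tg (tag p0) (tagged p0) = p0 by exact: taggedK.
move=> c0; move: cp0; rewrite c0 ?eqxx//.
move: z; apply: filterS => x h Ox; rewrite -[RHS](h Ox) wu fct_sumE.
by apply: eq_bigr => k _.
Qed.

(** A bounded supremum of naturals is attained, so an independent family of maximal size can be
    chosen for each eigenvalue. *)
Lemma multiplicity_nat t : C * t < 1 -> exists m : nat, multiplicity Om dom t = m%:R%:E /\
  exists u : 'I_m -> field,
      (forall i, Defs.eigenspace Om dom t (u i)) /\ ae_linearly_independent Om u.
Proof.
move=> Ct; pose P n := `[< exists u : 'I_n -> field,
      (forall i, Defs.eigenspace Om dom t (u i)) /\ ae_linearly_independent Om u >].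
have bP n : P n -> (n <= M)%N.
  move=> /asboolP[u [eu iu]].
  have := @eigenfamily_size unit (fun=> t) (fun=> n) (fun=> u) _ (fun=> Ct) (fun=> eu) (fun=> iu).
  by rewrite big_const card_unit /= addn0; apply => -[] [].
have P0 : exists n, P n.
  exists 0%N; apply/asboolP; exists (fun=> 0).
  by split => [[]|c _ []].
have /asboolP Pm := ex_maxnP P0 bP; case: ex_maxnP Pm => m /asboolP Pm mmax _.
exists m; split => //; apply/eqP; rewrite eq_le; apply/andP; split.
  apply: ge_ereal_sup => _ [n /asboolP Pn <-]; rewrite lee_fin ler_nat; exact: mmax.
by apply: ereal_sup_ubound; exists m.
Qed.

(** The count is a supremum over finite sets of values; on each of them the maximal families
    together form one input to [eigenfamily_size]. *)
Lemma eigenvalue_count_le t : C * t < 1 -> (eigenvalue_count Om dom t <= M%:R%:E)%E.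
Proof.
move=> Ct; apply: ge_ereal_sup => _ [A [fA At] <-].
have CA s : A s -> C * s < 1.
  by move=> /At /= st; apply: le_lt_trans Ct; apply: ler_wpM2l.
rewrite fsbig_finite//; set r := finmap.enum_fset (fset_set A).
have rA s : s \in r -> A s by rewrite /r => h; apply/set_mem; rewrite -in_fset_set.
have ur : uniq r by exact: finmap.fset_uniq.
rewrite big_tnth; pose s i := tnth (in_tuple r) i.
have sA i : C * s i < 1 by apply/CA/rA; exact: mem_tnth.
have /choice[m mP] : forall i, exists m : nat, multiplicity Om dom (s i) = m%:R%:E /\
  exists u : 'I_m -> field,
      (forall k, Defs.eigenspace Om dom (s i) (u k)) /\ ae_linearly_independent Om u.
  by move=> i; exact: multiplicity_nat.
pose u i := projT1 (cid (mP i).2).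
have uP i := projT2 (cid (mP i).2).
have -> : (\sum_(i < size r) multiplicity Om dom (s i) = (\sum_i m i)%N%:R%:E)%E.
  rewrite natr_sum -sumEFin; apply: eq_bigr => i _; by case: (mP i).
rewrite lee_fin ler_nat; apply: (@eigenfamily_size _ s m u) => //.
- move=> i j; rewrite /s !(tnth_nth 0) /= => /eqP; rewrite nth_uniq// => /eqP; exact: val_inj.
- by move=> i; case: (uP i).
- by move=> i; case: (uP i).
Qed.

End gap.
End domain.

Lemma neumann_count_le (M : nat) (C t : R) : 0 <= C -> C * t < 1 ->
  (forall s, C * s < 1 -> (eigenvalue_count Om (H1 Om) s <= M%:R%:E)%E) ->
  (1%:E <= eigenvalue_count Om (H10 Om) t)%E ->
  (neumann_count Om <= M%:R%:E)%E.
Proof.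
move=> C0 Ct cM c1.
have lam : (dirichlet_eigenvalue Om 1 <= t%:E)%E.
  by apply: ge_ereal_inf; exists t%:E => //; exists t.
(* An eigenvalue is defined as an infimum, which gives values [s] with enough eigenvalues only
   strictly above it; [t'] makes room above [t] while keeping [C * t' < 1]. *)
pose t' := t + (1 - C * t) / (2 * (C + 1)).
have tt' : t < t'.
  rewrite ltrDl; apply: divr_gt0; first by rewrite subr_gt0.
  by apply: mulr_gt0 => //; exact: ltr_wpDl.
have Ct' : C * t' < 1.
  rewrite -subr_gt0; have C1 : 0 < C + 1 by exact: ltr_wpDl.
  have -> : 1 - C * t' = (1 - C * t) * ((C + 2) / (2 * (C + 1))).
    by rewrite /t'; field; rewrite gt_eqF.
  apply: mulr_gt0; first by rewrite subr_gt0.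
  by apply: divr_gt0; [lra|exact: mulr_gt0].
have jM j : (neumann_eigenvalue Om j <= dirichlet_eigenvalue Om 1)%E -> (j <= M)%N.
  move=> h; have : (neumann_eigenvalue Om j < t'%:E)%E.
    by apply: le_lt_trans (le_trans h lam) _; rewrite lte_fin.
  move=> /ereal_inf_lt[_ [s js <-]]; rewrite lte_fin => st.
  have := le_trans js (cM s (le_lt_trans (ler_wpM2l C0 (ltW st)) Ct')).
  by rewrite lee_fin ler_nat.
rewrite /neumann_count; set A := [set _ | _].
have sub : A `<=` [set` iota 1 M].
  by move=> j [j1 /jM jM']; rewrite /= mem_iota add1n j1 ltnS.
have fA : finite_set A by apply: sub_finite_set sub _; exact: finite_seq.
rewrite /counting asboolT// lee_fin ler_nat -[leqRHS](size_iota 1).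
apply: uniq_leq_size; first exact: finmap.fset_uniq.
by move=> j; rewrite in_fset_set// => /set_mem /sub.
Qed.

End counting.

(** * Tensor products of test functions belong to [H10] *)

Section tensor_graph.
Context {R : realType}.
Local Notation plane := (measurableTypeR R * measurableTypeR R)%type.
Local Notation mu2 := (@lebesgue2 R).
Local Notation mu := (@lebesgue_measure R).

Lemma integral_derive_supported (a b : R) (F f : R -> R) : a < b ->
  (forall x : R, is_derive x 1 F (f x)) -> continuous f -> supported a b F -> supported a b f ->
  (\int[mu]_x (f x)%:E = 0)%E.
Proof.
move=> ab Ff cf sF sf.
have -> : (\int[mu]_x (f x)%:E = (\int[mu]_x f x)%:E)%E.
  by rewrite /Rintegral fineK//; apply: integrable_fin_num => //; exact: supported_integrable sf.
rewrite -(Rintegral_supported sf (A := `[a, b]%classic))// (Rintegral_derive ab Ff cf).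
by rewrite (supported_out sF (x := a)) ?lexx// (supported_out sF (x := b)) ?lexx ?orbT// subr0.
Qed.

Lemma inner_sym (D : set plane) (u v : R * R -> R) : inner D u v = inner D v u.
Proof. by apply: eq_Rintegral => x _; rewrite mulrC. Qed.

Section box.
Variables (x0 x1 y0 y1 : R).
Hypotheses (x01 : x0 < x1) (y01 : y0 < y1).
Local Notation Q := (box x0 x1 y0 y1 : set plane).
Let mQ := measurable_box x0 x1 y0 y1.
Let fQ := box_finite x0 x1 y0 y1.

Let box_integrable (f : R * R -> R) M : continuous f -> (forall p, `|f p| <= M) ->
  (forall p, ~ Q p -> f p = 0) -> mu2.-integrable setT (EFin \o f).
Proof.
move=> cf fM f0.
have iQ : mu2.-integrable Q (EFin \o f).
  apply: measurable_bounded_integrable => //; first exact: continuous_measurable_plane.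
  exists M; split; first exact: num_real.
  by move=> t Mt p _; apply: le_trans (fM p) _; exact: ltW.
have := iQ; rewrite integrable_mkcond//; congr (_.-integrable _ _).
apply/funext => p; rewrite /patch; case: ifPn => //; rewrite notin_setE => nQ.
by rewrite /= f0.
Qed.

Lemma slices_zero1 (f : R * R -> R) M : continuous f -> (forall p, `|f p| <= M) ->
  (forall p, ~ Q p -> f p = 0) ->
  (forall y, \int[mu]_x (f (x, y))%:E = 0)%E -> \int[mu2]_(p in Q) f p = 0.
Proof.
move=> cf fM f0 sl; have iT := box_integrable cf fM f0.
rewrite /Rintegral (integral_box_setT f0).
rewrite -[X in fine X](@integral21_prod_meas1 _ _ _ _ R mu mu _ iT).
rewrite (eq_integral (cst 0%E)); first by rewrite integral0.
by move=> y _; exact: sl.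
Qed.

Lemma slices_zero2 (f : R * R -> R) M : continuous f -> (forall p, `|f p| <= M) ->
  (forall p, ~ Q p -> f p = 0) ->
  (forall x, \int[mu]_y (f (x, y))%:E = 0)%E -> \int[mu2]_(p in Q) f p = 0.
Proof.
move=> cf fM f0 sl; have iT := box_integrable cf fM f0.
rewrite /Rintegral (integral_box_setT f0).
rewrite -[X in fine X](@integral12_prod_meas1 _ _ _ _ R mu mu _ iT).
rewrite (eq_integral (cst 0%E)); first by rewrite integral0.
by move=> x _; exact: sl.
Qed.

Variables (Om : set plane) (psi : R * R -> R) (a a' b b' : R -> R).
Hypotheses (QOm : Q `<=` Om) (tpsi : test_function Om psi).
Hypotheses (ta : test1 x0 x1 a) (ta' : test1 x0 x1 a') (da : forall x : R, is_derive x 1 a (a' x)).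
Hypotheses (tb : test1 y0 y1 b) (tb' : test1 y0 y1 b') (db : forall x : R, is_derive x 1 b (b' x)).

Let by_parts (f g dpsi : R * R -> R) :
  L2 Q f -> L2 Q g -> L2 Q psi -> L2 Q dpsi ->
  (forall p, ~ Q p -> f p = 0) -> (forall p, ~ Q p -> g p = 0) ->
  \int[mu2]_(p in Q) (f p * dpsi p + g p * psi p) = 0 ->
  inner Om f dpsi = - inner Om g psi.
Proof.
move=> Lf Lg Lp Ld f0 g0; rewrite RintegralD//; try exact: L2_integrable.
move=> /eqP; rewrite addr_eq0 => /eqP h.
rewrite inner_sym (inner_restrict _ QOm f0) inner_sym [in RHS]inner_sym.
by rewrite (inner_restrict _ QOm g0) [in RHS]inner_sym; exact: h.
Qed.

Let psi_continuous : continuous psi. Proof. by have [/(_ 0%N)] := tpsi. Qed.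

Let continuous_slices (f : R * R -> R) : continuous f ->
  (forall y, continuous (fun x => f (x, y))) /\ (forall x, continuous (fun y => f (x, y))).
Proof.
move=> cf; have fE : (fun p : R * R => f (p.1, p.2)) = f by apply/funext => -[].
split=> z t.
- apply: (@cvg_comp2 _ _ _ _ (nbhs t) (nbhs t) (nbhs z) _ _ _ _ id (fun=> z) (fun x y => f (x, y))).
  + exact: cvg_id.
  + exact: cvg_cst.
  + by rewrite fE; exact: (cf (t, z)).
- apply: (@cvg_comp2 _ _ _ _ (nbhs t) (nbhs z) (nbhs t) _ _ _ _ (fun=> z) id (fun x y => f (x, y))).
  + exact: cvg_cst.
  + exact: cvg_id.
  + by rewrite fE; exact: (cf (z, t)).
Qed.

Let product_bounded (f g : R * R -> R) : (exists M, forall x, `|f x| <= M) ->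
  (exists M, forall x, `|g x| <= M) -> exists M, forall x, `|f x * g x| <= M.
Proof.
move=> [M fM] [K gK]; exists (M * K) => x; rewrite normrM; exact: ler_pM.
Qed.

Let tensor_bounded (c d : R -> R) : test1 x0 x1 c -> test1 y0 y1 d ->
  exists M, forall p, `|tensor c d p| <= M.
Proof.
move=> tc td; have [M _ cM] := test1_bounded tc; have [K _ dK] := test1_bounded td.
by exists (M * K) => p; rewrite normrM; exact: ler_pM.
Qed.

(** On every horizontal line the integrand is the derivative of a product compactly supported
    through the factor [a], so each slice integrates to 0. *)
Lemma tensor_weak1 :
  inner Om (tensor a b) (fun p => 'D_e1 psi p) = - inner Om (tensor a' b) psi.
Proof.
have td := test_derive1 tpsi; have cd : continuous (fun p => 'D_e1 psi p) by have [/(_ 0%N)] := td.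
have ca := smooth_continuous ta.1; have ca' := smooth_continuous ta'.1.
have cb := smooth_continuous tb.1.
apply: by_parts.
- exact: (tensor_L2 mQ fQ ta tb).
- exact: (tensor_L2 mQ fQ ta' tb).
- exact: test_L2 tpsi.
- exact: test_L2 td.
- by move=> p; exact: tensor_out.
- by move=> p; exact: tensor_out.
have [M1 h1] := product_bounded (tensor_bounded ta tb) (test_bounded td).
have [M2 h2] := product_bounded (tensor_bounded ta' tb) (test_bounded tpsi).
have cF : continuous (fun p => tensor a b p * 'D_e1 psi p + tensor a' b p * psi p).
  move=> p; apply: cvgD; apply: cvgM;
    [exact: continuous_tensor|exact: cd|exact: continuous_tensor|exact: psi_continuous].
apply: (slices_zero1 (M := M1 + M2) cF).
- by move=> p; apply: le_trans (ler_normD _ _) _; exact: lerD.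
- by move=> p nQ; rewrite (tensor_out ta tb nQ) (tensor_out ta' tb nQ) !mul0r addr0.
move=> y.
apply: (integral_derive_supported x01 (F := fun x => (b y * psi (x, y)) * a x)).
- move=> x; have [d1 _] := test_derivable tpsi.
  have dpsi : is_derive x 1 (fun s => psi (s, y)) ('D_e1 psi (x, y)).
    by apply/(is_derive_e1 psi (x, y)); split.
  apply: (is_derive_eq (is_deriveM (is_deriveZ (b y) dpsi) (da x))).
  by rewrite /tensor /= /GRing.scale /=; ring.
- exact: ((continuous_slices cF).1 y).
- by apply: supportedZ; exact: ta.2.
- apply: (supportedD (f := fun x => tensor a b (x, y) * 'D_e1 psi (x, y))).
    rewrite (_ : (fun x => _) = (fun x => (b y * 'D_e1 psi (x, y)) * a x)).
      by apply: supportedZ; exact: ta.2.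
    by apply/funext => x; rewrite /tensor /=; ring.
  rewrite (_ : (fun x => _) = (fun x => (b y * psi (x, y)) * a' x)).
    by apply: supportedZ; exact: ta'.2.
  by apply/funext => x; rewrite /tensor /=; ring.
Qed.

Lemma tensor_weak2 :
  inner Om (tensor a b) (fun p => 'D_e2 psi p) = - inner Om (tensor a b') psi.
Proof.
have td := test_derive2 tpsi; have cd : continuous (fun p => 'D_e2 psi p) by have [/(_ 0%N)] := td.
have ca := smooth_continuous ta.1; have cb' := smooth_continuous tb'.1.
have cb := smooth_continuous tb.1.
apply: by_parts.
- exact: (tensor_L2 mQ fQ ta tb).
- exact: (tensor_L2 mQ fQ ta tb').
- exact: test_L2 tpsi.
- exact: test_L2 td.
- by move=> p; exact: tensor_out.
- by move=> p; exact: tensor_out.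
have [M1 h1] := product_bounded (tensor_bounded ta tb) (test_bounded td).
have [M2 h2] := product_bounded (tensor_bounded ta tb') (test_bounded tpsi).
have cF : continuous (fun p => tensor a b p * 'D_e2 psi p + tensor a b' p * psi p).
  move=> p; apply: cvgD; apply: cvgM;
    [exact: continuous_tensor|exact: cd|exact: continuous_tensor|exact: psi_continuous].
apply: (slices_zero2 (M := M1 + M2) cF).
- by move=> p; apply: le_trans (ler_normD _ _) _; exact: lerD.
- by move=> p nQ; rewrite (tensor_out ta tb nQ) (tensor_out ta tb' nQ) !mul0r addr0.
move=> x.
apply: (integral_derive_supported y01 (F := fun y => (a x * psi (x, y)) * b y)).
- move=> y; have [_ d2] := test_derivable tpsi.
  have dpsi : is_derive y 1 (fun s => psi (x, s)) ('D_e2 psi (x, y)).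
    by apply/(is_derive_e2 psi (x, y)); split.
  apply: (is_derive_eq (is_deriveM (is_deriveZ (a x) dpsi) (db y))).
  by rewrite /tensor /= /GRing.scale /=; ring.
- exact: ((continuous_slices cF).2 x).
- by apply: supportedZ; exact: tb.2.
- apply: (supportedD (f := fun y => tensor a b (x, y) * 'D_e2 psi (x, y))).
    rewrite (_ : (fun y => _) = (fun y => (a x * 'D_e2 psi (x, y)) * b y)).
      by apply: supportedZ; exact: tb.2.
    by apply/funext => y; rewrite /tensor /=; ring.
  rewrite (_ : (fun y => _) = (fun y => (a x * psi (x, y)) * b' y)).
    by apply: supportedZ; exact: tb'.2.
  by apply/funext => y; rewrite /tensor /=; ring.
Qed.

End box.

Lemma tensor_H10 (Om : set plane) x0 x1 y0 y1 (a a' b b' : R -> R) :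
  measurable Om -> (mu2 Om < +oo)%E -> x0 < x1 -> y0 < y1 -> box x0 x1 y0 y1 `<=` Om ->
  test1 x0 x1 a -> test1 x0 x1 a' -> (forall x : R, is_derive x 1 a (a' x)) ->
  test1 y0 y1 b -> test1 y0 y1 b' -> (forall x : R, is_derive x 1 b (b' x)) ->
  H10_graph Om (tensor a b, (tensor a' b, tensor a b')).
Proof.
move=> mOm fOm x01 y01 QOm ta ta' da tb tb' db.
have tt := test_tensor QOm ta tb.
have E : (tensor a b, (tensor a' b, tensor a b')) = test_graph (tensor a b).
  by rewrite /test_graph (derive_tensor_e1 b da) (derive_tensor_e2 a db).
have HG : H1_graph Om (test_graph (tensor a b)).
  rewrite -E; have L c d : test1 x0 x1 c -> test1 y0 y1 d -> L2 Om (tensor c d).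
    by move=> tc td; exact: (tensor_L2 mOm fOm tc td).
  split; [exact: L|exact: L|exact: L| |] => psi tpsi.
  - exact: (tensor_weak1 x01 QOm tpsi ta ta' da tb).
  - exact: (tensor_weak2 y01 QOm tpsi ta tb tb' db).
rewrite E; apply/H10P => //; split => // eps e0; exists (tensor a b) => //.
have sLg := L2_graph_subspace mOm.
rewrite subrr (linear_on0 sLg (form_linl (energy_form mOm) _))//; by case: sLg.
Qed.

End tensor_graph.

(** * A trial function of small Rayleigh quotient on the square *)

Section trial.
Context {R : realType}.
Local Notation plane := (measurableTypeR R * measurableTypeR R)%type.
Local Notation mu2 := (@lebesgue2 R).
Local Notation mu := (@lebesgue_measure R).
Implicit Types (a b K d S : R).

Let itv_length a b : a <= b -> fine (mu `[a, b]%classic) = b - a.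
Proof.
move=> ab; rewrite lebesgue_measure_itv /= lte_fin; case: ifP => //= h.
by apply/esym/eqP; rewrite subr_eq0 eq_sym eq_le ab leNgt h.
Qed.

Lemma integral_sqr_le a b K f : a <= b -> test1 a b f -> (forall x, `|f x| <= K) ->
  \int[mu]_x f x ^+ 2 <= K ^+ 2 * (b - a).
Proof.
move=> ab tf fK; have tt := test1_sqr tf.
rewrite -(Rintegral_supported tt.2 (A := `[a, b]%classic))//.
apply: (@le_trans _ _ (\int[mu]_(x in `[a, b]) K ^+ 2)).
  apply: le_Rintegral => //.
  - exact: integrableS (test1_integrable tt).
  - by apply: continuous_compact_integrable; [exact: segment_compact|apply: continuous_subspaceT => t; exact: cvg_cst].
  - move=> x _; rewrite -(real_normK (num_real (f x))); apply: lerXn2r => //.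
    by rewrite nnegrE; apply: le_trans (fK x).
by rewrite Rintegral_cst// itv_length.
Qed.

Lemma integral_sqr_ge a b c d f : c <= d -> test1 a b f ->
  (forall x, c <= x <= d -> f x = 1) -> d - c <= \int[mu]_x f x ^+ 2.
Proof.
move=> cd tf f1; have tt := test1_sqr tf.
rewrite -(itv_length cd) -[leLHS]mul1r -(Rintegral_cst mu (measurable_itv _)).
apply: (@le_trans _ _ (\int[mu]_(x in `[c, d]) f x ^+ 2)).
  rewrite le_eqVlt; apply/orP; left; apply/eqP; apply: eq_Rintegral => x.
  by rewrite inE /= in_itv /= => /f1 ->; rewrite expr1n.
apply: le_Rintegral_subset => //; last exact: test1_integrable tt.
by move=> x; exact: sqr_ge0.
Qed.

(** Equal to 1 on the middle half of [0, S], with ramps of width S / 4 at both ends. *)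
Definition trial S (x : R) : R := step_on 0 (S / 4) x - step_on (S - S / 4) S x.
Definition trial' S (x : R) : R := bump 0 (S / 4) x - bump (S - S / 4) S x.

Section trial_bounds.
Variables (S N : R).
Hypotheses (S0 : 0 < S) (N1 : 1 <= N).
Hypothesis bN : forall a b x : R, a < b -> `|bump a b x| <= N / (b - a).

Lemma trial_derive (x : R) : is_derive x 1 (trial S) (trial' S x).
Proof. by apply: is_deriveB; exact: step_on_derive. Qed.

Lemma test1_trial : test1 0 S (trial S).
Proof. by have h := S0; apply: test1_step_diff; lra. Qed.

Lemma test1_trial' : test1 0 S (trial' S).
Proof.
have h := S0; apply: test1B.
  by apply: (test1W (a := 0) (b := S / 4)); [lra|lra|apply: test1_bump; lra].
by apply: (test1W (a := S - S / 4) (b := S)); [lra|lra|apply: test1_bump; lra].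
Qed.

Lemma trial_sqr_ge : S / 2 <= \int[mu]_x trial S x ^+ 2.
Proof.
have h := S0; have cd : S / 4 <= S - S / 4 by lra.
have := @integral_sqr_ge 0 S _ _ _ cd test1_trial.
have -> : S - S / 4 - S / 4 = S / 2 by lra.
apply => x /andP[h1 h2]; rewrite /trial step_on1 ?step_on0 ?subr0//; lra.
Qed.

Lemma trial'_sqr_le : \int[mu]_x trial' S x ^+ 2 <= 64 * N ^+ 2 / S.
Proof.
(* Each of the two bumps lives on an interval of length S / 4 and is bounded by 4 N / S. *)
have h := S0; have b x : `|trial' S x| <= 8 * N / S.
  apply: (le_trans (ler_normB _ _)).
  have h1 := @bN 0 (S / 4) x ltac:(lra); have h2 := @bN (S - S / 4) S x ltac:(lra).
  apply: (le_trans (lerD h1 h2)); rewrite le_eqVlt; apply/orP; left; apply/eqP.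
  by field; rewrite gt_eqF.
apply: (le_trans (integral_sqr_le (ltW S0) test1_trial' b)).
rewrite le_eqVlt; apply/orP; left; apply/eqP; by field; rewrite gt_eqF.
Qed.

Definition trial_graph : @graph R :=
  (tensor (trial S) (trial S), (tensor (trial' S) (trial S), tensor (trial S) (trial' S))).

Variable Om : set plane.
Hypotheses (mOm : measurable Om) (fOm : (mu2 Om < +oo)%E).
Hypothesis SOm : box 0 S 0 S `<=` Om.

Lemma trial_H10 : H10_graph Om trial_graph.
Proof.
by apply: (tensor_H10 mOm fOm S0 S0 SOm test1_trial test1_trial' trial_derive
  test1_trial test1_trial' trial_derive).
Qed.

Let inner_tensor (f g : R -> R) : test1 0 S f -> test1 0 S g ->
  inner Om (tensor f g) (tensor f g) = (\int[mu]_x f x ^+ 2) * \int[mu]_x g x ^+ 2.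
Proof.
move=> tf tg; rewrite (inner_restrict _ SOm); last by move=> p; exact: tensor_out.
rewrite -(tensor_integral (test1_sqr tf) (test1_sqr tg)).
by apply: eq_Rintegral => p _; rewrite /tensor; ring.
Qed.

(** With F and A the integrals of the squared profile and of its squared derivative, the claim is 2
    C A < F. As A <= 64 N^2 / S and F >= S / 2, it follows from 256 C N^2 < S^2. *)
Lemma trial_rayleigh (C : R) : 0 <= C -> 256 * C * N ^+ 2 < S ^+ 2 ->
  0 < mass Om trial_graph trial_graph /\
  C * dirichlet Om trial_graph trial_graph < mass Om trial_graph trial_graph.
Proof.
move=> C0 CS; rewrite /mass /dirichlet /=.
rewrite !inner_tensor; try exact: test1_trial; try exact: test1_trial'.
have h1 := trial_sqr_ge; have h2 := trial'_sqr_le.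
move: h1 h2; move: (\int[mu]_x trial S x ^+ 2) (\int[mu]_x trial' S x ^+ 2) => F A h1 h2.
have h := S0; have F0 : 0 < F by lra.
split; first exact: mulr_gt0.
have -> : C * (A * F + F * A) = (2 * C * A) * F by ring.
rewrite ltr_pM2r//; apply: lt_le_trans h1.
apply: (le_lt_trans (ler_wpM2l _ h2)); first by apply: mulr_ge0.
rewrite -(ltr_pM2r S0).
have -> : 2 * C * (64 * N ^+ 2 / S) * S = 128 * C * N ^+ 2 by field; rewrite gt_eqF.
by move: CS; rewrite expr2; lra.
Qed.

End trial_bounds.
End trial.

(** * The uniform bound on the count *)

Section horn_count.
Context {R : realType}.
Local Notation plane := (measurableTypeR R * measurableTypeR R)%type.
Local Notation mu2 := (@lebesgue2 R).

Lemma horn_sub_box (S n : nat) : (0 < S)%N ->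
  horn S n `<=` box 0 ((S + n)%:R + 1) 0 (S%:R : R).
Proof.
move=> S0; have S1 : 1 <= S%:R :> R by rewrite ler1n.
move=> p [h|[i ni h]]; apply: subset_box h => //.
- by rewrite natr1 ler_nat leqW// leq_addr.
- by rewrite lerD2r ler_nat leq_add2l.
- by apply: le_trans S1; apply: exprn_ile1; lra.
Qed.

Lemma horn_finite (S n : nat) : (0 < S)%N -> (mu2 (horn S n) < +oo)%E.
Proof.
move=> S0; apply: le_lt_trans (box_finite 0 ((S + n)%:R + 1) 0 S%:R).
by apply: le_measure; rewrite ?inE; [exact: measurable_horn|exact: measurable_box|exact: horn_sub_box].
Qed.

Section moments.
Variables (S n : nat) (N : R).
Hypotheses (S0 : (0 < S)%N) (N1 : 1 <= N).
Hypothesis bN : forall a b x : R, a < b -> `|bump a b x| <= N / (b - a).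
Local Notation Om := (horn S n : set plane).
Let mOm := measurable_horn S n : measurable Om.

(** [None] stands for the first tail cell, which is a unit square because its height is 4^0. *)
Definition corner (q : option ('I_S * 'I_S)) : R * R :=
  if q is Some jk then (jk.1%:R, jk.2%:R) else (S%:R, 0).

Local Notation unit_cell q :=
  (box (corner q).1 ((corner q).1 + 1) (corner q).2 ((corner q).2 + 1)).

Lemma unit_cell_horn q : unit_cell q `<=` Om.
Proof.
case: q => [jk|]; first exact: square_cell_horn.
by move=> p h; right; exists 0%N => //; rewrite expr0 addn0; apply: subset_box h; rewrite /= ?add0r.
Qed.

Definition unit_moment q (u : R * R -> R) : R :=
  bump_moment u (corner q).1 ((corner q).1 + 1) (corner q).2 ((corner q).2 + 1).

Let l1 (z : R) : z < z + 1. Proof. by rewrite ltrDl. Qed.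
Let w1 (z : R) : z + 1 - z = 1. Proof. by rewrite addrAC subrr add0r. Qed.

Let LQ q (u : R * R -> R) : L2 Om u -> L2 (unit_cell q) u.
Proof. exact: (L2_subset mOm (measurable_box _ _ _ _) (@unit_cell_horn q)). Qed.

Let Lrho q : L2 (unit_cell q) (tensor (bump (corner q).1 ((corner q).1 + 1))
  (bump (corner q).2 ((corner q).2 + 1))).
Proof.
exact: (tensor_L2 (measurable_box _ _ _ _) (box_finite _ _ _ _) (test1_bump (l1 _)) (test1_bump (l1 _))).
Qed.

Lemma unit_moment_linear q : linear_on (L2 Om) (unit_moment q).
Proof.
move=> k u v Lu Lv.
exact: (form_linl (inner_form (measurable_box _ _ _ _)) (Lrho q) k (LQ q Lu) (LQ q Lv)).
Qed.

(** Cauchy-Schwarz against the product bump, which is at most N^2 on a cell of area 1. *)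
Lemma unit_moment_bound q u : L2 Om u -> unit_moment q u ^+ 2 <= N ^+ 4 * inner Om u u.
Proof.
move=> Lu; have mQ := measurable_box (corner q).1 ((corner q).1 + 1) (corner q).2 ((corner q).2 + 1).
have := form_cauchy_schwarz (L2_subspace mQ) (inner_form mQ) (LQ q Lu) (Lrho q).
rewrite -/(unit_moment q u) => h; apply: (le_trans h).
have G0 := form_ge0 (inner_form mQ) (LQ q Lu).
have h1 := inner_subset mOm mQ (@unit_cell_horn q) Lu.
have h2 := @inner_box_bound _ _ _ _ _ (N ^+ 2) _ (ltW (l1 _)) (ltW (l1 _)) (Lrho q).
rewrite mulrC; apply: ler_pM => //; first exact: (form_ge0 (inner_form mQ) (Lrho q)).
move: h2; rewrite !w1 !mulr1 -exprM; apply => p.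
rewrite normrM expr2; apply: ler_pM => //.
  by have := bN p.1 (l1 (corner q).1); rewrite w1 divr1.
by have := bN p.2 (l1 (corner q).2); rewrite w1 divr1.
Qed.

Lemma horn_gap_moments u g1 g2 : H1 Om u g1 g2 ->
  inner Om u u <= 120 * N ^+ 4 * (inner Om g1 g1 + inner Om g2 g2) +
    4 * \sum_q unit_moment q u ^+ 2.
Proof.
move=> Hu; have := horn_gap S0 N1 bN Hu; congr (_ <= _ + 4 * _).
rewrite [RHS](bigD1 None)//= /unit_moment /= add0r; congr (_ + _).
rewrite (reindex_omap Some id)//= => [|[jk|]//].
by apply: eq_big => [jk|jk _]//; rewrite eqxx.
Qed.

End moments.

Lemma horn_neumann_count : exists S : nat, (0 < S)%N /\ exists M : nat, forall n,
  (neumann_count (horn S n : set (R * R)) <= M%:R%:E)%E.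
Proof.
have [N N1 bN] := @bump_bound R.
pose C : R := 120 * N ^+ 4.
have N0 : 0 <= N by apply: le_trans N1.
have C0 : 0 <= C by apply: mulr_ge0 => //; exact: exprn_ge0.
(* [C] involves [N] alone, so [S] can be taken large in terms of it; the bound on [S] passes to its
   square since [S] is at least 1. *)
pose S := (Num.truncn (256 * C * N ^+ 2)).+1.
have S0 : (0 < S)%N by [].
have SR0 : 0 < S%:R :> R by rewrite ltr0n.
have CS : 256 * C * N ^+ 2 < S%:R ^+ 2.
  apply: (lt_le_trans (truncnS_gt _)).
  by rewrite -/S expr2 ler_peMr ?ler1n// ltW.
exists S; split => //; exists #|{: option ('I_S * 'I_S)}| => n.
pose Om : set plane := horn S n.
have mOm : measurable Om := measurable_horn S n.
have fOm : (mu2 Om < +oo)%E := horn_finite n S0.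
pose l (j : 'I_#|{: option ('I_S * 'I_S)}|) (w : @graph R) := unit_moment (enum_val j) w.1.
have H1L : H1_graph Om `<=` L2_graph Om by move=> w; exact: H1_L2.
have H10L : H10_graph Om `<=` L2_graph Om by move=> w [/H1_L2].
have lin (D : set (@graph R)) j : D `<=` L2_graph Om -> linear_on D (l j).
  move=> DL k u v /DL[Lu _ _] /DL[Lv _ _].
  by rewrite /l graph_linear; exact: (@unit_moment_linear S n (enum_val j) k _ _ Lu Lv).
have gap w : H1_graph Om w ->
    mass Om w w <= C * dirichlet Om w w + 4 * \sum_j l j w ^+ 2.
  move=> Hw; have := horn_gap_moments S0 N1 bN Hw.
  by rewrite (reindex (enum_val : 'I_#|{: option ('I_S * 'I_S)}| -> _))//=; exact/onW_bij/enum_val_bij.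
have SOm : box 0 S%:R 0 S%:R `<=` Om by move=> p h; left.
have [m0 d0] := trial_rayleigh SR0 bN SOm C0 CS.
have sD := H10_subspace mOm fOm.
(* The trial function starts the direct method, and the gap makes it converge; the outcome is a
   Dirichlet eigenvalue [t] with [C * t < 1]. *)
have [t [u [Ct Du mu0 eu]]] := ground_state (l := l) (C1 := 4) (B := N ^+ 4) sD
  (psd_formS H10L (dirichlet_form mOm)) (psd_formS H10L (mass_form mOm))
  (fun j => lin _ j H10L) C0 ltac:(by [])
  (fun j u Du => let: And3 Lu _ _ := H10L _ Du in unit_moment_bound bN (enum_val j) Lu)
  (fun u Du => gap u Du.1) (H10_complete mOm fOm)
  (trial_H10 SR0 mOm fOm SOm) m0 d0.
apply: (@neumann_count_le R Om _ C t C0 Ct).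
  move=> s Cs; apply: (eigenvalue_count_le mOm H1L (l := l) (H1_subspace mOm fOm) C0 _ _ Cs).
    by move=> j; exact: lin.
  move=> w Hw lw; have := gap w Hw; rewrite big1 ?mulr0 ?addr0// => j _.
  by rewrite lw expr0n.
exact: (eigenvalue_count_ge1 mOm H10L Du eu mu0).
Qed.

End horn_count.

(** * Lipschitz graphs from monotone sets, and star-shaped sets *)

Section orthant_graphs.
Context {R : realType}.
Implicit Types (A : set (R * R)) (p q : R * R).

Lemma lipschitz1 (f : R -> R) : (forall t t', f t' <= f t + `|t - t'|) -> lipschitz f.
Proof.
move=> fL; exists 1; split; first exact: num_real.
move=> M M1 [t t'] _ /=; apply: (@le_trans _ _ `|t - t'|); last first.
  by rewrite ler_peMl// ltW.
rewrite ler_norml; have := fL t t'; have := fL t' t; rewrite (distrC t' t) => h1 h2.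
by apply/andP; split; lra.
Qed.

(* In coordinates rotated by 45 degrees an orthant becomes the region above the
   graph of the absolute value, so an open set that is stable under translation
   by an orthant lies above the graph of a function with Lipschitz constant 1. *)
Lemma orthant_graph A (sg ta : R) a b : sg ^+ 2 = 1 -> ta ^+ 2 = 1 -> open A ->
  (forall p q, A p -> 0 <= sg * (q.1 - p.1) -> 0 <= ta * (q.2 - p.2) -> A q) ->
  A a -> ~ A b ->
  exists c s : R, exists gamma : R -> R, [/\ c ^+ 2 + s ^+ 2 = 1, lipschitz gamma &
    forall x, A x <-> gamma (c * x.1 + s * x.2) < c * x.2 - s * x.1].
Proof.
move=> sg1 ta1 oA mono Aa nAb.
pose r : R := (Num.sqrt 2)^-1.
have r0 : 0 < r by rewrite invr_gt0 sqrtr_gt0.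
have r2 : r ^+ 2 = 2^-1 by rewrite exprVn sqr_sqrtr.
pose c := ta * r; pose s := - sg * r.
have cs : c ^+ 2 + s ^+ 2 = 1 by rewrite !exprMn sqrrN sg1 ta1 r2; lra.
pose P t h : R * R := (c * t - s * h, s * t + c * h).
pose T (x : R * R) := c * x.1 + s * x.2; pose H (x : R * R) := c * x.2 - s * x.1.
have PE x : P (T x) (H x) = x.
  case: x => x y; rewrite /P /T /H /=; congr pair.
    have -> : c * (c * x + s * y) - s * (c * y - s * x) = (c ^+ 2 + s ^+ 2) * x by ring.
    by rewrite cs mul1r.
  have -> : s * (c * x + s * y) + c * (c * y - s * x) = (c ^+ 2 + s ^+ 2) * y by ring.
  by rewrite cs mul1r.
have st2 : (sg * ta) ^+ 2 = 1 by rewrite exprMn sg1 ta1 mulr1.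
(* In the rotated coordinates [P], the orthant is the cone of steps whose rise is at least their
   horizontal length. *)
have cone t h t' h' : A (P t h) -> `|t - t'| <= h' - h -> A (P t' h').
  move=> AP; rewrite ler_norml => /andP[k1 k2].
  have st : -1 <= sg * ta <= 1.
    by rewrite -ler_norml -(@ler_pXn2r _ 2)// ?nnegrE// expr1n real_normK ?num_real// st2.
  have /andP[k3 k4] := st.
  have sp : 0 <= (h' - h) + sg * ta * (t' - t) by nra.
  have sm : 0 <= (h' - h) - sg * ta * (t' - t) by nra.
  apply: (mono _ _ AP); rewrite /P /= /c /s.
  - have -> : sg * (ta * r * t' - - sg * r * h' - (ta * r * t - - sg * r * h)) =
      r * (sg ^+ 2 * (h' - h) + sg * ta * (t' - t)) by ring.
    by rewrite sg1 mul1r mulr_ge0// ltW.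
  - have -> : ta * (- sg * r * t' + ta * r * h' - (- sg * r * t + ta * r * h)) =
      r * (ta ^+ 2 * (h' - h) - sg * ta * (t' - t)) by ring.
    by rewrite ta1 mul1r mulr_ge0// ltW.
pose E t := [set h | A (P t h)].
(* A point inside, moved up along a cone, shows that the fibre is nonempty; the point [b] outside
   bounds it below. *)
have hE t : has_inf (E t).
  split.
    exists (H a + `|T a - t|); apply: (cone (T a) (H a)); first by rewrite PE.
    by rewrite [leRHS]addrC addKr.
  exists (H b - `|T b - t|) => h AP; rewrite leNgt; apply/negP => hb.
  by apply: nAb; rewrite -(PE b); apply: cone AP _; rewrite distrC; lra.
pose gamma t := inf (E t).
exists c, s, gamma; split => //.
  apply: lipschitz1 => t t'.
  rewrite -lerBlDr; apply: lb_le_inf; first by case: (hE t).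
  move=> h Ah; rewrite lerBlDr; apply: ge_inf; first by case: (hE t').
  by apply: cone Ah _; rewrite [leRHS]addrC addKr.
move=> x; rewrite -/(T x) -/(H x); split => [Ax|].
  have /nbhs_ballP[e /= e0 eA] := open_nbhs_nbhs (conj oA Ax).
  have c1 : `|c| <= 1.
    by rewrite -(@ler_pXn2r _ 2)// ?nnegrE// expr1n real_normK ?num_real// -cs lerDl sqr_ge0.
  have s1 : `|s| <= 1.
    by rewrite -(@ler_pXn2r _ 2)// ?nnegrE// expr1n real_normK ?num_real// -cs lerDr sqr_ge0.
  (* Openness allows a small descent inside [A], which makes the inequality with the infimum
     strict. *)
  have Ae : A (P (T x) (H x - e / 2)).
    apply: eA; move: (PE x); move: (T x) (H x) => t h /(congr1 (fun x => (x.1, x.2))) [E1 E2].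
    have small k : `|k| <= 1 -> `|k * (e / 2)| < e.
      move=> k1; rewrite normrM (ger0_norm (x := e / 2)); last lra.
      by apply: (@le_lt_trans _ _ (1 * (e / 2))); [apply: ler_wpM2r => //; lra|lra].
    split; rewrite /ball /= -?E1 -?E2.
    - have -> : c * t - s * h - (c * t - s * (h - e / 2)) = - (s * (e / 2)) by ring.
      by rewrite normrN; exact: small.
    - have -> : s * t + c * h - (s * t + c * (h - e / 2)) = c * (e / 2) by ring.
      exact: small.
  apply: (@le_lt_trans _ _ (H x - e / 2)); last by lra.
  by apply: ge_inf => //; case: (hE (T x)).
move=> gx; have [h Ah hx] := inf_adherent (eps := H x - gamma (T x)) ltac:(by rewrite subr_gt0) (hE (T x)).
rewrite -(PE x); apply: cone Ah _; rewrite subrr normr0 subr_ge0.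
by move: hx; rewrite -/(gamma _); lra.
Qed.

Lemma open_fst_lt (a : R) : open [set x : R * R | x.1 < a].
Proof. by apply: (@open_comp _ _ fst [set t : R | t < a]); [move=> x _; exact: cvg_fst|exact: open_lt]. Qed.

Lemma open_fst_gt (a : R) : open [set x : R * R | a < x.1].
Proof. by apply: (@open_comp _ _ fst [set t : R | a < t]); [move=> x _; exact: cvg_fst|exact: open_gt]. Qed.

Lemma open_snd_lt (a : R) : open [set x : R * R | x.2 < a].
Proof. by apply: (@open_comp _ _ snd [set t : R | t < a]); [move=> x _; exact: cvg_snd|exact: open_lt]. Qed.

Lemma open_snd_gt (a : R) : open [set x : R * R | a < x.2].
Proof. by apply: (@open_comp _ _ snd [set t : R | a < t]); [move=> x _; exact: cvg_snd|exact: open_gt]. Qed.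

Lemma open_box (x0 x1 y0 y1 : R) : open (box x0 x1 y0 y1).
Proof.
have -> : box x0 x1 y0 y1 = ([set x : R * R | x0 < x.1] `&` [set x | x.1 < x1]) `&`
    ([set x | y0 < x.2] `&` [set x | x.2 < y1]).
  rewrite eqEsubset; split => x; first by move=> [/andP[? ?] /andP[? ?]].
  by move=> [[? ?] [? ?]]; split; apply/andP.
by apply: openI; apply: openI; [exact: open_fst_gt|exact: open_fst_lt|exact: open_snd_gt|exact: open_snd_lt].
Qed.

Lemma starshaped_connected A p : A p ->
  (forall q (t : R), A q -> 0 <= t <= 1 -> A (p.1 + t * (q.1 - p.1), p.2 + t * (q.2 - p.2))) ->
  connected A.
Proof.
move=> Ap star.
pose seg q : set (R * R) := [set (p.1 + t * (q.1 - p.1), p.2 + t * (q.2 - p.2)) | t in `[0, 1]%classic].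
have -> : A = \bigcup_(q in A) seg q.
  rewrite eqEsubset; split => [q Aq|x [q Aq [t]]].
    exists q => //; exists 1; first by rewrite /= in_itv /= lexx ler01.
    by rewrite !mul1r !(addrC _ (_ - _)) !subrK -surjective_pairing.
  by rewrite /= in_itv /= => t01 <-; exact: star.
apply: bigcup_connected.
  exists p => q Aq; exists 0; first by rewrite /= in_itv /= lexx ler01.
  by rewrite !mul0r !addr0 -surjective_pairing.
move=> q Aq; apply: connected_continuous_connected; first exact: segment_connected.
apply: continuous_subspaceT => t.
have aff (u v : R) : continuous (fun t : R => u + t * v).
  by move=> z; apply: cvgD; [exact: cvg_cst|apply: cvgMl; exact: cvg_id].
exact: (@cvg_pair _ _ _ (nbhs t) (nbhs (p.1 + t * (q.1 - p.1))) (nbhs (p.2 + t * (q.2 - p.2)))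
  _ _ _ _ _ (@aff _ _ t) (@aff _ _ t)).
Qed.

End orthant_graphs.

(** * The horn is a bounded Lipschitz domain *)

Section horn_domain.
Context {R : realType}.
Local Notation plane := (measurableTypeR R * measurableTypeR R)%type.
Local Notation mu2 := (@lebesgue2 R).
Variables (S n : nat).
Hypothesis S0 : (0 < S)%N.
Local Notation Om := (@horn R S n).

Let S1 : 1 <= S%:R :> R. Proof. by rewrite ler1n. Qed.
Let q0 i : 0 < 4^-1 ^+ i :> R. Proof. by rewrite exprn_gt0. Qed.
Let q1 i : 4^-1 ^+ i <= 1 :> R. Proof. by apply: exprn_ile1; lra. Qed.

Lemma open_horn : open Om.
Proof.
have -> : Om = box 0 S%:R 0 S%:R `|`
    \bigcup_(i in [set i | (i <= n)%N]) box 0 ((S + i)%:R + 1) 0 (4^-1 ^+ i).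
  by rewrite eqEsubset; split => p [bp|[i ni bp]]; [left|right; exists i|left|right; exists i].
by apply: openU; [exact: open_box|apply: bigcup_open => i _; exact: open_box].
Qed.

(** Half the height of the thinnest box, so that the point lies in all of them. *)
Let center : R * R := (2^-1, 4^-1 ^+ n / 2).

Let center_box i : (i <= n)%N -> box 0 ((S + i)%:R + 1) 0 (4^-1 ^+ i) center.
Proof.
move=> ni; have h1 := S1; have h2 := q0 n.
have h3 : 4^-1 ^+ n <= 4^-1 ^+ i :> R by apply: ler_wiXn2l => //; lra.
have h4 : S%:R <= (S + i)%:R :> R by rewrite ler_nat leq_addr.
by split; rewrite /=; apply/andP; split; lra.
Qed.

Let center_square : box 0 S%:R 0 S%:R center.
Proof.
have h1 := S1; have h2 := q0 n; have h3 := q1 n.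
by split; rewrite /=; apply/andP; split; lra.
Qed.

Lemma box_starshaped (x1 y1 : R) p q (t : R) : box 0 x1 0 y1 p -> box 0 x1 0 y1 q -> 0 <= t <= 1 ->
  box 0 x1 0 y1 (p.1 + t * (q.1 - p.1), p.2 + t * (q.2 - p.2)).
Proof.
move=> [/andP[a1 a2] /andP[a3 a4]] [/andP[b1 b2] /andP[b3 b4]] /andP[t0 t1].
have conv (a b c : R) : 0 < a -> 0 < b -> a < c -> b < c -> 0 < a + t * (b - a) < c.
  move=> h1 h2 h3 h4; have -> : a + t * (b - a) = (1 - t) * a + t * b by ring.
  have [te|tn] := eqVneq t 0; first by rewrite te; apply/andP; split; lra.
  have tp : 0 < t by rewrite lt_neqAle eq_sym tn.
  have k0 : 0 <= 1 - t by rewrite subr_ge0.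
  have m1 := mulr_gt0 tp h2; have m2 := mulr_ge0 k0 (ltW h1).
  have m3 : t * b < t * c by rewrite ltr_pM2l.
  have m4 := ler_wpM2l k0 (ltW h3).
  by apply/andP; split; lra.
by split; exact: conv.
Qed.

Lemma connected_horn : connected Om.
Proof.
apply: (@starshaped_connected _ Om center); first by left.
move=> q t [h|[i ni h]] t01; first by left; exact: box_starshaped.
by right; exists i => //; apply: box_starshaped => //; exact: center_box.
Qed.

Lemma bounded_horn : bounded_set Om.
Proof.
exists ((S + n)%:R + 1); split; first exact: num_real.
move=> M hM p /(horn_sub_box S0) [/andP[h1 h2] /andP[h3 h4]].
have h5 : S%:R <= (S + n)%:R :> R by rewrite ler_nat leq_addr.
by rewrite /= prod_normE ge_max !ger0_norm ?(ltW h1) ?(ltW h3)//; apply/andP; split; lra.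
Qed.

Let closure_ge0 p : closure Om p -> 0 <= p.1 /\ 0 <= p.2.
Proof.
move=> cp; split; rewrite leNgt; apply/negP => h.
- have /cp[x [Ox xp]] : nbhs p [set x : R * R | x.1 < 0].
    by apply: open_nbhs_nbhs; split => //; exact: open_fst_lt.
  by have [/andP[h1 _] _] := horn_sub_box S0 Ox; have := lt_trans h1 xp; rewrite ltxx.
- have /cp[x [Ox xp]] : nbhs p [set x : R * R | x.2 < 0].
    by apply: open_nbhs_nbhs; split => //; exact: open_snd_lt.
  by have [_ /andP[h1 _]] := horn_sub_box S0 Ox; have := lt_trans h1 xp; rewrite ltxx.
Qed.

Let near_open p (A : set (R * R)) : open A -> A p -> \forall x \near p, A x.
Proof. by move=> oA Ap; exact: open_nbhs_nbhs. Qed.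

Let sqr1 : (1 : R) ^+ 2 = 1. Proof. by rewrite expr1n. Qed.
Let sqrN1 : (-1 : R) ^+ 2 = 1. Proof. by rewrite sqrrN expr1n. Qed.

(** Boundary points are sorted by which coordinates are positive. In each case the horn agrees
    nearby with an open set stable under translation by one orthant, so edges, convex corners and
    re-entrant corners need no separate treatment. *)
Lemma horn_lipschitz_boundary : lipschitz_boundary Om.
Proof.
move=> p [cp _]; have [p1 p2] := closure_ge0 cp.
suff [A [sg [ta [a [b [[s1 t1 oA mA Aa] [nAb OA]]]]]]] : exists A sg ta a b,
    [/\ sg ^+ 2 = 1, ta ^+ 2 = 1, open A,
      (forall p q : R * R, A p -> 0 <= sg * (q.1 - p.1) -> 0 <= ta * (q.2 - p.2) -> A q) & A a] /\
    (~ A b /\ \forall x \near p, Om x <-> A x).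
  have [c [s [g [cs lg AP]]]] := orthant_graph s1 t1 oA mA Aa nAb.
  exists c, s, g; split => //.
  by apply: filterS OA => x OAx; rewrite OAx; exact: AP.
have h1 := S1.
have [p1'|p1'] := ltP 0 p.1; have [p2'|p2'] := ltP 0 p.2.
(* Away from both axes only the upper right staircase is seen; dropping the lower bounds of the
   boxes leaves a union of lower left quadrants. *)
- pose A := [set x : R * R | x.1 < S%:R] `&` [set x | x.2 < S%:R] `|`
    \bigcup_(i in [set i | (i <= n)%N]) ([set x : R * R | x.1 < (S + i)%:R + 1] `&` [set x | x.2 < 4^-1 ^+ i]).
  exists A, (-1), (-1), (0, 0), (0, S%:R); split; [split => //|split].
  + apply: openU; first by apply: openI; [exact: open_fst_lt|exact: open_snd_lt].
    by apply: bigcup_open => i _; apply: openI; [exact: open_fst_lt|exact: open_snd_lt].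
  + move=> x y [[/= k1 k2]|[i ni [/= k1 k2]]] m1 m2; [left|right; exists i => //]; split => /=; lra.
  + by left; split => /=; lra.
  + by move=> [[/= k1 k2]|[i ni [/= k1 k2]]]; [lra|have := q1 i; lra].
  + have := near_open (@open_fst_gt _ 0) p1'; have := near_open (@open_snd_gt _ 0) p2'.
    apply: filterS2 => x x2 x1; split.
      move=> [[/andP[_ k1] /andP[_ k2]]|[i ni [/andP[_ k1] /andP[_ k2]]]]; first by left.
      by right; exists i.
    move=> [[/= k1 k2]|[i ni [/= k1 k2]]]; first by left; split; apply/andP.
    by right; exists i => //; split; apply/andP.
(* Along the bottom, below the height of the thinnest box, the horn is a strip ending at the tip;
   this covers the lower right corner. *)
- pose A := [set x : R * R | x.1 < (S + n)%:R + 1] `&` [set x | 0 < x.2].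
  exists A, (-1), 1, (0, 1), (0, 0); split; [split => //|split].
  + by apply: openI; [exact: open_fst_lt|exact: open_snd_gt].
  + by move=> x y [/= k1 k2] m1 m2; split => /=; lra.
  + by split => /=; [rewrite ltr_wpDl|lra].
  + by move=> [/= _]; rewrite ltxx.
  + have := near_open (@open_fst_gt _ 0) p1'.
    have := near_open (@open_snd_lt _ (4^-1 ^+ n)) (le_lt_trans p2' (q0 n)).
    apply: filterS2 => x /= x2 x1; split.
      by move=> /(horn_sub_box S0) [/andP[_ k1] /andP[k2 _]].
    by move=> [/= k1 k2]; right; exists n => //; split; apply/andP.
- pose A := [set x : R * R | 0 < x.1] `&` [set x | x.2 < S%:R].
  exists A, 1, (-1), (1, 0), (0, 0); split; [split => //|split].
  + by apply: openI; [exact: open_fst_gt|exact: open_snd_lt].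
  + by move=> x y [/= k1 k2] m1 m2; split => /=; lra.
  + by split => /=; lra.
  + by move=> [/=]; rewrite ltxx.
  + have := near_open (@open_snd_gt _ 0) p2'.
    have := near_open (@open_fst_lt _ S%:R) (le_lt_trans p1' (lt_le_trans ltr01 h1)).
    apply: filterS2 => x /= x1 x2; split.
      by move=> /(horn_sub_box S0) [/andP[k1 _] /andP[_ k2]].
    by move=> [/= k1 k2]; left; split; apply/andP.
- pose A := [set x : R * R | 0 < x.1] `&` [set x | 0 < x.2].
  exists A, 1, 1, (1, 1), (0, 0); split; [split => //|split].
  + by apply: openI; [exact: open_fst_gt|exact: open_snd_gt].
  + by move=> x y [/= k1 k2] m1 m2; split => /=; lra.
  + by split => /=; exact: ltr01.
  + by move=> [/=]; rewrite ltxx.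
  + have := near_open (@open_snd_lt _ S%:R) (le_lt_trans p2' (lt_le_trans ltr01 h1)).
    have := near_open (@open_fst_lt _ S%:R) (le_lt_trans p1' (lt_le_trans ltr01 h1)).
    apply: filterS2 => x /= x1 x2; split.
      by move=> /(horn_sub_box S0) [/andP[k1 _] /andP[k2 _]].
    by move=> [/= k1 k2]; left; split; apply/andP.
Qed.

Lemma horn_domain : bounded_lipschitz_domain Om.
Proof.
split; [by exists center; left|exact: open_horn|exact: connected_horn|exact: bounded_horn|].
exact: horn_lipschitz_boundary.
Qed.

End horn_domain.

(** * Area and diameter of the horn *)

Section horn_size.
Context {R : realType}.
Local Notation plane := (measurableTypeR R * measurableTypeR R)%type.
Local Notation mu2 := (@lebesgue2 R).
Variables (S n : nat).
Hypothesis S0 : (0 < S)%N.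
Local Notation Om := (@horn R S n).

Let S1 : 1 <= S%:R :> R. Proof. by rewrite ler1n. Qed.
Let mOm : measurable (Om : set plane). Proof. exact: measurable_horn. Qed.
Let fOm : (mu2 (Om : set plane) < +oo)%E. Proof. exact: horn_finite. Qed.

Let L1 (D : set plane) : measurable D -> (mu2 D < +oo)%E -> L2 D (cst 1 : R * R -> R).
Proof. by move=> mD fD; apply: (bounded_L2 mD fD (M := 1)) => // x _; rewrite normr1. Qed.

Let areaE : area Om = inner Om (cst 1) (cst 1).
Proof.
have -> : inner Om (cst 1 : R * R -> R) (cst 1) = \int[mu2]_(x in (Om : set plane)) (1 : R).
  by apply: eq_Rintegral => x _; rewrite /= mulr1.
by rewrite Rintegral_cst// mul1r.
Qed.

Let sum_halves m : \sum_(i < m) 2^-1 ^+ i <= 2 :> R.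
Proof.
suff : \sum_(i < m) 2^-1 ^+ i + 2 * 2^-1 ^+ m <= 2 :> R.
  by apply: le_trans; rewrite lerDl mulr_ge0// exprn_ge0.
elim: m => [|m IH]; first by rewrite big_ord0 expr0; lra.
by rewrite big_ord_recr /= exprS; lra.
Qed.

Let box_le (x1 y1 : R) : 0 <= x1 -> 0 <= y1 ->
  inner (box 0 x1 0 y1) (cst 1 : R * R -> R) (cst 1) <= x1 * y1.
Proof.
move=> x10 y10; have := @inner_box_bound R 0 x1 0 y1 1 (cst 1) x10 y10.
rewrite expr1n mul1r !subr0; apply; last by move=> p; rewrite normr1.
exact: L1 (measurable_box _ _ _ _) (box_finite _ _ _ _).
Qed.

Lemma horn_area_le : area Om <= S%:R ^+ 2 + 2 * (S%:R + 1).
Proof.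
rewrite areaE.
pose D (i : option 'I_n.+1) : set plane :=
  if i is Some i then box 0 ((S + i)%:R + 1) 0 (4^-1 ^+ i) else box 0 S%:R 0 S%:R.
have := @covering_inner R _ (Om : set plane) D set0 (cst 1) mOm.
move=> /(_ _ _ (L1 mOm fOm) measurable0 (measure0 _)) => H; apply: (le_trans (H _ _ _)).
- by case=> [i|]; exact: measurable_box.
- case=> [i|] p h; last by left.
  by right; exists i => //; rewrite -ltnS.
- move=> p [h _|[i ni h] _]; first by exists None.
  by have ni' : (i < n.+1)%N by []; exists (Some (Ordinal ni')).
have -> : \sum_i inner (D i) (cst 1 : R * R -> R) (cst 1) = inner (D None) (cst 1) (cst 1) +
    \sum_(i < n.+1) inner (D (Some i)) (cst 1) (cst 1).
  rewrite (bigD1 None)//=; congr (_ + _); rewrite (reindex_omap Some id)//= => [|[i|]//].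
  by apply: eq_big => [i|i _]//; rewrite eqxx.
apply: lerD; first by rewrite expr2; exact: box_le.
(* The full boxes are summed, overlaps included: S + i + 1 <= (S + 1) (i + 1) <= (S + 1) 2^i turns
   the factor 4^-i into 2^-i, which is summable uniformly in [n]. *)
apply: (@le_trans _ _ (\sum_(i < n.+1) (S%:R + 1) * 2^-1 ^+ i)); last first.
  by rewrite -mulr_sumr mulrC ler_wpM2r ?addr_ge0.
apply: ler_sum => i _.
have q0 : 0 <= 4^-1 ^+ i :> R by apply: exprn_ge0.
apply: (le_trans (box_le _ q0)); first by rewrite addr_ge0.
have -> : 2^-1 ^+ i = 2 ^+ i * 4^-1 ^+ i :> R.
  by rewrite -exprMn; congr (_ ^+ _); lra.
rewrite mulrA ler_wpM2r//.
have i2 : i.+1%:R <= 2 ^+ i :> R by rewrite -natrX ler_nat ltn_expl.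
apply: (@le_trans _ _ ((S%:R + 1) * i.+1%:R)); last by rewrite ler_wpM2l// addr_ge0.
rewrite natrD -natr1; have : 0 <= i%:R :> R by []. have := S1; nra.
Qed.

Lemma horn_area_ge1 : 1 <= area Om.
Proof.
rewrite areaE; have mQ := measurable_box 0 S%:R 0 (S%:R : R).
have QOm : box 0 S%:R 0 S%:R `<=` Om by move=> p; left.
apply: le_trans (inner_subset mOm mQ QOm (L1 mOm fOm)).
have -> : inner (box 0 S%:R 0 S%:R) (cst 1 : R * R -> R) (cst 1) =
    \int[mu2]_(x in (box 0 S%:R 0 S%:R : set plane)) (1 : R).
  by apply: eq_Rintegral => x _; rewrite /= mulr1.
rewrite Rintegral_cst// mul1r (box_area (ler0n _ _) (ler0n _ _)) /= !subr0.
by have := S1; nra.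
Qed.

Lemma horn_diameter_ge : n%:R <= diameter Om.
Proof.
have h1 := S1; have q0 : 0 < 4^-1 ^+ n :> R by rewrite exprn_gt0.
(* Two points at half the height of the longest box, at distance S + n - 1/2. *)
pose y : R := 4^-1 ^+ n / 2; pose q : R * R := ((S + n)%:R, y); pose p : R * R := (2^-1, y).
have h2 : S%:R <= (S + n)%:R :> R by rewrite ler_nat leq_addr.
have inOm x : 0 < x -> x < (S + n)%:R + 1 -> Om (x, y).
  by move=> x0 xn; right; exists n => //; split => /=; apply/andP; split=> //; rewrite /y; lra.
have dist : euclidean_dist q p = (S + n)%:R - 2^-1.
  by rewrite /euclidean_dist /= subrr expr0n addr0 sqrtr_sqr ger0_norm//; lra.
apply: (@le_trans _ _ (euclidean_dist q p)).
  by rewrite dist natrD; lra.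
apply: ub_le_sup; last by exists (q, p) => //; split; apply: inOm; lra.
(* A lower bound by a member of the set needs the set to be bounded above, as [sup] has a default
   value otherwise. *)
exists (Num.sqrt (((S + n)%:R + 1) ^+ 2 + ((S + n)%:R + 1) ^+ 2)) => _ [[a b] [/= Oa Ob] <-].
have [/andP[a1 a2] /andP[a3 a4]] := horn_sub_box S0 Oa.
have [/andP[b1 b2] /andP[b3 b4]] := horn_sub_box S0 Ob.
have sq (u v : R) : 0 < u -> 0 < v -> u < (S + n)%:R + 1 -> v < (S + n)%:R + 1 ->
    (u - v) ^+ 2 <= ((S + n)%:R + 1) ^+ 2.
  move=> u0 v0 u1 v1; rewrite -[(u - v) ^+ 2](real_normK (num_real _)).
  apply: lerXn2r; rewrite ?nnegrE ?normr_ge0 ?addr_ge0//.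
  by rewrite ler_norml; apply/andP; split; lra.
by rewrite ler_sqrt ?addr_ge0 ?sqr_ge0//; apply: lerD; apply: sq => //=; lra.
Qed.

End horn_size.
Theorem theorem4p3 (R : realType) :
  exists Omega : nat -> set (R * R),
    [/\ forall k, bounded_lipschitz_domain (Omega k),
        (fun k => diameter (Omega k) / Num.sqrt (area (Omega k))) @ \oo --> +oo &
        exists M : nat, forall k, (neumann_count (Omega k) <= M%:R%:E)%E].
Proof.
have [S [S0 [M count]]] := @horn_neumann_count R.
exists (fun k => horn S k); split; [|apply/cvgryPge => A|by exists M].
  by move=> k; exact: horn_domain.
pose B := Num.sqrt (S%:R ^+ 2 + 2 * (S%:R + 1)) : R.
(* From this index on, [k] exceeds |A| [B], while the diameter is at least [k] and the root of the
   area at most [B]; the absolute value covers negative thresholds. *)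
exists (Num.truncn (`|A| * B)).+1 => // k /= kA.
have a1 := horn_area_ge1 k S0 : 1 <= area (horn S k : set (R * R)).
have s0 : 0 < Num.sqrt (area (horn S k : set (R * R))).
  by rewrite sqrtr_gt0 (lt_le_trans ltr01).
have sB : Num.sqrt (area (horn S k : set (R * R))) <= B.
  by apply: ler_wsqrtr; exact: horn_area_le.
rewrite ler_pdivlMr//; apply: le_trans (horn_diameter_ge k S0).
apply: (@le_trans _ _ (`|A| * B)).
  apply: (le_trans (ler_wpM2r (ltW s0) (ler_norm A))).
  exact: ler_wpM2l.
apply: ltW; apply: (lt_le_trans (truncnS_gt _)).
by rewrite ler_nat.
Qed.
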